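(* Let $A{_\tau\times_\sigma}B$ be a smash biproduct bialgebra such that $\sigma$ is right conormal and $\tau$ is right normal. Then $A{_\tau\times_\sigma}B$ admits a quasitriangular structure if and only if there exist normalized elements $W=\sum W^1\otimes W^2\in B\otimes B$, $X=\sum X^1\otimes X^2\in A\otimes B$, $Y=\sum Y^1\otimes Y^2\in B\otimes A$ and $Z=\sum Z^1\otimes Z^2\in A\otimes A$ satisfying the following identities C1')–C19') for all $a\in A$, $b\in B$: C1') $\sum Z^1_{\tau_1\tau_2}\bar X^1_{\tau_3}X^1a_{(1)\sigma_2}\,\epsilon_B((W^1Y^1)_{\sigma_2})\otimes Z^2Y^2_{\sigma_1}\,\epsilon_B(\bar X^2_{\tau_1\sigma_1})\,a_{(2)\sigma_3}\,\epsilon_B((X^2_{\tau_3\tau_2}W^2)_{\sigma_3})=\sum a_{(2)\tau}Z^1\otimes a_{(1)}Z^2_\sigma\,\epsilon_B(1_{B\tau\sigma})$; C2') $\sum X^1a_\sigma\,\epsilon_B(W^1_\sigma)\otimes X^2W^2=\sum a_\tau X^1\otimes X^2_\tau$; C3') $\sum W^1Y^11_{B\tau}\otimes Y^2a_{\tau\sigma}\,\epsilon_B(W^2_\sigma)=\sum Y^1\otimes aY^2$; C4') $\sum Z^1\otimes Z^2\epsilon_B(b)=\sum Z^1_{\sigma_1}\otimes Z^2_{\sigma_2}\,\epsilon_B(b_{\sigma_2\sigma_1})$; C5') $\sum X^1\otimes X^2b=\sum X^1_\sigma\,\epsilon_B(b_{(2)\sigma})\otimes b_{(1)}X^2$; C6')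 $\sum Y^1b\otimes Y^2=\sum b_\sigma Y^1\otimes Y^2_\sigma$; C7') $\sum W^1b_{(1)}\otimes W^2b_{(2)}=\sum b_{(2)}W^1\otimes b_{(1)}W^2$; C8') $\sum Z^1_{(1)}\otimes Z^1_{(2)}\otimes Z^2=\sum Z^1_\tau X^1\otimes\bar Z^1\otimes Z^2\bar Z^2_\sigma\,\epsilon_B(X^2_{\tau\sigma})$; C9') $\sum X^1_{(1)}\otimes X^1_{(2)}\otimes X^2=\sum X^1\otimes\bar X^1\otimes X^2\bar X^2$; C10') $\sum Y^1_{\tau_1}\otimes(Z^1_{\tau_2}X^1)_{\tau_1}\otimes Z^2Y^2_\sigma\,\epsilon_B(X^2_{\tau_2\sigma})=\sum W^1Y^1\otimes Z^1\otimes Y^2Z^2_\sigma\,\epsilon_B(W^2_\sigma)$; C11') $\sum W^1_\tau\otimes X^1_\tau\otimes X^2W^2=\sum W^1\otimes X^1\otimes W^2X^2$; C12') $\sum Y^1_{(1)}\otimes Y^1_{(2)}\otimes Y^2=\sum W^1Y^1\otimes\bar Y^1\otimes Y^2\bar Y^2_\sigma\,\epsilon_B(W^2_\sigma)$; C13') $\sum W^1_{(1)}\otimes W^1_{(2)}\otimes W^2=\sum W^1\otimes\bar W^1\otimes W^2\bar W^2$; C14') $\sum Z^1\otimes Z^2_{(1)}\otimes Z^2_{(2)}=\sum Z^1_\tau X^1\bar Z^1_{\sigma_1}\,\epsilon_B(Y^1_{\sigma_1})\otimes\bar Z^2\otimes Z^2Y^2_{\sigma_2}\,\epsilon_B(X^2_{\tau\sigma_2})$;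 C15') $\sum Z^1_{\tau_1}X^1\otimes X^2_{\tau_1\tau_2}\otimes Z^2_{\tau_2}=\sum Z^1_\tau X^1\bar X^1_{\sigma_1}\,\epsilon_B(Y^1_{\sigma_1})\otimes\bar X^2\otimes Z^2Y^2_{\sigma_2}\,\epsilon_B(X^2_{\tau\sigma_2})$; C16') $\sum X^1\otimes X^2_{(1)}\otimes X^2_{(2)}=\sum X^1\bar X^1_\sigma\,\epsilon_B(W^1_\sigma)\otimes\bar X^2\otimes X^2W^2$; C17') $\sum Y^1\otimes Y^2_{(1)}\otimes Y^2_{(2)}=\sum Y^1\bar Y^1\otimes\bar Y^2\otimes Y^2$; C18') $\sum W^1Y^1\otimes W^2_\tau\otimes Y^2_\tau=\sum Y^1W^1\otimes W^2\otimes Y^2$; C19') $\sum W^1\otimes W^2_{(1)}\otimes W^2_{(2)}=\sum W^1\bar W^1\otimes\bar W^2\otimes W^2$. In this case, the quasitriangular structure is given as $$\alpha=\sum Z^1_{\tau_1\tau_2}\bar X^1_{\tau_3}X^1\otimes W^1Y^1\otimes Z^2Y^2_\sigma\,\epsilon_B(\bar X^2_{\tau_1\sigma})\otimes X^2_{\tau_3\tau_2}W^2\in(A\otimes B)\otimes(A\otimes B).$$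
   Context: Everything is over a field $\Bbbk$. Algebras are associative and unital, coalgebras coassociative and counital; $\Delta(c)=\sum c_{(1)}\otimes c_{(2)}$. Smash product: for algebras $A,B$ and a linear map $\sigma:B\otimes A\to A\otimes B$, written $\sigma(b\otimes a)=\sum a_\sigma\otimes b_\sigma$, consider on $A\otimes B$ the multiplication $(a\otimes b)(a'\otimes b')=\sum aa'_\sigma\otimes b_\sigma b'$. If it is associative with unit $1_A\otimes 1_B$, this algebra is the smash product $A\#_\sigma B$. Smash coproduct: for coalgebras $A,B$ and a linear map $\tau:A\otimes B\to B\otimes A$, written $\tau(a\otimes b)=\sum b_\tau\otimes a_\tau$, consider on $A\otimes B$ the comultiplication $a\otimes b\mapsto\sum a_{(1)}\otimes b_{(1)\tau}\otimes a_{(2)\tau}\otimes b_{(2)}$. If it is coassociative with counit $\epsilon_A\otimes\epsilon_B$, this coalgebra is the smash coproduct $A{_\tau\ltimes}B$. Smash biproduct: if $A,B$ are both algebras and coalgebras (neither necessarily a bialgebra), $A\#_\sigma B$ is a smash product, $A{_\tau\ltimes}B$ is a smash coproduct, and $A\otimes B$ with these two structures is a bialgebra, this bialgebra is denoted $A{_\tau\times_\sigma}B$ and called a smash biproduct bialgebra. Standing assumption: for every smash biproduct bialgebra, $A$ and $B$ are counital algebras via $\epsilon_A,\epsilon_B$ (i.e. $\epsilon_A,\epsilon_B$ are algebra maps to $\Bbbk$) and unital coalgebras via $\eta_A,\eta_B$ (i.e. the unit maps $\Bbbk\to A$, $\Bbbk\to B$ are coalgebra maps). $\sigma$ is right conormal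 if $\sum\epsilon_A(a_\sigma)b_\sigma=\epsilon_A(a)b$ for all $a\in A,b\in B$. $\tau$ is right normal if $\tau(1_A\otimes b)=\sum b_\tau\otimes 1_{A\tau}=b\otimes 1_A$ for all $b\in B$. A quasitriangular structure of a bialgebra $H$ is an element $\mathcal R=\sum\mathcal R^1\otimes\mathcal R^2\in H\otimes H$ (not required invertible) with: (QT1) $(\epsilon_H\otimes id)(\mathcal R)=1_H=(id\otimes\epsilon_H)(\mathcal R)$; (QT2) $(\Delta_H\otimes id)(\mathcal R)=\mathcal R_{13}\mathcal R_{23}$; (QT3) $(id\otimes\Delta_H)(\mathcal R)=\mathcal R_{13}\mathcal R_{12}$; (QT4) $\mathcal R\Delta_H(h)=\Delta_H^{cop}(h)\mathcal R$ for all $h\in H$. For $H=A{_\tau\times_\sigma}B$, $H\otimes H=A\otimes B\otimes A\otimes B$. Normalized elements: $W\in B\otimes B$ is normalized if $\sum\epsilon_B(W^1)W^2=1_B=\sum W^1\epsilon_B(W^2)$; $X\in A\otimes B$ if $\sum\epsilon_A(X^1)X^2=1_B$ and $\sum X^1\epsilon_B(X^2)=1_A$; $Y\in B\otimes A$ if $\sum\epsilon_B(Y^1)Y^2=1_A$ and $\sum Y^1\epsilon_A(Y^2)=1_B$; $Z\in A\otimes A$ if $\sum\epsilon_A(Z^1)Z^2=1_A=\sum Z^1\epsilon_A(Z^2)$. Index notation: $\sigma_i$ (resp. $\tau_i$) is a copy of $\sigma$ (resp. $\tau$). If an index $\sigma_i$ appears on an element coming from $B$ and on an element coming from $A$, then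 $\sigma_i$ has been applied to ($B$-element)$\otimes$($A$-element); similarly $\tau_i$ is applied to ($A$-element)$\otimes$($B$-element). Several subscripts on one element are applied successively from left to right (including comultiplication subscripts $(1),(2)$); an index on a bracketed product applies to the product. Each occurrence of $1_A$ or $1_B$ carries its own indices. Decorated letters such as $\bar X=\sum\bar X^1\otimes\bar X^2$ denote further copies of the same element $X$ (likewise for $W,Y,Z$). For example, in $\alpha$: $\tau_1$ is applied to $Z^1\otimes\bar X^2$; $\tau_3$ is applied to $\bar X^1\otimes X^2$, then $\tau_2$ to $Z^1_{\tau_1}\otimes X^2_{\tau_3}$; $\sigma$ is applied to $\bar X^2_{\tau_1}\otimes Y^2$. *)

(* Defs.v *)
From HB Require Import structures.
From mathcomp Require Import all_boot all_order all_algebra.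
From mathcomp Require Import boolp.

Set Implicit Arguments.
Unset Strict Implicit.
Unset Printing Implicit Defensive.

Import GRing.Theory.
Local Open Scope ring_scope.
Local Open Scope quotient_scope.

(* U ⨂ V is the space, u ⊗ v a pure tensor in it; u ⊗ v ⊗ w is (u ⊗ v) ⊗ w. *)
Reserved Notation "U ⨂ V" (at level 45, left associativity).
Reserved Notation "u ⊗ v" (at level 45, left associativity).
Reserved Notation "'∑_(' u ⊗ v '<-' t ) E"
  (at level 46, u name, v name, t at level 45, E at level 46, right associativity,
   format "'[' '∑_(' u  ⊗  v  '<-'  t ) '/  '  E ']'").

(* The tensor product of two vector spaces is built as the quotient of the
   finite formal sums [:: (u1, v1); ...; (un, vn)], standing for
   u1 ⊗ v1 + ... + un ⊗ vn, by the congruence generated by bilinearity.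
   [tens_bilinear], [tensor_univ] and [tensor_univ_uniq] below state that it
   has the universal property. *)
Section Tensor.
Variables (K : fieldType) (U V : lmodType K).

Inductive tensor_rel : seq (U * V) -> seq (U * V) -> Prop :=
| TRrefl s : tensor_rel s s
| TRsym s t : tensor_rel s t -> tensor_rel t s
| TRtrans s t r : tensor_rel s t -> tensor_rel t r -> tensor_rel s r
| TRcat s s' t t' :
    tensor_rel s s' -> tensor_rel t t' -> tensor_rel (s ++ t) (s' ++ t')
| TRcatC s t : tensor_rel (s ++ t) (t ++ s)
| TRaddl u u' v : tensor_rel [:: (u + u', v)] [:: (u, v); (u', v)]
| TRaddr u v v' : tensor_rel [:: (u, v + v')] [:: (u, v); (u, v')]
| TRscale a u v : tensor_rel [:: (a *: u, v)] [:: (u, a *: v)]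
| TR0 v : tensor_rel [:: (0, v)] [::].

Definition tensor_relb (s t : seq (U * V)) : bool := `[< tensor_rel s t >].

Lemma tensor_relb_refl : reflexive tensor_relb.
Proof. by move=> s; apply/asboolP; constructor. Qed.

Lemma tensor_relb_sym : symmetric tensor_relb.
Proof. by move=> s t; apply/asboolP/asboolP; apply: TRsym. Qed.

Lemma tensor_relb_trans : transitive tensor_relb.
Proof. by move=> t s r /asboolP st /asboolP tr; apply/asboolP/(TRtrans st tr). Qed.

Canonical tensor_equiv :=
  EquivRel tensor_relb tensor_relb_refl tensor_relb_sym tensor_relb_trans.

Definition tensor : Type := {eq_quot tensor_equiv}.

HB.instance Definition _ := Choice.on tensor.
HB.instance Definition _ := EqQuotient.on tensor.

Definition tens_class (s : seq (U * V)) : tensor := \pi_tensor s.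

Lemma tens_classP s t : tens_class s = tens_class t <-> tensor_rel s t.
Proof.
split; first by move=> e; apply/asboolP; have /eqmodP := e.
by move=> st; apply/eqmodP/asboolP.
Qed.

Lemma tens_class_repr (t : tensor) : tens_class (repr t) = t.
Proof. exact: reprK. Qed.

Lemma repr_tens_class s : tensor_rel (repr (tens_class s)) s.
Proof. by apply/tens_classP; rewrite tens_class_repr. Qed.

Definition tens (u : U) (v : V) : tensor := tens_class [:: (u, v)].

Definition scale_sum (a : K) (s : seq (U * V)) := [seq (a *: p.1, p.2) | p <- s].

Lemma scale_sum_rel a s t :
  tensor_rel s t -> tensor_rel (scale_sum a s) (scale_sum a t).
Proof.
elim=> {s t} [s|s t _|s t r _ st _|s s' t t' _ ss _|s t|u u' v|u v v'|b u v|v] /=.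
- exact: TRrefl.
- exact: TRsym.
- exact: TRtrans st.
- by move=> tt; rewrite /scale_sum !map_cat; apply: TRcat.
- by rewrite /scale_sum !map_cat; apply: TRcatC.
- by rewrite scalerDr; apply: TRaddl.
- exact: TRaddr.
- by rewrite scalerA mulrC -scalerA; apply: TRscale.
- by rewrite scaler0; apply: TR0.
Qed.

Definition tensor_zero : tensor := tens_class [::].
Definition tensor_add (x y : tensor) : tensor := tens_class (repr x ++ repr y).
Definition tensor_scale (a : K) (x : tensor) : tensor :=
  tens_class (scale_sum a (repr x)).
Definition tensor_opp (x : tensor) : tensor := tensor_scale (-1) x.

Lemma tens_class_cat s t :
  tensor_add (tens_class s) (tens_class t) = tens_class (s ++ t).
Proof. by apply/tens_classP/TRcat; apply: repr_tens_class. Qed.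

Lemma tens_class_scale a s :
  tensor_scale a (tens_class s) = tens_class (scale_sum a s).
Proof. exact/tens_classP/scale_sum_rel/repr_tens_class. Qed.

Lemma tensor_addA : associative tensor_add.
Proof.
move=> x y z; rewrite -(tens_class_repr x) -(tens_class_repr y).
by rewrite -(tens_class_repr z) !tens_class_cat catA.
Qed.

Lemma tensor_addC : commutative tensor_add.
Proof. by move=> x y; apply/tens_classP/TRcatC. Qed.

Lemma tensor_add0 : left_id tensor_zero tensor_add.
Proof. by move=> x; rewrite -{1}(tens_class_repr x) tens_class_cat tens_class_repr. Qed.

Lemma tensor_scaleDl x a b :
  tensor_scale (a + b) x = tensor_add (tensor_scale a x) (tensor_scale b x).
Proof.
rewrite -(tens_class_repr x) !tens_class_scale tens_class_cat; apply/tens_classP.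
elim: (repr x) => [|[u v] s IHs] /=; first exact: TRrefl.
apply: (TRtrans (TRcat (TRrefl [:: _]) IHs)); rewrite scalerDl.
apply: (TRtrans (TRcat (TRaddl _ _ _) (TRrefl _))).
apply: (TRcat (TRrefl [:: _])).
rewrite -[(b *: u, v) :: scale_sum b s]/([:: (b *: u, v)] ++ scale_sum b s) catA.
by rewrite -cat1s catA; apply: TRcat (TRcatC [:: _] _) (TRrefl _).
Qed.

Lemma tensor_scaleA a b x : tensor_scale a (tensor_scale b x) = tensor_scale (a * b) x.
Proof.
rewrite -(tens_class_repr x) !tens_class_scale /scale_sum -map_comp.
by congr tens_class; apply: eq_map => p /=; rewrite scalerA.
Qed.

Lemma tensor_scale1 : left_id 1 tensor_scale.
Proof.
move=> x; rewrite -[in LHS](tens_class_repr x) tens_class_scale -[RHS]tens_class_repr.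
by congr tens_class; rewrite -[RHS]map_id; apply: eq_map => -[u v] /=; rewrite scale1r.
Qed.

Lemma tensor_scale0 x : tensor_scale 0 x = tensor_zero.
Proof.
rewrite -(tens_class_repr x) tens_class_scale; apply/tens_classP.
elim: (repr x) => [|[u v] s IHs] /=; first exact: TRrefl.
by rewrite scale0r; apply: (TRcat (s := [:: _]) (s' := [::]) (TR0 _) IHs).
Qed.

Lemma tensor_addN : left_inverse tensor_zero tensor_opp tensor_add.
Proof.
move=> x; rewrite -[in X in tensor_add _ X](tensor_scale1 x) -tensor_scaleDl.
by rewrite addNr tensor_scale0.
Qed.

Lemma tensor_scaleDr : right_distributive tensor_scale tensor_add.
Proof.
move=> a x y; rewrite -(tens_class_repr x) -(tens_class_repr y).
by rewrite !(tens_class_cat, tens_class_scale) /scale_sum map_cat.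
Qed.

HB.instance Definition _ :=
  GRing.isZmodule.Build tensor tensor_addA tensor_addC tensor_add0 tensor_addN.

HB.instance Definition _ :=
  GRing.Zmodule_isLmodule.Build K tensor
    tensor_scaleA tensor_scale1 tensor_scaleDr (fun x a b => tensor_scaleDl x a b).

(* Sweedler notation: for [t = u1 ⊗ v1 + ... + un ⊗ vn], [sweedler t f] is
   f u1 v1 + ... + f un vn. The decomposition used is the chosen representative
   of [t]; by [sweedlerE] any decomposition gives the same value as soon as [f]
   is bilinear, which is the case at every use below. *)
Definition sweedler (W : nmodType) (t : tensor) (f : U -> V -> W) : W :=
  \sum_(p <- repr t) f p.1 p.2.

End Tensor.

Notation "U ⨂ V" := (tensor U V) : type_scope.
Notation "u ⊗ v" := (tens u v) : ring_scope.
Notation "'∑_(' u ⊗ v '<-' t ) E" := (sweedler t (fun u v => E)) : ring_scope.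

Notation bilinear f := (bilinear_for *:%R *:%R f).

Section TensorTheory.
Variables (K : fieldType) (U V : lmodType K).

Lemma tens_bilinear : bilinear (@tens K U V).
Proof.
split=> [v a u u'|u a v v'].
  rewrite /tens /= [a *: tens_class _]tens_class_scale.
  rewrite [tens_class _ + _]tens_class_cat; apply/tens_classP; exact: TRaddl.
rewrite /tens /= [a *: tens_class _]tens_class_scale.
rewrite [tens_class _ + _]tens_class_cat; apply/tens_classP.
apply: (TRtrans (TRaddr _ _ _)); apply: (TRcat (s := [:: _]) (s' := [:: _])).
  exact/TRsym/TRscale.
exact: TRrefl.
Qed.

Lemma tens_class_sum (s : seq (U * V)) :
  tens_class s = \sum_(p <- s) (p.1 ⊗ p.2).
Proof.
elim: s => [|[u v] s IHs]; first by rewrite big_nil.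
by rewrite big_cons -IHs; apply/esym; apply: tens_class_cat.
Qed.

Lemma tensor_decomp (t : U ⨂ V) : t = ∑_(u ⊗ v <- t) u ⊗ v.
Proof. by rewrite -[LHS]tens_class_repr tens_class_sum. Qed.

Variable W : lmodType K.

Lemma bilinear_tensor_rel (f : U -> V -> W) s t : bilinear f -> tensor_rel s t ->
  \sum_(p <- s) f p.1 p.2 = \sum_(p <- t) f p.1 p.2.
Proof.
case=> fl fr.
have f0 v : f 0 v = 0.
  by have := fl v (-1) 0 0; rewrite /= scaler0 addr0 scaleN1r addNr.
have f0r u : f u 0 = 0.
  by have := fr u (-1) 0 0; rewrite /= scaler0 addr0 scaleN1r addNr.
elim=> {s t} [s|s t _|s t r _ st _|s s' t t' _ ss _ tt|s t|u u' v|u v v'|b u v|v] //=.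
- by rewrite st.
- by rewrite !big_cat ss tt.
- by rewrite !big_cat /= addrC.
- by rewrite !(big_cons, big_nil) /= !addr0; have := fl v 1 u u'; rewrite /= !scale1r.
- by rewrite !(big_cons, big_nil) /= !addr0; have := fr u 1 v v'; rewrite /= !scale1r.
- rewrite !(big_cons, big_nil) /= !addr0.
  have := fl v b u 0; have := fr u b v 0.
  by rewrite /= !addr0 f0 f0r !addr0 => -> ->.
- by rewrite !(big_cons, big_nil) /= f0 addr0.
Qed.

Lemma sweedlerE (f : U -> V -> W) s : bilinear f ->
  ∑_(u ⊗ v <- tens_class s) f u v = \sum_(p <- s) f p.1 p.2.
Proof. by move=> bf; apply: (bilinear_tensor_rel bf); apply: repr_tens_class. Qed.

Lemma sweedler_tens (f : U -> V -> W) u v : bilinear f ->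
  ∑_(x ⊗ y <- u ⊗ v) f x y = f u v.
Proof. by move=> bf; rewrite sweedlerE // big_seq1. Qed.

Lemma sweedler_linear (f : U -> V -> W) : bilinear f ->
  linear (fun t : U ⨂ V => ∑_(u ⊗ v <- t) f u v).
Proof.
move=> bf a s t; have [fl _] := bf.
have f0 v : f 0 v = 0.
  by have := fl v (-1) 0 0; rewrite /= scaler0 addr0 scaleN1r addNr.
rewrite -(tens_class_repr s) -(tens_class_repr t).
rewrite [a *: tens_class _]tens_class_scale [tens_class _ + _]tens_class_cat.
rewrite !sweedlerE // big_cat big_map scaler_sumr; congr (_ + _).
by apply: eq_bigr => p _; have := fl p.2 a p.1 0; rewrite /= !addr0 f0 addr0.
Qed.

Theorem tensor_univ (f : U -> V -> W) : bilinear f ->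
  exists g : {linear U ⨂ V -> W}, forall u v, g (u ⊗ v) = f u v.
Proof.
move=> bf; pose m := GRing.isLinear.Build K (U ⨂ V) W *:%R _ (sweedler_linear bf).
pose g : {linear U ⨂ V -> W} := HB.pack (fun t : U ⨂ V => ∑_(u ⊗ v <- t) f u v) m.
by exists g => u v; apply: sweedler_tens.
Qed.

Theorem tensor_univ_uniq (g h : {linear U ⨂ V -> W}) :
  (forall u v, g (u ⊗ v) = h (u ⊗ v)) -> g =1 h.
Proof.
move=> gh t; rewrite (tensor_decomp t) /sweedler !linear_sum.
by apply: eq_bigr => p _; apply: gh.
Qed.

End TensorTheory.

(* Algebras, coalgebras and bialgebras given by their structure maps: the same
   space A ⨂ B carries several of them, so they are not canonical structures. *)
Section Structures.
Variable K : fieldType.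

Record is_algebra (H : lmodType K) (mul : H -> H -> H) (one : H) : Prop := {
  alg_bilinear : bilinear mul;
  alg_assoc : associative mul;
  alg_unitl : left_id one mul;
  alg_unitr : right_id one mul }.

Record is_coalgebra (C : lmodType K) (D : C -> C ⨂ C) (e : C -> K) : Prop := {
  coalg_linear : linear D;
  coalg_scalar : scalar e;
  coalg_coassoc : forall c,
    ∑_(x ⊗ y <- D c) ∑_(x1 ⊗ x2 <- D x) x1 ⊗ x2 ⊗ y =
    ∑_(x ⊗ y <- D c) ∑_(y1 ⊗ y2 <- D y) x ⊗ y1 ⊗ y2;
  coalg_counitl : forall c, ∑_(x ⊗ y <- D c) e x *: y = c;
  coalg_counitr : forall c, ∑_(x ⊗ y <- D c) e y *: x = c }.

Definition tensor_mul (U V : lmodType K) (mU : U -> U -> U) (mV : V -> V -> V)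
    (s t : U ⨂ V) : U ⨂ V :=
  ∑_(u ⊗ v <- s) ∑_(u' ⊗ v' <- t) mU u u' ⊗ mV v v'.

Definition flip (U V : lmodType K) (t : U ⨂ V) : V ⨂ U := ∑_(u ⊗ v <- t) v ⊗ u.

Record is_bialgebra (H : lmodType K) (mul : H -> H -> H) (one : H)
    (D : H -> H ⨂ H) (e : H -> K) : Prop := {
  bialg_alg : is_algebra mul one;
  bialg_coalg : is_coalgebra D e;
  bialg_comul1 : D one = one ⊗ one;
  bialg_comulM : forall x y, D (mul x y) = tensor_mul mul mul (D x) (D y);
  bialg_counit1 : e one = 1;
  bialg_counitM : forall x y, e (mul x y) = e x * e y }.

Definition normalized (U V : lmodType K) (eU : U -> K) (eV : V -> K)
    (oneU : U) (oneV : V) (t : U ⨂ V) : Prop :=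
  ∑_(u ⊗ v <- t) eU u *: v = oneV /\ ∑_(u ⊗ v <- t) eV v *: u = oneU.

Section Quasitriangular.
Variables (H : lmodType K) (mul : H -> H -> H) (one : H).
Variables (D : H -> H ⨂ H) (e : H -> K) (R : H ⨂ H).

Definition leg12 : H ⨂ H ⨂ H := ∑_(r1 ⊗ r2 <- R) r1 ⊗ r2 ⊗ one.
Definition leg13 : H ⨂ H ⨂ H := ∑_(r1 ⊗ r2 <- R) r1 ⊗ one ⊗ r2.
Definition leg23 : H ⨂ H ⨂ H := ∑_(r1 ⊗ r2 <- R) one ⊗ r1 ⊗ r2.
Definition mul2 : H ⨂ H -> H ⨂ H -> H ⨂ H := tensor_mul mul mul.
Definition mul3 : H ⨂ H ⨂ H -> H ⨂ H ⨂ H -> H ⨂ H ⨂ H := tensor_mul mul2 mul.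

Record quasitriangular : Prop := {
  QT1 : normalized e e one one R;
  QT2 : ∑_(r1 ⊗ r2 <- R) D r1 ⊗ r2 = mul3 leg13 leg23;
  QT3 : ∑_(r1 ⊗ r2 <- R) ∑_(x ⊗ y <- D r2) r1 ⊗ x ⊗ y = mul3 leg13 leg12;
  QT4 : forall h, mul2 R (D h) = mul2 (flip (D h)) R }.

End Quasitriangular.
End Structures.

Section SmashBiproduct.
Variables (K : fieldType) (A B : algType K).
Variables (ΔA : {linear A -> A ⨂ A}) (εA : {scalar A}).
Variables (ΔB : {linear B -> B ⨂ B}) (εB : {scalar B}).
Variables (σ : {linear B ⨂ A -> A ⨂ B}) (τ : {linear A ⨂ B -> B ⨂ A}).

Definition smash_mul (x y : A ⨂ B) : A ⨂ B :=
  ∑_(a ⊗ b <- x) ∑_(a' ⊗ b' <- y) ∑_(aσ ⊗ bσ <- σ (b ⊗ a')) (a * aσ) ⊗ (bσ * b').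

Definition smash_one : A ⨂ B := 1 ⊗ 1.

Definition smash_comul (x : A ⨂ B) : (A ⨂ B) ⨂ (A ⨂ B) :=
  ∑_(a ⊗ b <- x) ∑_(a1 ⊗ a2 <- ΔA a) ∑_(b1 ⊗ b2 <- ΔB b)
  ∑_(b1τ ⊗ a2τ <- τ (a2 ⊗ b1)) (a1 ⊗ b1τ) ⊗ (a2τ ⊗ b2).

Definition smash_counit (x : A ⨂ B) : K := ∑_(a ⊗ b <- x) εA a * εB b.

(* Includes the standing assumptions that the counits of A and B are algebra
   maps and that their units are coalgebra maps. *)
Record smash_biproduct_bialgebra : Prop := {
  sb_coalgA : is_coalgebra ΔA εA;
  sb_coalgB : is_coalgebra ΔB εB;
  sb_product : is_algebra smash_mul smash_one;
  sb_coproduct : is_coalgebra smash_comul smash_counit;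
  sb_bialgebra : is_bialgebra smash_mul smash_one smash_comul smash_counit;
  sb_counitA : εA 1 = 1 /\ {morph εA : x y / x * y};
  sb_counitB : εB 1 = 1 /\ {morph εB : x y / x * y};
  sb_unitA : ΔA 1 = 1 ⊗ 1;
  sb_unitB : ΔB 1 = 1 ⊗ 1 }.

Definition right_conormal : Prop :=
  forall a b, ∑_(aσ ⊗ bσ <- σ (b ⊗ a)) εA aσ *: bσ = εA a *: b.

Definition right_normal : Prop := forall b, τ (1 ⊗ b) = b ⊗ 1.

Section Elements.
Variables (W : B ⨂ B) (X : A ⨂ B) (Y : B ⨂ A) (Z : A ⨂ A).

(* Barred copies of X, Y, Z, W are primed; the suffix of a bound name lists the
   maps σ, τ applied to it (σ1, τ1, ... being copies of σ, τ). *)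
Definition C1 : Prop := forall a,
  ∑_(z1 ⊗ z2 <- Z) ∑_(x'1 ⊗ x'2 <- X) ∑_(x1 ⊗ x2 <- X)
  ∑_(w1 ⊗ w2 <- W) ∑_(y1 ⊗ y2 <- Y) ∑_(a1 ⊗ a2 <- ΔA a)
  ∑_(x'2τ1 ⊗ z1τ1 <- τ (z1 ⊗ x'2))
  ∑_(x2τ3 ⊗ x'1τ3 <- τ (x'1 ⊗ x2))
  ∑_(x2τ3τ2 ⊗ z1τ1τ2 <- τ (z1τ1 ⊗ x2τ3))
  ∑_(y2σ1 ⊗ x'2τ1σ1 <- σ (x'2τ1 ⊗ y2))
  ∑_(a1σ2 ⊗ wyσ2 <- σ ((w1 * y1) ⊗ a1))
  ∑_(a2σ3 ⊗ xwσ3 <- σ ((x2τ3τ2 * w2) ⊗ a2))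
    (εB wyσ2 * εB x'2τ1σ1 * εB xwσ3) *:
      ((z1τ1τ2 * x'1τ3 * x1 * a1σ2) ⊗ (z2 * y2σ1 * a2σ3))
  = ∑_(a1 ⊗ a2 <- ΔA a) ∑_(z1 ⊗ z2 <- Z)
    ∑_(bτ ⊗ a2τ <- τ (a2 ⊗ 1)) ∑_(z2σ ⊗ bτσ <- σ (bτ ⊗ z2))
      εB bτσ *: ((a2τ * z1) ⊗ (a1 * z2σ)).

Definition C2 : Prop := forall a,
  ∑_(x1 ⊗ x2 <- X) ∑_(w1 ⊗ w2 <- W) ∑_(aσ ⊗ w1σ <- σ (w1 ⊗ a))
    εB w1σ *: ((x1 * aσ) ⊗ (x2 * w2))
  = ∑_(x1 ⊗ x2 <- X) ∑_(x2τ ⊗ aτ <- τ (a ⊗ x2)) (aτ * x1) ⊗ x2τ.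

Definition C3 : Prop := forall a,
  ∑_(w1 ⊗ w2 <- W) ∑_(y1 ⊗ y2 <- Y)
  ∑_(bτ ⊗ aτ <- τ (a ⊗ 1)) ∑_(aτσ ⊗ w2σ <- σ (w2 ⊗ aτ))
    εB w2σ *: ((w1 * y1 * bτ) ⊗ (y2 * aτσ))
  = ∑_(y1 ⊗ y2 <- Y) y1 ⊗ (a * y2).

Definition C4 : Prop := forall b,
  ∑_(z1 ⊗ z2 <- Z) z1 ⊗ (εB b *: z2)
  = ∑_(z1 ⊗ z2 <- Z)
    ∑_(z2σ2 ⊗ bσ2 <- σ (b ⊗ z2)) ∑_(z1σ1 ⊗ bσ2σ1 <- σ (bσ2 ⊗ z1))
      εB bσ2σ1 *: (z1σ1 ⊗ z2σ2).

Definition C5 : Prop := forall b,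
  ∑_(x1 ⊗ x2 <- X) x1 ⊗ (x2 * b)
  = ∑_(x1 ⊗ x2 <- X) ∑_(b1 ⊗ b2 <- ΔB b) ∑_(x1σ ⊗ b2σ <- σ (b2 ⊗ x1))
      εB b2σ *: (x1σ ⊗ (b1 * x2)).

Definition C6 : Prop := forall b,
  ∑_(y1 ⊗ y2 <- Y) (y1 * b) ⊗ y2
  = ∑_(y1 ⊗ y2 <- Y) ∑_(y2σ ⊗ bσ <- σ (b ⊗ y2)) (bσ * y1) ⊗ y2σ.

Definition C7 : Prop := forall b,
  ∑_(w1 ⊗ w2 <- W) ∑_(b1 ⊗ b2 <- ΔB b) (w1 * b1) ⊗ (w2 * b2)
  = ∑_(w1 ⊗ w2 <- W) ∑_(b1 ⊗ b2 <- ΔB b) (b2 * w1) ⊗ (b1 * w2).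

Definition C8 : Prop :=
  ∑_(z1 ⊗ z2 <- Z) ΔA z1 ⊗ z2
  = ∑_(z1 ⊗ z2 <- Z) ∑_(x1 ⊗ x2 <- X) ∑_(z'1 ⊗ z'2 <- Z)
    ∑_(x2τ ⊗ z1τ <- τ (z1 ⊗ x2)) ∑_(z'2σ ⊗ x2τσ <- σ (x2τ ⊗ z'2))
      εB x2τσ *: ((z1τ * x1) ⊗ z'1 ⊗ (z2 * z'2σ)).

Definition C9 : Prop :=
  ∑_(x1 ⊗ x2 <- X) ΔA x1 ⊗ x2
  = ∑_(x1 ⊗ x2 <- X) ∑_(x'1 ⊗ x'2 <- X) x1 ⊗ x'1 ⊗ (x2 * x'2).

Definition C10 : Prop :=
  ∑_(y1 ⊗ y2 <- Y) ∑_(z1 ⊗ z2 <- Z) ∑_(x1 ⊗ x2 <- X)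
  ∑_(x2τ2 ⊗ z1τ2 <- τ (z1 ⊗ x2))
  ∑_(y1τ1 ⊗ zxτ1 <- τ ((z1τ2 * x1) ⊗ y1))
  ∑_(y2σ ⊗ x2τ2σ <- σ (x2τ2 ⊗ y2))
    εB x2τ2σ *: (y1τ1 ⊗ zxτ1 ⊗ (z2 * y2σ))
  = ∑_(w1 ⊗ w2 <- W) ∑_(y1 ⊗ y2 <- Y) ∑_(z1 ⊗ z2 <- Z)
    ∑_(z2σ ⊗ w2σ <- σ (w2 ⊗ z2))
      εB w2σ *: ((w1 * y1) ⊗ z1 ⊗ (y2 * z2σ)).

Definition C11 : Prop :=
  ∑_(w1 ⊗ w2 <- W) ∑_(x1 ⊗ x2 <- X) ∑_(w1τ ⊗ x1τ <- τ (x1 ⊗ w1))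
    w1τ ⊗ x1τ ⊗ (x2 * w2)
  = ∑_(w1 ⊗ w2 <- W) ∑_(x1 ⊗ x2 <- X) w1 ⊗ x1 ⊗ (w2 * x2).

Definition C12 : Prop :=
  ∑_(y1 ⊗ y2 <- Y) ΔB y1 ⊗ y2
  = ∑_(w1 ⊗ w2 <- W) ∑_(y1 ⊗ y2 <- Y) ∑_(y'1 ⊗ y'2 <- Y)
    ∑_(y'2σ ⊗ w2σ <- σ (w2 ⊗ y'2))
      εB w2σ *: ((w1 * y1) ⊗ y'1 ⊗ (y2 * y'2σ)).

Definition C13 : Prop :=
  ∑_(w1 ⊗ w2 <- W) ΔB w1 ⊗ w2
  = ∑_(w1 ⊗ w2 <- W) ∑_(w'1 ⊗ w'2 <- W) w1 ⊗ w'1 ⊗ (w2 * w'2).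

Definition C14 : Prop :=
  ∑_(z1 ⊗ z2 <- Z) ∑_(z21 ⊗ z22 <- ΔA z2) z1 ⊗ z21 ⊗ z22
  = ∑_(z1 ⊗ z2 <- Z) ∑_(x1 ⊗ x2 <- X) ∑_(z'1 ⊗ z'2 <- Z) ∑_(y1 ⊗ y2 <- Y)
    ∑_(x2τ ⊗ z1τ <- τ (z1 ⊗ x2))
    ∑_(z'1σ1 ⊗ y1σ1 <- σ (y1 ⊗ z'1))
    ∑_(y2σ2 ⊗ x2τσ2 <- σ (x2τ ⊗ y2))
      (εB y1σ1 * εB x2τσ2) *: ((z1τ * x1 * z'1σ1) ⊗ z'2 ⊗ (z2 * y2σ2)).

Definition C15 : Prop :=
  ∑_(z1 ⊗ z2 <- Z) ∑_(x1 ⊗ x2 <- X)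
  ∑_(x2τ1 ⊗ z1τ1 <- τ (z1 ⊗ x2)) ∑_(x2τ1τ2 ⊗ z2τ2 <- τ (z2 ⊗ x2τ1))
    (z1τ1 * x1) ⊗ x2τ1τ2 ⊗ z2τ2
  = ∑_(z1 ⊗ z2 <- Z) ∑_(x1 ⊗ x2 <- X) ∑_(x'1 ⊗ x'2 <- X) ∑_(y1 ⊗ y2 <- Y)
    ∑_(x2τ ⊗ z1τ <- τ (z1 ⊗ x2))
    ∑_(x'1σ1 ⊗ y1σ1 <- σ (y1 ⊗ x'1))
    ∑_(y2σ2 ⊗ x2τσ2 <- σ (x2τ ⊗ y2))
      (εB y1σ1 * εB x2τσ2) *: ((z1τ * x1 * x'1σ1) ⊗ x'2 ⊗ (z2 * y2σ2)).

Definition C16 : Prop :=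
  ∑_(x1 ⊗ x2 <- X) ∑_(x21 ⊗ x22 <- ΔB x2) x1 ⊗ x21 ⊗ x22
  = ∑_(x1 ⊗ x2 <- X) ∑_(x'1 ⊗ x'2 <- X) ∑_(w1 ⊗ w2 <- W)
    ∑_(x'1σ ⊗ w1σ <- σ (w1 ⊗ x'1))
      εB w1σ *: ((x1 * x'1σ) ⊗ x'2 ⊗ (x2 * w2)).

Definition C17 : Prop :=
  ∑_(y1 ⊗ y2 <- Y) ∑_(y21 ⊗ y22 <- ΔA y2) y1 ⊗ y21 ⊗ y22
  = ∑_(y1 ⊗ y2 <- Y) ∑_(y'1 ⊗ y'2 <- Y) (y1 * y'1) ⊗ y'2 ⊗ y2.

Definition C18 : Prop :=
  ∑_(w1 ⊗ w2 <- W) ∑_(y1 ⊗ y2 <- Y) ∑_(w2τ ⊗ y2τ <- τ (y2 ⊗ w2))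
    (w1 * y1) ⊗ w2τ ⊗ y2τ
  = ∑_(w1 ⊗ w2 <- W) ∑_(y1 ⊗ y2 <- Y) (y1 * w1) ⊗ w2 ⊗ y2.

Definition C19 : Prop :=
  ∑_(w1 ⊗ w2 <- W) ∑_(w21 ⊗ w22 <- ΔB w2) w1 ⊗ w21 ⊗ w22
  = ∑_(w1 ⊗ w2 <- W) ∑_(w'1 ⊗ w'2 <- W) (w1 * w'1) ⊗ w'2 ⊗ w2.

Record qt_datum : Prop := {
  qt_normW : normalized εB εB 1 1 W;
  qt_normX : normalized εA εB 1 1 X;
  qt_normY : normalized εB εA 1 1 Y;
  qt_normZ : normalized εA εA 1 1 Z;
  qt_C1 : C1; qt_C2 : C2; qt_C3 : C3; qt_C4 : C4; qt_C5 : C5;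
  qt_C6 : C6; qt_C7 : C7; qt_C8 : C8; qt_C9 : C9; qt_C10 : C10;
  qt_C11 : C11; qt_C12 : C12; qt_C13 : C13; qt_C14 : C14; qt_C15 : C15;
  qt_C16 : C16; qt_C17 : C17; qt_C18 : C18; qt_C19 : C19 }.

Definition qt_alpha : (A ⨂ B) ⨂ (A ⨂ B) :=
  ∑_(z1 ⊗ z2 <- Z) ∑_(x'1 ⊗ x'2 <- X) ∑_(x1 ⊗ x2 <- X)
  ∑_(w1 ⊗ w2 <- W) ∑_(y1 ⊗ y2 <- Y)
  ∑_(x'2τ1 ⊗ z1τ1 <- τ (z1 ⊗ x'2))
  ∑_(x2τ3 ⊗ x'1τ3 <- τ (x'1 ⊗ x2))
  ∑_(x2τ3τ2 ⊗ z1τ1τ2 <- τ (z1τ1 ⊗ x2τ3))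
  ∑_(y2σ ⊗ x'2τ1σ <- σ (x'2τ1 ⊗ y2))
    εB x'2τ1σ *:
      (((z1τ1τ2 * x'1τ3 * x1) ⊗ (w1 * y1)) ⊗ ((z2 * y2σ) ⊗ (x2τ3τ2 * w2))).

End Elements.

End SmashBiproduct.

(* Main.v *)
Require Import Defs.
From HB Require Import structures.
From mathcomp Require Import all_boot all_order all_algebra.
Import GRing.Theory.
Local Open Scope ring_scope.
Set Implicit Arguments.
Unset Strict Implicit.
Unset Printing Implicit Defensive.

(** Write H for the smash biproduct, [pA = id ⊗ εB] and [pB = εA ⊗ id] for its
    projections, [iA] and [iB] for its inclusions.  Right conormality of [σ] makes [pB] an
    algebra map, and right normality of [τ] makes [iB] a coalgebra map, so that B is a
    retract of the bialgebra H and H is a biproduct in the sense of Radford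
    ([smash_radford_biproduct]).  Then [h ▷ a = pA (h * iA a)] is an action of H on A,
    [coact a = (pB ⊗ pA) (Δ (iA a))] is a coaction of B on A, and both determine the
    smash structure: [σ (b ⊗ a) = ∑ (b₁ ▷ a) ⊗ b₂] and [τ (a ⊗ b) = coact a * (b ⊗ 1)].
    Everything below is expressed with [▷] and [coact]; the tensors of the statement
    become tensors of the same shape without [σ] and [τ] ([qt_datumP]).

    Let R be a quasitriangular structure of H, and let W, X, Y, Z be its images under
    [pB ⊗ pB], [pA ⊗ pB], [pB ⊗ pA], [pA ⊗ pA].  Since [h = ∑ iA (pA h₁) * iB (pB h₂)] for
    every [h], the identity [(Δ ⊗ id) R = R₁₃ R₂₃] writes R as the product of
    [(iA pA ⊗ id) R] and [(iB pB ⊗ id) R], and [(id ⊗ Δ) R = R₁₃ R₁₂] splits the second leg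
    likewise.  Splitting both legs recovers R from W, X, Y, Z ([R_projections]), and the
    resulting expression is the tensor α ([alpha_expand], [R_HH_expand]).  The nineteen
    identities are the images of the axioms of R under the same projections
    ([proj_hexagon], [proj_cocomm]).

    Conversely, given W, X, Y, Z, define the partial projections [R_HB], [R_BH], [R_AH],
    [R_HA] and the full tensor [R_HH] by the formulas that the splitting of R forces.  The
    product [UT] of U in [A ⊗ E] and T in [B ⊗ E] is multiplicative for Δ when U
    and T are multiplicative and satisfy an exchange relation ([assemble_mult]).  Applied
    to the first legs this gives [(Δ ⊗ id) R = R₁₃ R₂₃]; applied to the flipped tensors
    with opposite multiplication it gives [(id ⊗ Δ) R = R₁₃ R₁₂].  The twelve identities
    that do not quantify over A or B supply the hypotheses of these steps.

    The remaining axiom [R Δ(h) = Δᶜᵒᵖ(h) R] may be tested on the generators [iA a] and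
    [iB b]; by the two hexagons it may moreover be tested after projecting each leg to A or
    to B ([almost_cocomm_of_gens]).  Of the eight equations so obtained, one always
    holds and the others are the seven identities that quantify over A or B. *)

(** * Multilinear sums over tensors *)

Section SweedlerCalculus.
Variable K : fieldType.

Lemma eq_sweedler (U V : lmodType K) (W : nmodType) (t : U ⨂ V) (f g : U -> V -> W) :
  (forall u v, f u v = g u v) -> ∑_(u ⊗ v <- t) f u v = ∑_(u ⊗ v <- t) g u v.
Proof. by move=> fg; apply: eq_bigr => p _; apply: fg. Qed.

(** Sums over tensors are finite sums over chosen representatives, so independent ones
    commute whatever the summand is. *)
Lemma sweedler_exchange (U V U' V' : lmodType K) (W : nmodType)
    (s : U ⨂ V) (t : U' ⨂ V') (f : U -> V -> U' -> V' -> W) :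
  ∑_(u ⊗ v <- s) ∑_(u' ⊗ v' <- t) f u v u' v' =
  ∑_(u' ⊗ v' <- t) ∑_(u ⊗ v <- s) f u v u' v'.
Proof. exact: exchange_big. Qed.

Section Linear.
Variables U V P Q : lmodType K.

Lemma linearE0 (f : P -> Q) : linear f -> f 0 = 0.
Proof. by move=> lf; have := lf (-1) 0 0; rewrite scaler0 addr0 scaleN1r addNr. Qed.

Lemma linear_sweedler (g : P -> Q) (t : U ⨂ V) (f : U -> V -> P) : linear g ->
  g (∑_(u ⊗ v <- t) f u v) = ∑_(u ⊗ v <- t) g (f u v).
Proof.
move=> lg; apply: (big_morph g); last exact: linearE0.
by move=> x y; have := lg 1 x y; rewrite !scale1r.
Qed.

Lemma linear_scale (g : P -> Q) a x : linear g -> g (a *: x) = a *: g x.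
Proof. by move=> lg; have := lg a x 0; rewrite !addr0 (linearE0 lg) addr0. Qed.

Lemma lin_eta (f : P -> Q) : linear (fun x => f x) -> linear f. Proof. by []. Qed.

Lemma lin_comp (R : lmodType K) (g : Q -> R) (f : P -> Q) :
  linear g -> linear f -> linear (fun x => g (f x)).
Proof. by move=> lg lf a x y; rewrite lf lg. Qed.

Lemma lin_tensl (f : P -> U) (v : V) : linear f -> linear (fun x => f x ⊗ v).
Proof. by move=> lf a x y; rewrite lf; have [bl _] := tens_bilinear U V; apply: bl. Qed.

Lemma lin_tensr (f : P -> V) (u : U) : linear f -> linear (fun x => u ⊗ f x).
Proof. by move=> lf a x y; rewrite lf; have [_ br] := tens_bilinear U V; apply: br. Qed.

Lemma lin_scaler (f : P -> Q) (c : K) : linear f -> linear (fun x => c *: f x).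
Proof. by move=> lf a x y; rewrite lf scalerDr !scalerA mulrC. Qed.

Lemma lin_scalel (f : P -> K) (q : Q) : scalar f -> linear (fun x => f x *: q).
Proof. by move=> lf a x y; rewrite lf scalerDl scalerA. Qed.

Lemma lin_sweedler_body (t : U ⨂ V) (f : P -> U -> V -> Q) :
  (forall u v, linear (fun x => f x u v)) -> linear (fun x => ∑_(u ⊗ v <- t) f x u v).
Proof.
by move=> lf a x y; rewrite /sweedler scaler_sumr -big_split; apply: eq_bigr => p _; apply: lf.
Qed.

Lemma lin_sweedler (t : P -> U ⨂ V) (f : U -> V -> Q) :
  linear t -> (forall v, linear (fun u => f u v)) -> (forall u, linear (f u)) ->
  linear (fun x => ∑_(u ⊗ v <- t x) f u v).
Proof. by move=> lt fl fr a x y; rewrite lt; apply: (sweedler_linear (f := f)). Qed.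

Lemma scal_comp (f : P -> Q) (e : Q -> K) :
  scalar e -> linear f -> scalar (fun x => e (f x)).
Proof. by move=> le lf a x y; rewrite lf le. Qed.

Lemma scal_mull (f : P -> K) (c : K) : scalar f -> scalar (fun x => f x * c).
Proof. by move=> lf a x y; rewrite lf mulrDl mulrA. Qed.

Lemma scal_mulr (f : P -> K) (c : K) : scalar f -> scalar (fun x => c * f x).
Proof. by move=> lf a x y; rewrite lf mulrDr mulrCA. Qed.

End Linear.

Lemma lin_mull (P : lmodType K) (C : algType K) (f : P -> C) (c : C) :
  linear f -> linear (fun x => f x * c).
Proof. by move=> lf a x y; rewrite lf mulrDl scalerAl. Qed.

Lemma lin_mulr (P : lmodType K) (C : algType K) (f : P -> C) (c : C) :
  linear f -> linear (fun x => c * f x).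
Proof. by move=> lf a x y; rewrite lf mulrDr scalerAr. Qed.

Lemma lin_regl (P : lmodType K) (f : P -> K^o) (c : K) :
  linear f -> linear (fun x => f x * c : K^o).
Proof. by move=> lf a x y; rewrite lf mulrDl -mulrA. Qed.

Lemma lin_regr (P : lmodType K) (f : P -> K^o) (c : K) :
  linear f -> linear (fun x => c * f x : K^o).
Proof. by move=> lf a x y; rewrite lf mulrDr mulrCA. Qed.

Section Multilinear.
Variables U V Q P : lmodType K.

(** Curried counterparts of bilinearity and trilinearity, with conditions of the form
    [linear (fun x => _)] that syntax-directed search can decompose. *)
Definition bilin (f : U -> V -> P) : Prop :=
  (forall v, linear (fun u => f u v)) /\ (forall u, linear (f u)).

Definition trilin (f : U -> V -> Q -> P) : Prop :=
  [/\ forall v q, linear (fun u => f u v q), forall u q, linear (fun v => f u v q)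
    & forall u v, linear (f u v)].

Lemma sweedlerT (f : U -> V -> P) u v : bilin f -> ∑_(x ⊗ y <- u ⊗ v) f x y = f u v.
Proof. by case=> fl fr; apply: sweedler_tens. Qed.

Variable R : lmodType K.

Lemma lin_app2l (f : U -> V -> P) (g : R -> U) v :
  bilin f -> linear g -> linear (fun x => f (g x) v).
Proof. by case=> fl _ lg; apply: (lin_comp (fl v)). Qed.
Lemma lin_app2r (f : U -> V -> P) (g : R -> V) u :
  bilin f -> linear g -> linear (fun x => f u (g x)).
Proof. by case=> _ fr lg; apply: (lin_comp (fr u)). Qed.
Lemma lin_app31 (f : U -> V -> Q -> P) (g : R -> U) v q :
  trilin f -> linear g -> linear (fun x => f (g x) v q).
Proof. by case=> fl _ _ lg; apply: (lin_comp (fl v q)). Qed.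
Lemma lin_app32 (f : U -> V -> Q -> P) (g : R -> V) u q :
  trilin f -> linear g -> linear (fun x => f u (g x) q).
Proof. by case=> _ fm _ lg; apply: (lin_comp (fm u q)). Qed.
Lemma lin_app33 (f : U -> V -> Q -> P) (g : R -> Q) u v :
  trilin f -> linear g -> linear (fun x => f u v (g x)).
Proof. by case=> _ _ fr lg; apply: (lin_comp (fr u v)). Qed.

End Multilinear.

Lemma sweedler_bilin (U V P : lmodType K) (f : U -> V -> P) :
  bilin f -> linear (fun t => ∑_(u ⊗ v <- t) f u v).
Proof. by case=> fl fr; apply: lin_sweedler. Qed.

Section Evaluation.
Variables U V Q P : lmodType K.

(** Two tensors are equal as soon as all multilinear maps agree on them.  Equations between
    tensors are therefore handled as equations between the values [eval2 f] and [eval3 f]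
    for an arbitrary multilinear [f], where no tensor sign is left. *)
Definition eval3 (f : U -> V -> Q -> P) (t : U ⨂ V ⨂ Q) :=
  ∑_(uv ⊗ q <- t) ∑_(u ⊗ v <- uv) f u v q.

Lemma eval3_bilin (f : U -> V -> Q -> P) : trilin f ->
  bilin (fun uv q => ∑_(u ⊗ v <- uv) f u v q).
Proof.
case=> fl fm fr; split=> x.
- exact: lin_sweedler.
- exact: lin_sweedler_body.
Qed.

Lemma eval3_linear (f : U -> V -> Q -> P) : trilin f -> linear (eval3 f).
Proof. by move=> tf; exact: (sweedler_bilin (eval3_bilin tf)). Qed.

Lemma eval3Tl (f : U -> V -> Q -> P) t q :
  trilin f -> eval3 f (t ⊗ q) = ∑_(u ⊗ v <- t) f u v q.
Proof. by move/eval3_bilin => bf; apply: (sweedlerT _ _ bf). Qed.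

Lemma eval3T (f : U -> V -> Q -> P) u v q : trilin f -> eval3 f (u ⊗ v ⊗ q) = f u v q.
Proof. by move=> tf; rewrite eval3Tl // sweedlerT //; case: tf. Qed.
End Evaluation.

Definition eval2 (U V P : lmodType K) (f : U -> V -> P) (t : U ⨂ V) : P :=
  ∑_(u ⊗ v <- t) f u v.

Lemma eval2_linear (U V P : lmodType K) (f : U -> V -> P) : bilin f -> linear (eval2 f).
Proof. exact: sweedler_bilin. Qed.

Lemma eval2T (U V P : lmodType K) (f : U -> V -> P) u v :
  bilin f -> eval2 f (u ⊗ v) = f u v.
Proof. exact: sweedlerT. Qed.

Lemma tens_bilin (U V : lmodType K) : bilin (@tens K U V).
Proof. by have [l r] := tens_bilinear U V; split. Qed.

Lemma tens_trilin (U V Q : lmodType K) : trilin (fun (u : U) (v : V) (q : Q) => u ⊗ v ⊗ q).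
Proof.
by split=> x y; [apply: lin_tensl; apply: lin_tensl | apply: lin_tensl; apply: lin_tensr
  | apply: lin_tensr].
Qed.

Lemma eval3_tens (U V Q : lmodType K) (t : U ⨂ V ⨂ Q) :
  eval3 (fun u v q => u ⊗ v ⊗ q) t = t.
Proof.
rewrite [RHS]tensor_decomp; apply: eq_sweedler => uv q.
by rewrite {2}(tensor_decomp uv) (linear_sweedler _ _ (lin_tensl q (f := id) (fun _ _ _ => erefl))).
Qed.

(** The parameter [i] stands for the element of A, B or H over which an identity between
    tensors is universally quantified. *)
Lemma tensor_eq2 (I : Type) (U V : lmodType K) (s t : I -> U ⨂ V)
    (F G : forall P : lmodType K, (U -> V -> P) -> I -> P) :
  (forall (P : lmodType K) (f : U -> V -> P), bilin f -> forall i, eval2 f (s i) = F P f i) ->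
  (forall (P : lmodType K) (f : U -> V -> P), bilin f -> forall i, eval2 f (t i) = G P f i) ->
  (forall i, s i = t i) <->
  (forall (P : lmodType K) (f : U -> V -> P), bilin f -> forall i, F P f i = G P f i).
Proof.
move=> sF tG; split=> [st P f bf i | FG i].
  by rewrite -sF // -tG // st.
have ev u : u = eval2 (@tens K U V) u by apply: tensor_decomp.
by rewrite (ev (s i)) (ev (t i)) sF ?tG ?FG //; apply: tens_bilin.
Qed.

Lemma tensor_eq3 (U V Q : lmodType K) (s t : U ⨂ V ⨂ Q)
    (F G : forall P : lmodType K, (U -> V -> Q -> P) -> P) :
  (forall (P : lmodType K) (f : U -> V -> Q -> P), trilin f -> eval3 f s = F P f) ->
  (forall (P : lmodType K) (f : U -> V -> Q -> P), trilin f -> eval3 f t = G P f) ->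
  s = t <-> (forall (P : lmodType K) (f : U -> V -> Q -> P), trilin f -> F P f = G P f).
Proof.
move=> sF tG; split=> [st P f tf | FG].
  by rewrite -sF // -tG // st.
rewrite -(eval3_tens s) -(eval3_tens t) sF ?tG ?FG //; exact: tens_trilin.
Qed.

Lemma scale_congr (P : lmodType K) (c : K) (x y : P) : x = y -> c *: x = c *: y.
Proof. by move->. Qed.

Lemma sweedler_sum (U V U' V' P : lmodType K) (s : U ⨂ V) (g : U -> V -> U' ⨂ V')
    (f : U' -> V' -> P) : bilin f ->
  ∑_(x ⊗ y <- (∑_(u ⊗ v <- s) g u v)) f x y = ∑_(u ⊗ v <- s) ∑_(x ⊗ y <- g u v) f x y.
Proof. by move=> bf; apply: (linear_sweedler s g (sweedler_bilin bf)). Qed.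

Lemma tensor_ext (U V : lmodType K) (s t : U ⨂ V) :
  (forall (P : lmodType K) (f : U -> V -> P), bilin f ->
    ∑_(u ⊗ v <- s) f u v = ∑_(u ⊗ v <- t) f u v) -> s = t.
Proof. by move=> st; rewrite (tensor_decomp s) (tensor_decomp t) st //; apply: tens_bilin. Qed.

Lemma flipE (U V P : lmodType K) (f : V -> U -> P) (t : U ⨂ V) : bilin f ->
  ∑_(v ⊗ u <- flip t) f v u = ∑_(u ⊗ v <- t) f v u.
Proof.
move=> bf; rewrite /flip sweedler_sum //.
by apply: eq_sweedler => u v; apply: sweedlerT.
Qed.

Lemma eq_on_pure (U V P : lmodType K) (f g : U ⨂ V -> P) :
  linear f -> linear g -> (forall u v, f (u ⊗ v) = g (u ⊗ v)) -> forall t, f t = g t.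
Proof.
move=> lf lg fg t; rewrite (tensor_decomp t) !linear_sweedler //.
exact: eq_sweedler.
Qed.

(** The scalar [e x] enters through an argument of type [K^o], so that the rule applies
    wherever a counit occurs as a factor of the summand, not only in front of it. *)
Lemma sweedler_scalarl (U V P : lmodType K) (e : U -> K) (t : U ⨂ V) k c
    (f : K^o -> V -> P) :
  ∑_(x ⊗ y <- t) e x *: y = k *: c -> bilin f -> ∑_(x ⊗ y <- t) f (e x) y = f k c.
Proof.
move=> tc [fl fr].
have fE x y : f x y = f 1 (x *: y).
  rewrite (linear_scale _ _ (fr 1)).
  by rewrite -(linear_scale (g := fun k : K^o => f k y)) // /GRing.scale /= mulr1.
rewrite (fE k c) -tc (linear_sweedler _ _ (fr 1)).
by apply: eq_sweedler => x y; apply: fE.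
Qed.

Lemma sweedler_scalarr (U V P : lmodType K) (e : V -> K) (t : U ⨂ V) k c
    (f : U -> K^o -> P) :
  ∑_(x ⊗ y <- t) e y *: x = k *: c -> bilin f -> ∑_(x ⊗ y <- t) f x (e y) = f c k.
Proof.
move=> tc [fl fr].
have fE x y : f y x = f (x *: y) 1.
  rewrite (linear_scale _ _ (fl 1)).
  by rewrite -(linear_scale (g := fun k : K^o => f y k)) // /GRing.scale /= mulr1.
rewrite (fE k c) -tc (linear_sweedler _ _ (fl 1)).
by apply: eq_sweedler => x y; apply: fE.
Qed.

Lemma sweedler_counitl (U V P : lmodType K) (e : U -> K) (t : U ⨂ V) c
    (f : K^o -> V -> P) :
  ∑_(x ⊗ y <- t) e x *: y = c -> bilin f -> ∑_(x ⊗ y <- t) f (e x) y = f 1 c.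
Proof. by move=> tc; apply: sweedler_scalarl; rewrite scale1r. Qed.

Lemma sweedler_counitr (U V P : lmodType K) (e : V -> K) (t : U ⨂ V) c
    (f : U -> K^o -> P) :
  ∑_(x ⊗ y <- t) e y *: x = c -> bilin f -> ∑_(x ⊗ y <- t) f x (e y) = f c 1.
Proof. by move=> tc; apply: sweedler_scalarr; rewrite scale1r. Qed.

Section Coalgebra.
Variables (C : lmodType K) (D : C -> C ⨂ C) (e : C -> K).
Hypothesis cD : is_coalgebra D e.

Lemma counitlE (P : lmodType K) (f : K^o -> C -> P) c :
  bilin f -> ∑_(x ⊗ y <- D c) f (e x) y = f 1 c.
Proof. by apply: sweedler_counitl; apply: (coalg_counitl cD). Qed.

Lemma counitrE (P : lmodType K) (f : C -> K^o -> P) c :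
  bilin f -> ∑_(x ⊗ y <- D c) f x (e y) = f c 1.
Proof. by apply: sweedler_counitr; apply: (coalg_counitr cD). Qed.
End Coalgebra.

End SweedlerCalculus.

(** The second hexagon for R is the first one for the flipped tensor, with the opposite
    multiplication on the leg that is not comultiplied. *)
Definition opmul (K : fieldType) (E : algType K) (x y : E) : E := y * x.

Lemma opmulA (K : fieldType) (E : algType K) : associative (@opmul K E).
Proof. by move=> x y z; rewrite /opmul mulrA. Qed.

(** * Rewriting under nested sums *)

(** [lin] proves multilinearity by recursion on the syntax of the summand; [lin_hook] is
    the place where rules for further operations are added. *)
Ltac lin_hook := fail.

Ltac lin :=
  intros; cbv beta delta [opmul];
  lazymatch goal with
  | |- bilin _ => split; lin
  | |- trilin _ => split; lin
  | |- GRing.linear_for _ (fun _ => _) => lin1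
  | |- GRing.linear_for _ _ => first [eassumption | exact: linearP | apply: lin_eta; lin1]
  end
with lin1 :=
  first
  [ eassumption
  | let a := fresh in let x := fresh in let y := fresh in intros a x y; reflexivity
  | exact: linearP
  | match goal with
    | |- GRing.linear_for _ (fun x => tens (@?a x) ?b) => apply: lin_tensl; lin
    | |- GRing.linear_for _ (fun x => tens ?b (@?a x)) => apply: lin_tensr; lin
    | |- GRing.linear_for _ (fun x => sweedler ?t (@?f x)) =>
        apply: lin_sweedler_body; lin
    | |- GRing.linear_for _ (fun x => sweedler (@?t x) ?f) =>
        apply: lin_sweedler; lin
    | |- GRing.linear_for _ (fun x => GRing.mul (@?a x) ?b) =>
        first [apply: lin_mull; lin | apply: scal_mull; lin | apply: lin_regl; lin]
    | |- GRing.linear_for _ (fun x => GRing.mul ?b (@?a x)) =>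
        first [apply: lin_mulr; lin | apply: scal_mulr; lin | apply: lin_regr; lin]
    | |- GRing.linear_for _ (fun x => GRing.scale (@?a x) ?b) => apply: lin_scalel; lin
    | |- GRing.linear_for _ (fun x => GRing.scale ?b (@?a x)) => apply: lin_scaler; lin
    | |- GRing.linear_for _ (fun x => ?f (@?a x) ?b) =>
        match goal with H : bilin f |- _ => apply: (lin_app2l _ H); lin end
    | |- GRing.linear_for _ (fun x => ?f ?b (@?a x)) =>
        match goal with H : bilin f |- _ => apply: (lin_app2r _ H); lin end
    | |- GRing.linear_for _ (fun x => ?f (@?a x) ?b ?c) =>
        match goal with H : trilin f |- _ => apply: (lin_app31 _ _ H); lin end
    | |- GRing.linear_for _ (fun x => ?f ?b (@?a x) ?c) =>
        match goal with H : trilin f |- _ => apply: (lin_app32 _ _ H); lin end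
    | |- GRing.linear_for _ (fun x => ?f ?b ?c (@?a x)) =>
        match goal with H : trilin f |- _ => apply: (lin_app33 _ _ H); lin end
    | |- _ => lin_hook
    | |- GRing.linear_for _ (fun x => ?g (@?a x)) =>
        first [ apply: (lin_comp (g := g)); [ first [exact: linearP | eassumption] | lin ]
              | apply: (scal_comp (e := g)); [ exact: linearP | lin ] ]
    end ].

(** [pull t] proves [L = ∑_(u ⊗ v <- t) ?F u v] by moving the sum over [t] outwards. *)
Ltac pull t :=
  lazymatch goal with
  | |- @sweedler ?K ?U ?V ?W ?s ?f = _ =>
    ((unify s t; reflexivity)
     + (eapply eq_trans;
        [ eapply eq_sweedler;
          let u := fresh "u" in let v := fresh "v" in intros u v; cbv beta; pull t
        | eapply sweedler_exchange ]))
  end.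

(** Both sides are brought to the same nesting order, and [leaf] compares the bodies. *)
Ltac align_sums leaf :=
  cbv beta;
  lazymatch goal with
  | |- _ = sweedler ?t _ =>
    eapply eq_trans;
    [ pull t
    | eapply eq_sweedler;
      let u := fresh "u" in let v := fresh "v" in intros u v; align_sums leaf ]
  | |- _ => leaf
  end.

Ltac body_eq := solve [ reflexivity | rewrite ?mulrA ?mulr1 ?mul1r; reflexivity ].
Ltac match_sums := align_sums body_eq.

Ltac abstract_arg a k :=
  tryif is_var a then k a
  else (let z := fresh "z" in set z := a; k z).

(** Higher-order unification of a summand with an unknown function of the bound variables,
    including the case where the arguments are not variables but, for instance, products. *)
Ltac solve_body :=
  first
  [ lazymatch goal with
    | |- _ = ?f ?a ?b ?c => is_evar f;
      abstract_arg a ltac:(fun x => abstract_arg b ltac:(fun y =>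
      abstract_arg c ltac:(fun z =>
        lazymatch goal with
        | |- ?L = _ => let L' := (eval pattern x, y, z in L) in
          lazymatch L' with ?g _ _ _ => unify f g end
        end)))
    | |- _ = ?f ?a ?b => is_evar f;
      abstract_arg a ltac:(fun x => abstract_arg b ltac:(fun y =>
        lazymatch goal with
        | |- ?L = _ => let L' := (eval pattern x, y in L) in
          lazymatch L' with ?g _ _ => unify f g end
        end))
    | |- _ = ?f ?a => is_evar f;
      abstract_arg a ltac:(fun x =>
        lazymatch goal with
        | |- ?L = _ => let L' := (eval pattern x in L) in
          lazymatch L' with ?g _ => unify f g end
        end)
    end; reflexivity
  | reflexivity ].

(** [srw E] rewrites a nested sum with [E], whose left-hand side is a nested sum with an
    arbitrary multilinear summand: independent sums are exchanged until those of [E]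
    become adjacent, and the outermost level where this succeeds is used. *)
Ltac srw_at E :=
  eapply eq_trans; [ | eapply eq_trans; [ eapply E | ] ];
  [ align_sums solve_body | lin .. | cbv beta; reflexivity ].

Ltac srw_in E :=
  cbv beta;
  first
  [ srw_at E
  | eapply eq_sweedler;
    let u := fresh "u" in let v := fresh "v" in intros u v; srw_in E ].

(** The same from right to left. *)
Ltac srwr_at E :=
  eapply eq_trans; [ | eapply Logic.eq_sym; eapply E ]; [ align_sums solve_body | lin .. ].

Ltac srwr_in E :=
  cbv beta;
  first
  [ srwr_at E
  | eapply eq_sweedler;
    let u := fresh "u" in let v := fresh "v" in intros u v; srwr_in E ].

Ltac srwr E := eapply eq_trans; [ once (srwr_in E) | cbv beta ].

Ltac front t := eapply eq_trans; [ once (pull t) | cbv beta ].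

Ltac srw E := eapply eq_trans; [ once (srw_in E) | cbv beta ].

(** [inside tac] rewrites the body below all the sums. *)
Ltac under_sums tac :=
  cbv beta;
  lazymatch goal with
  | |- sweedler _ _ = _ =>
    eapply eq_sweedler;
    let u := fresh "u" in let v := fresh "v" in intros u v; under_sums tac
  | |- _ => tac
  end.
Tactic Notation "inside" tactic3(tac) :=
  eapply eq_trans; [ under_sums ltac:(tac; reflexivity) | cbv beta ].

(** [within tac] runs [tac] at the outermost level of a nested sum where it applies. *)
Ltac within_sums tac :=
  cbv beta;
  first
  [ tac
  | eapply eq_sweedler;
    let u := fresh "u" in let v := fresh "v" in intros u v; within_sums tac ].
Tactic Notation "within" tactic3(tac) :=
  eapply eq_trans; [ within_sums ltac:(tac; reflexivity) | cbv beta ].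

(** [push] evaluates [eval2 f] or [eval3 f] on a nested sum of pure tensors. *)
Ltac push_body :=
  cbv beta;
  lazymatch goal with
  | H : bilin ?f |- eval2 ?f (sweedler _ _) = _ =>
    eapply eq_trans;
    [ eapply (linear_sweedler _ _ (eval2_linear H))
    | eapply eq_sweedler; let u := fresh "u" in let v := fresh "v" in
      intros u v; push_body ]
  | H : bilin ?f |- eval2 ?f (GRing.scale _ _) = _ =>
    eapply eq_trans;
    [ eapply (linear_scale _ _ (eval2_linear H)) | eapply scale_congr; push_body ]
  | H : bilin ?f |- eval2 ?f (tens _ _) = _ => eapply (eval2T _ _ H)
  | H : trilin ?f |- eval3 ?f (sweedler _ _) = _ =>
    eapply eq_trans;
    [ eapply (linear_sweedler _ _ (eval3_linear H))
    | eapply eq_sweedler; let u := fresh "u" in let v := fresh "v" in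
      intros u v; push_body ]
  | H : trilin ?f |- eval3 ?f (GRing.scale _ _) = _ =>
    eapply eq_trans;
    [ eapply (linear_scale _ _ (eval3_linear H)) | eapply scale_congr; push_body ]
  | H : trilin ?f |- eval3 ?f (tens (tens _ _) _) = _ => eapply (eval3T _ _ _ H)
  | H : trilin ?f |- eval3 ?f (tens _ _) = _ => eapply (eval3Tl _ _ H)
  end.
Ltac push := eapply eq_trans; [ push_body | cbv beta ].

(** * Coassociativity, and algebras given by their structure maps *)

Definition coassoc (K : fieldType) (C : lmodType K) (D : C -> C ⨂ C) : Prop :=
  forall (P : lmodType K) (f : C -> C -> C -> P), trilin f -> forall c,
  ∑_(x ⊗ y <- D c) ∑_(x1 ⊗ x2 <- D x) f x1 x2 y =
  ∑_(x ⊗ y <- D c) ∑_(y1 ⊗ y2 <- D y) f x y1 y2.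

Lemma coassoc_of (K : fieldType) (C : lmodType K) (D : C -> C ⨂ C) (e : C -> K) :
  is_coalgebra D e -> coassoc D.
Proof.
move=> cD P f tf c.
transitivity (eval3 f (∑_(x ⊗ y <- D c) ∑_(x1 ⊗ x2 <- D x) x1 ⊗ x2 ⊗ y)).
  by symmetry; push.
by rewrite (coalg_coassoc cD); push.
Qed.

(** A multiplication on V becomes a canonical structure on an alias of V, indexed by the
    proofs of its axioms, which gives access to the ring notations and lemmas. *)
Section AlgebraOf.
Variables (K : fieldType) (V : lmodType K) (mul : V -> V -> V) (one : V).

Definition algebra_of (alg : is_algebra mul one) (nz : one <> 0) : Type := V.

Variables (alg : is_algebra mul one) (nz : one <> 0).
Local Notation T := (algebra_of alg nz).

HB.instance Definition _ := GRing.Lmodule.copy T V.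

Let mulDl : left_distributive (mul : T -> T -> T) +%R.
Proof.
move=> x y z; have [ml _] := alg_bilinear alg.
by have := ml z 1 x y; rewrite /= !scale1r.
Qed.
Let mulDr : right_distributive (mul : T -> T -> T) +%R.
Proof.
move=> x y z; have [_ mr] := alg_bilinear alg.
by have := mr x 1 y z; rewrite /= !scale1r.
Qed.
Let one_neq0 : (one : T) != 0. Proof. exact/eqP. Qed.

HB.instance Definition _ := GRing.Zmodule_isNzRing.Build T
  (alg_assoc alg) (alg_unitl alg) (alg_unitr alg) mulDl mulDr one_neq0.

Let scaleAl (a : K) (x y : T) : a *: (x * y) = (a *: x) * y.
Proof.
have [ml _] := alg_bilinear alg.
exact: esym (linear_scale (g := fun u => mul u y) a x (ml y)).
Qed.
HB.instance Definition _ := GRing.Lmodule_isLalgebra.Build K T scaleAl.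
Let scaleAr (a : K) (x y : T) : a *: (x * y) = x * (a *: y).
Proof.
have [_ mr] := alg_bilinear alg.
exact: esym (linear_scale (g := mul x) a y (mr x)).
Qed.
HB.instance Definition _ := GRing.Lalgebra_isAlgebra.Build K T scaleAr.

Definition algType_of : algType K := T.
End AlgebraOf.

Definition linear_of (K : fieldType) (U V : lmodType K) (f : U -> V) (lf : linear f) :
    {linear U -> V} :=
  HB.pack f (GRing.isLinear.Build K U V *:%R f lf).

(** * Biproducts of a bialgebra with a retract *)

Section Biproduct.
Variables (K : fieldType) (A B H : algType K).
Variables (ΔA : {linear A -> A ⨂ A}) (εA : {scalar A}).
Variables (ΔB : {linear B -> B ⨂ B}) (εB : {scalar B}).
Variables (Δ : {linear H -> H ⨂ H}).
Variables (iA : {linear A -> H}) (iB : {linear B -> H}).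
Variables (pA : {linear H -> A}) (pB : {linear H -> B}).

Definition comul_morph (C C' : lmodType K) (D : {linear C -> C ⨂ C})
    (D' : {linear C' -> C' ⨂ C'}) (g : {linear C -> C'}) : Prop :=
  forall (P : lmodType K) (f : C' -> C' -> P), bilin f -> forall c,
  ∑_(x ⊗ y <- D' (g c)) f x y = ∑_(x ⊗ y <- D c) f (g x) (g y).

(** The bialgebra H retracts onto B by algebra and coalgebra maps, and A is the subalgebra of
    coinvariants for [pB], onto which [pA] projects along the augmentation ideal of B.  The
    last field says that A is a left coideal: [Δ (iA a)] lies in the image of [H ⊗ A]. *)
Record radford_biproduct : Prop := {
  bp_coalg : is_coalgebra Δ (fun h => εB (pB h));
  bp_coalgA : is_coalgebra ΔA εA;
  bp_coalgB : is_coalgebra ΔB εB;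
  bp_comulM : forall h k, Δ (h * k) = tensor_mul *%R *%R (Δ h) (Δ k);
  bp_counit : forall h, εA (pA h) = εB (pB h);
  bp_εBM : {morph εB : x y / x * y};
  bp_εB1 : εB 1 = 1;
  bp_iAM : {morph iA : x y / x * y};
  bp_iA1 : iA 1 = 1;
  bp_iBM : {morph iB : x y / x * y};
  bp_iB1 : iB 1 = 1;
  bp_pBM : {morph pB : x y / x * y};
  bp_pB1 : pB 1 = 1;
  bp_pA_iA : forall a, pA (iA a) = a;
  bp_pB_iB : forall b, pB (iB b) = b;
  bp_pB_iA : forall a, pB (iA a) = εA a *: 1;
  bp_pA_mulB : forall h b, pA (h * iB b) = εB b *: pA h;
  bp_pA_mulA : forall a h, pA (iA a * h) = a * pA h;
  bp_comul_iB : comul_morph ΔB Δ iB;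
  bp_comul_pB : comul_morph Δ ΔB pB;
  bp_comul_pA : comul_morph Δ ΔA pA;
  bp_factor : forall h, h = ∑_(x ⊗ y <- Δ h) iA (pA x) * iB (pB y);
  bp_comul_iA : forall a, Δ (iA a) = ∑_(x ⊗ y <- Δ (iA a)) x ⊗ iA (pA y) }.

Hypothesis bp : radford_biproduct.

Definition act (h : H) (a : A) : A := pA (h * iA a).
Local Notation "h ▷ a" := (act h a) (at level 40, left associativity).

Lemma lin_actl (P : lmodType K) (g : P -> H) a : linear g -> linear (fun x => g x ▷ a).
Proof. by move=> lg; rewrite /act; lin. Qed.
Lemma lin_actr (P : lmodType K) h (g : P -> A) : linear g -> linear (fun x => h ▷ g x).
Proof. by move=> lg; rewrite /act; lin. Qed.

Definition coact (a : A) : B ⨂ A := ∑_(x ⊗ y <- Δ (iA a)) pB x ⊗ pA y.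

Lemma lin_coact (P : lmodType K) (g : P -> A) : linear g -> linear (fun x => coact (g x)).
Proof. by move=> lg; rewrite /coact; lin. Qed.

Ltac lin_hook ::=
  match goal with
  | |- GRing.linear_for _ (fun x => act (@?g x) ?a) => apply: lin_actl; lin
  | |- GRing.linear_for _ (fun x => act ?h (@?g x)) => apply: lin_actr; lin
  | |- GRing.linear_for _ (fun x => coact (@?g x)) => apply: lin_coact; lin
  end.

Lemma coactE (P : lmodType K) (f : B -> A -> P) a : bilin f ->
  ∑_(b ⊗ a0 <- coact a) f b a0 = ∑_(x ⊗ y <- Δ (iA a)) f (pB x) (pA y).
Proof.
move=> bf; rewrite /coact sweedler_sum //.
by apply: eq_sweedler => u v; apply: sweedlerT.
Qed.

Lemma comulME (P : lmodType K) (f : H -> H -> P) h k : bilin f ->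
  ∑_(x ⊗ y <- Δ (h * k)) f x y =
  ∑_(x ⊗ y <- Δ h) ∑_(x' ⊗ y' <- Δ k) f (x * x') (y * y').
Proof.
move=> bf; rewrite (bp_comulM bp) /tensor_mul sweedler_sum //.
apply: eq_sweedler => u v; rewrite sweedler_sum //.
by apply: eq_sweedler => u' v'; apply: sweedlerT.
Qed.

Lemma counitl (P : lmodType K) (f : K^o -> H -> P) h : bilin f ->
  ∑_(x ⊗ y <- Δ h) f (εB (pB x)) y = f 1 h.
Proof. by move=> bf; apply: (counitlE (bp_coalg bp)). Qed.

Lemma counitr (P : lmodType K) (f : H -> K^o -> P) h : bilin f ->
  ∑_(x ⊗ y <- Δ h) f x (εB (pB y)) = f h 1.
Proof. by move=> bf; apply: (counitrE (bp_coalg bp)). Qed.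

Lemma counitlB (P : lmodType K) (f : K^o -> B -> P) b : bilin f ->
  ∑_(x ⊗ y <- ΔB b) f (εB x) y = f 1 b.
Proof. exact: (counitlE (bp_coalgB bp)). Qed.

Lemma counitrB (P : lmodType K) (f : B -> K^o -> P) b : bilin f ->
  ∑_(x ⊗ y <- ΔB b) f x (εB y) = f b 1.
Proof. exact: (counitrE (bp_coalgB bp)). Qed.

Lemma comul_iAE (P : lmodType K) (f : H -> H -> P) a : bilin f ->
  ∑_(x ⊗ y <- Δ (iA a)) f x y = ∑_(x ⊗ y <- Δ (iA a)) f x (iA (pA y)).
Proof.
move=> bf; rewrite {1}(bp_comul_iA bp) sweedler_sum //.
by apply: eq_sweedler => u v; apply: sweedlerT.
Qed.

Lemma factorE (P : lmodType K) (f : H -> P) h : linear f ->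
  f h = ∑_(x ⊗ y <- Δ h) f (iA (pA x) * iB (pB y)).
Proof. by move=> lf; rewrite {1}(bp_factor bp h) linear_sweedler. Qed.

(** Splitting [k] as [∑ iA (pA k₁) * iB (pB k₂)] shows that [pA (h * k)] depends on [k] only
    through [pA k]. *)
Lemma pA_mul h k : pA (h * k) = h ▷ pA k.
Proof.
rewrite (factorE (f := fun x => pA (h * x))); last by lin.
inside (rewrite mulrA (bp_pA_mulB bp)).
rewrite (counitr (f := fun x k => k *: pA (h * iA (pA x)))) ?scale1r //; lin.
Qed.

Lemma act_mul h k a : (h * k) ▷ a = h ▷ (k ▷ a).
Proof. by rewrite {1}/act -mulrA pA_mul. Qed.
Lemma act1 a : 1 ▷ a = a.
Proof. by rewrite /act mul1r (bp_pA_iA bp). Qed.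
Lemma mul_act a h a' : (iA a * h) ▷ a' = a * (h ▷ a').
Proof. by rewrite /act -mulrA (bp_pA_mulA bp). Qed.

(** A is coinvariant under the right coaction of B that [pB] induces on H. *)
Lemma comul_iA_pB (P : lmodType K) (f : H -> B -> P) a : bilin f ->
  ∑_(x ⊗ y <- Δ (iA a)) f x (pB y) = f (iA a) 1.
Proof.
move=> bf; rewrite comul_iAE; last by lin.
inside (rewrite (bp_pB_iA bp) (bp_counit bp) linear_scale; last by case: bf).
rewrite (counitr (f := fun x k => k *: f x 1)) ?scale1r //; lin.
Qed.

(** The normal ordering of H, in which elements of A stand left of those of B: in a
    product [h * iA a], the element [a] is moved to the left through its action. *)
Lemma mul_iA_reorder (P : lmodType K) (f : H -> P) h a : linear f ->
  f (h * iA a) = ∑_(x ⊗ y <- Δ h) f (iA (x ▷ a) * iB (pB y)).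
Proof.
move=> lf; rewrite (factorE _ lf); srw comulME.
inside rewrite (bp_pBM bp).
srw comul_iA_pB.
by inside rewrite mulr1.
Qed.

Lemma comul_pB_mulA (P : lmodType K) (f : H -> B -> P) a h : bilin f ->
  ∑_(x ⊗ y <- Δ (iA a * h)) f x (pB y) = ∑_(x ⊗ y <- Δ h) f (iA a * x) (pB y).
Proof.
move=> bf; srw comulME.
inside rewrite (bp_pBM bp).
srw comul_iA_pB.
by inside rewrite mul1r.
Qed.

Lemma comul_iB (P : lmodType K) (f : H -> H -> P) b : bilin f ->
  ∑_(x ⊗ y <- Δ (iB b)) f x y = ∑_(x ⊗ y <- ΔB b) f (iB x) (iB y).
Proof. by move=> bf; rewrite (bp_comul_iB bp). Qed.

Lemma comul_pB (P : lmodType K) (f : B -> B -> P) h : bilin f ->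
  ∑_(x ⊗ y <- ΔB (pB h)) f x y = ∑_(x ⊗ y <- Δ h) f (pB x) (pB y).
Proof. by move=> bf; rewrite (bp_comul_pB bp). Qed.

Lemma comul_pA (P : lmodType K) (f : A -> A -> P) h : bilin f ->
  ∑_(x ⊗ y <- ΔA (pA h)) f x y = ∑_(x ⊗ y <- Δ h) f (pA x) (pA y).
Proof. by move=> bf; rewrite (bp_comul_pA bp). Qed.

Lemma comul_mulB (P : lmodType K) (f : B -> A -> P) a b : bilin f ->
  ∑_(x ⊗ y <- Δ (iA a * iB b)) f (pB x) (pA y) =
  ∑_(c ⊗ a0 <- coact a) f (c * b) a0.
Proof.
move=> bf; srw comulME; srw comul_iB.
inside rewrite (bp_pBM bp) (bp_pA_mulB bp) (bp_pB_iB bp).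
inside (rewrite linear_scale; last by lin).
srw counitrB; inside rewrite scale1r.
symmetry; srw coactE; match_sums.
Qed.

Lemma comul_pB_pA (P : lmodType K) (f : B -> A -> P) h : bilin f ->
  ∑_(x ⊗ y <- Δ h) f (pB x) (pA y) =
  ∑_(x ⊗ y <- Δ h) ∑_(b ⊗ a0 <- coact (pA x)) f (b * pB y) a0.
Proof.
move=> bf.
rewrite (factorE (f := fun h => ∑_(x ⊗ y <- Δ h) f (pB x) (pA y))); last by lin.
by apply: eq_sweedler => x y; apply: comul_mulB.
Qed.

(** The compatibility of Yetter and Drinfeld between action and coaction.  Both sides
    compute [(pB ⊗ pA) (Δ (h * iA a))], on the left by multiplicativity of Δ and on the
    right by normal ordering of the product. *)
Lemma coact_act (P : lmodType K) (f : B -> A -> P) h a : bilin f ->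
  ∑_(x ⊗ y <- Δ h) ∑_(b ⊗ a0 <- coact a) f (pB x * b) (y ▷ a0) =
  ∑_(x ⊗ y <- Δ h) ∑_(b ⊗ a0 <- coact (x ▷ a)) f (b * pB y) a0.
Proof.
move=> bf.
transitivity (∑_(x ⊗ y <- Δ (h * iA a)) f (pB x) (pA y)).
  symmetry; srw comulME; inside rewrite (bp_pBM bp) pA_mul.
  symmetry; srw coactE; match_sums.
srw comul_pB_pA; srw comulME; within rewrite -/(act _ _).
inside rewrite (bp_pBM bp).
srw comul_iA_pB; inside rewrite mulr1; match_sums.
Qed.

Lemma coact_mul (P : lmodType K) (f : B -> A -> P) a a' : bilin f ->
  ∑_(b ⊗ c <- coact (a * a')) f b c =
  ∑_(b ⊗ c <- coact a) ∑_(b' ⊗ c' <- coact a') f (b * b') (c * c').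
Proof.
move=> bf; srw coactE; rewrite (bp_iAM bp); srw comulME; srw comul_iAE.
inside rewrite (bp_pBM bp) (bp_pA_mulA bp).
symmetry; srw coactE; srw coactE; match_sums.
Qed.

Lemma comul_act (P : lmodType K) (f : A -> A -> P) h a : bilin f ->
  ∑_(x ⊗ y <- ΔA (h ▷ a)) f x y =
  ∑_(x ⊗ y <- Δ h) ∑_(a1 ⊗ a2 <- ΔA a) f (x ▷ a1) (y ▷ a2).
Proof.
move=> bf; srw comul_pA; srw comulME. inside rewrite !pA_mul.
symmetry; rewrite -{1}(bp_pA_iA bp a). srw comul_pA. match_sums.
Qed.

Lemma comul_iA (P : lmodType K) (f : H -> H -> P) a : bilin f ->
  ∑_(x ⊗ y <- Δ (iA a)) f x y =
  ∑_(a1 ⊗ a2 <- ΔA a) ∑_(b ⊗ a0 <- coact a2) f (iA a1 * iB b) (iA a0).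
Proof.
move=> bf; srw comul_iAE.
inside (rewrite (factorE (f := fun x => f x _)) //; last by lin).
srw (coassoc_of (bp_coalg bp)).
symmetry; rewrite -{1}(bp_pA_iA bp a). srw comul_pA.
srw coactE. symmetry. srw comul_iAE.
match_sums.
Qed.

(** * Products of multiplicative tensors *)

Section Multiplicative.

(** [t] satisfies [(D ⊗ id) t = t₁₃ t₂₃], that is, pairing with the first leg is an
    algebra map from the dual of C to E.  The algebra E and its multiplication are
    arbitrary, since both hexagons are instances. *)
Definition multiplicative (C E : lmodType K) (D : {linear C -> C ⨂ C}) (m : E -> E -> E)
    (t : C ⨂ E) : Prop :=
  forall (P : lmodType K) (f : C -> C -> E -> P), trilin f ->
  ∑_(c ⊗ e <- t) ∑_(x ⊗ y <- D c) f x y e =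
  ∑_(c ⊗ e <- t) ∑_(c' ⊗ e' <- t) f c c' (m e e').

Variables (E : lmodType K) (m : E -> E -> E).
Hypotheses (mL : bilin m) (mA : associative m).

(** The relation needed to exchange the factors of [UT] at the cost of the coaction. *)
Definition braided (U : A ⨂ E) (T : B ⨂ E) : Prop :=
  forall (P : lmodType K) (f : B -> A -> E -> P), trilin f ->
  ∑_(u ⊗ e <- U) ∑_(t ⊗ e' <- T) ∑_(b ⊗ a <- coact u) f (b * t) a (m e e') =
  ∑_(t ⊗ e' <- T) ∑_(u ⊗ e <- U) f t u (m e' e).

Definition assemble (U : A ⨂ E) (T : B ⨂ E) : H ⨂ E :=
  ∑_(u ⊗ e <- U) ∑_(t ⊗ e' <- T) (iA u * iB t) ⊗ m e e'.

Lemma assembleE U T (P : lmodType K) (f : H -> E -> P) : bilin f ->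
  ∑_(h ⊗ e <- assemble U T) f h e =
  ∑_(u ⊗ e <- U) ∑_(t ⊗ e' <- T) f (iA u * iB t) (m e e').
Proof.
move=> bf; rewrite /assemble sweedler_sum //; apply: eq_sweedler => u e.
by rewrite sweedler_sum //; apply: eq_sweedler => t e'; apply: sweedlerT.
Qed.

(** [Δ (iA u * iB t)] is [∑ iA u₁ * iB (b * t₁) ⊗ iA u₂' * iB t₂], with [b ⊗ u₂'] the
    coaction on [u₂].  Multiplicativity splits [u₁, u₂] and [t₁, t₂] into independent
    copies, and the exchange relation absorbs the coaction while it brings the second
    legs into the order [U T U T]. *)
Lemma assemble_mult U T : multiplicative ΔA m U -> multiplicative ΔB m T -> braided U T ->
  multiplicative Δ m (assemble U T).
Proof.
move=> multU multT braidUT P f tf.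
srw assembleE. srw comulME. srw comul_iA. srw comul_iB. srw multT. srw multU.
inside rewrite -mulrA -(bp_iBM bp) -!mA [X in m _ X]mA.
(* The middle two of the second legs are now adjacent. *)
srw braidUT.
symmetry; srw assembleE; srw assembleE.
inside rewrite -!mA [X in m _ X]mA.
match_sums.
Qed.
End Multiplicative.

(** * Almost cocommutativity from projections and generators *)

Section Commutation.
Variable R : H ⨂ H.
Hypothesis R_l : forall (P : lmodType K) (f : H -> H -> H -> P), trilin f ->
  ∑_(r ⊗ r' <- R) ∑_(x ⊗ y <- Δ r) f x y r' =
  ∑_(r ⊗ r' <- R) ∑_(q ⊗ q' <- R) f r q (r' * q').
Hypothesis R_r : forall (P : lmodType K) (f : H -> H -> H -> P), trilin f ->
  ∑_(r ⊗ r' <- R) ∑_(x ⊗ y <- Δ r') f r x y =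
  ∑_(r ⊗ r' <- R) ∑_(q ⊗ q' <- R) f (r * q) q' r'.

(** [R Δ(h) = Δᶜᵒᵖ(h) R] after application of [p ⊗ q]. *)
Definition almost_cocomm (U V : lmodType K) (p : H -> U) (q : H -> V) (h : H) : Prop :=
  forall (P : lmodType K) (f : U -> V -> P), bilin f ->
  ∑_(r ⊗ r' <- R) ∑_(x ⊗ y <- Δ h) f (p (r * x)) (q (r' * y)) =
  ∑_(r ⊗ r' <- R) ∑_(x ⊗ y <- Δ h) f (p (y * r)) (q (x * r')).

(** The four projections of the equation imply the equation on every subcoalgebra of H;
    the subcoalgebras in use are B and H itself. *)
Section Along.
Variables (C : lmodType K) (D : {linear C -> C ⨂ C}) (j : {linear C -> H}).
Hypothesis DC : coassoc D.
Hypothesis Dj : comul_morph D Δ j.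

Lemma comul_along (P : lmodType K) (f : H -> H -> P) c : bilin f ->
  ∑_(x ⊗ y <- Δ (j c)) f x y = ∑_(x ⊗ y <- D c) f (j x) (j y).
Proof. by move=> bf; rewrite Dj. Qed.

Lemma almost_cocomm_along (U V : lmodType K) (p : H -> U) (q : H -> V) c
    (P : lmodType K) (f : U -> V -> P) :
  linear p -> linear q -> almost_cocomm p q (j c) -> bilin f ->
  ∑_(r ⊗ r' <- R) ∑_(x ⊗ y <- D c) f (p (r * j x)) (q (r' * j y)) =
  ∑_(r ⊗ r' <- R) ∑_(x ⊗ y <- D c) f (p (j y * r)) (q (j x * r')).
Proof.
move=> lp lq ac bf.
transitivity (∑_(r ⊗ r' <- R) ∑_(x ⊗ y <- Δ (j c)) f (p (r * x)) (q (r' * y))).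
  symmetry; srw comul_along; match_sums.
rewrite (ac _ _ bf); srw comul_along; match_sums.
Qed.

(** Write the first leg as [∑ iA (pA k₁) * iB (pB k₂)].  The first hexagon turns R into two
    copies of R, one for each factor, and [h] is moved past them one after the other.
    The second legs of the two copies are multiplied with each other, whence the
    condition on [q]. *)
Lemma almost_cocomm_left (V : algType K) (q : H -> V) :
  linear q -> {morph q : x y / x * y} ->
  (forall c, almost_cocomm pA q (j c)) -> (forall c, almost_cocomm pB q (j c)) ->
  forall c, almost_cocomm (fun h => h) q (j c).
Proof.
move=> lq qM acA acB c P f bf.
have Aj := fun (c : C) P f (bf : bilin f) =>
  @almost_cocomm_along _ _ _ _ c P f (linearP pA) lq (acA c) bf.
have Bj := fun (c : C) P f (bf : bilin f) =>
  @almost_cocomm_along _ _ _ _ c P f (linearP pB) lq (acB c) bf.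
srw comul_along.
inside (rewrite (factorE (f := fun k => f k _)); last by lin).
srw comulME; srw comul_along; srw R_l; inside rewrite -mulrA qM; srw DC.
srw Bj.
inside rewrite qM mulrA -qM.
srwr DC; srw Aj.
symmetry; srw comul_along.
inside (rewrite (factorE (f := fun k => f k _)); last by lin).
srw comulME; srw comul_along; srw R_l; inside rewrite mulrA qM; srwr DC.
match_sums.
Qed.

(** The same with the second leg and the second hexagon.  Here it is enough that [p] maps
    the product of H to an action [m] of H, which includes the case [p = pA]. *)
Lemma almost_cocomm_right (U : lmodType K) (p : H -> U) (m : H -> U -> U) :
  linear p -> bilin m -> (forall h k, p (h * k) = m h (p k)) ->
  (forall c, almost_cocomm p pA (j c)) ->
  (forall c, almost_cocomm (fun h => h) pB (j c)) ->
  forall c, almost_cocomm p (fun h => h) (j c).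
Proof.
move=> lp bm pM acA acB c P f bf.
have Aj := fun (c : C) P f (bf : bilin f) =>
  @almost_cocomm_along _ _ _ _ c P f lp (linearP pA) (acA c) bf.
have Bj := fun (c : C) P f (bf : bilin f) =>
  @almost_cocomm_along _ _ (fun h => h) _ c P f ltac:(lin) (linearP pB) (acB c) bf.
srw comul_along.
inside (rewrite (factorE (f := fun k => f _ k)); last by lin).
srw comulME; srw comul_along; srw R_r; inside rewrite -mulrA pM; srwr DC.
srw Aj.
inside rewrite -pM mulrA.
srw DC; srw Bj.
symmetry; srw comul_along.
inside (rewrite (factorE (f := fun k => f _ k)); last by lin).
srw comulME; srw comul_along; srw R_r; inside rewrite mulrA; srw DC.
match_sums.
Qed.

(** The order of the extensions is forced: [pA] is not multiplicative, so the first leg can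
    be freed only when the second one is seen through [pB] or is already free. *)
Lemma almost_cocomm_along_of_proj :
  (forall c, almost_cocomm pA pA (j c)) -> (forall c, almost_cocomm pA pB (j c)) ->
  (forall c, almost_cocomm pB pA (j c)) -> (forall c, almost_cocomm pB pB (j c)) ->
  forall c, almost_cocomm (fun h => h) (fun h => h) (j c).
Proof.
move=> acAA acAB acBA acBB.
have ac_B := almost_cocomm_left (linearP pB) (bp_pBM bp) acAB acBB.
apply: almost_cocomm_left => //.
- apply: (almost_cocomm_right (m := act)) => //; [exact: linearP | by lin | exact: pA_mul].
- apply: (almost_cocomm_right (m := fun h b => pB h * b)) => //;
    [exact: linearP | by lin | exact: (bp_pBM bp)].
Qed.

End Along.

(** [iA a * iB b] is moved past R in two steps.  The second one takes place behind the
    factor [iA a], so it needs the equation for [iB b] before projection. *)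
Lemma almost_cocomm_mulB (U V : lmodType K) (p : H -> U) (q : H -> V)
    (m : U -> B -> U) (n : V -> B -> V) a b :
  linear p -> linear q -> bilin m -> bilin n ->
  (forall h c, p (h * iB c) = m (p h) c) -> (forall h c, q (h * iB c) = n (q h) c) ->
  almost_cocomm p q (iA a) -> almost_cocomm (fun h => h) (fun h => h) (iB b) ->
  almost_cocomm p q (iA a * iB b).
Proof.
move=> lp lq bm bn pm qn acA acB P f bf.
srw comulME; srw comul_iB; inside rewrite !mulrA pm qn.
srw acA; inside rewrite -pm -qn.
srwr comul_iB; inside rewrite -!mulrA.
srw acB; inside rewrite !mulrA.
srwr comulME.
match_sums.
Qed.

(** The equation for B is freed of its projections first; then the projected equations
    extend from A to all products [iA a * iB b], that is to H, where they are freed in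
    turn. *)
Lemma almost_cocomm_of_gens :
  (forall b, almost_cocomm pA pA (iB b)) -> (forall b, almost_cocomm pA pB (iB b)) ->
  (forall b, almost_cocomm pB pA (iB b)) -> (forall b, almost_cocomm pB pB (iB b)) ->
  (forall a, almost_cocomm pA pA (iA a)) -> (forall a, almost_cocomm pA pB (iA a)) ->
  (forall a, almost_cocomm pB pA (iA a)) -> (forall a, almost_cocomm pB pB (iA a)) ->
  forall h, almost_cocomm (fun h => h) (fun h => h) h.
Proof.
move=> bAA bAB bBA bBB aAA aAB aBA aBB.
have acB := almost_cocomm_along_of_proj (coassoc_of (bp_coalgB bp)) (bp_comul_iB bp)
  bAA bAB bBA bBB.
have bA : bilin (fun (a : A) b => εB b *: a) by lin.
have bB : bilin (fun b c : B => b * c) by lin.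
have spread (U V : lmodType K) (p : {linear H -> U}) (q : {linear H -> V}) m n :
    bilin m -> bilin n ->
    (forall h c, p (h * iB c) = m (p h) c) -> (forall h c, q (h * iB c) = n (q h) c) ->
    (forall a, almost_cocomm p q (iA a)) -> forall h, almost_cocomm p q h.
  move=> bm bn pm qn ac h P f bf.
  rewrite (factorE (f := fun h =>
    ∑_(r ⊗ r' <- R) ∑_(x ⊗ y <- Δ h) f (p (r * x)) (q (r' * y)))); last by lin.
  rewrite (factorE (f := fun h =>
    ∑_(r ⊗ r' <- R) ∑_(x ⊗ y <- Δ h) f (p (y * r)) (q (x * r')))); last by lin.
  apply: eq_sweedler => x y.
  by apply: (almost_cocomm_mulB (linearP p) (linearP q) bm bn pm qn).
have pAm h c : pA (h * iB c) = εB c *: pA h by rewrite (bp_pA_mulB bp).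
have pBm h c : pB (h * iB c) = pB h * c by rewrite (bp_pBM bp) (bp_pB_iB bp).
have idl : linear (fun h : H => h) by lin.
pose idH : {linear H -> H} := HB.pack (fun h : H => h) (GRing.isLinear.Build _ _ _ _ _ idl).
have idD : comul_morph Δ Δ idH by [].
apply: (almost_cocomm_along_of_proj (j := idH) (coassoc_of (bp_coalg bp)) idD) => h /=.
- exact: (spread _ _ pA pA _ _ bA bA).
- exact: (spread _ _ pA pB _ _ bA bB).
- exact: (spread _ _ pB pA _ _ bB bA).
- exact: (spread _ _ pB pB _ _ bB bB).
Qed.

(** The two sides of the projected equations on the generators, in terms of action,
    coaction and the projections of R. *)
Section Components.
Variables (P : lmodType K).
Variables (f : A -> A -> P) (g : A -> B -> P) (h : B -> A -> P) (k : B -> B -> P).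
Hypotheses (bf : bilin f) (bg : bilin g) (bh : bilin h) (bk : bilin k).

Lemma cocommAA_iA_l a :
  ∑_(r ⊗ r' <- R) ∑_(x ⊗ y <- Δ (iA a)) f (pA (r * x)) (pA (r' * y)) =
  ∑_(r ⊗ r' <- R) ∑_(x ⊗ y <- ΔA a) f (r ▷ x) (r' ▷ y).
Proof.
symmetry; rewrite -{1}(bp_pA_iA bp a); srw comul_pA.
symmetry; inside rewrite !pA_mul. match_sums.
Qed.

Lemma cocommAA_iA_r a :
  ∑_(r ⊗ r' <- R) ∑_(x ⊗ y <- Δ (iA a)) f (pA (y * r)) (pA (x * r')) =
  ∑_(r ⊗ r' <- R) ∑_(x ⊗ y <- ΔA a) ∑_(b ⊗ a0 <- coact y)
    f (a0 * pA r) (x * (iB b ▷ pA r')).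
Proof.
srw comul_iA; inside rewrite (bp_pA_mulA bp) -mulrA (bp_pA_mulA bp) pA_mul.
match_sums.
Qed.

Lemma cocommAB_iA_l a :
  ∑_(r ⊗ r' <- R) ∑_(x ⊗ y <- Δ (iA a)) g (pA (r * x)) (pB (r' * y)) =
  ∑_(r ⊗ r' <- R) g (r ▷ a) (pB r').
Proof.
inside rewrite (bp_pBM bp).
srw comul_iA_pB; inside rewrite mulr1; match_sums.
Qed.

Lemma cocommAB_iA_r a :
  ∑_(r ⊗ r' <- R) ∑_(x ⊗ y <- Δ (iA a)) g (pA (y * r)) (pB (x * r')) =
  ∑_(r ⊗ r' <- R) ∑_(b ⊗ a0 <- coact a) g (a0 * pA r) (b * pB r').
Proof.
srw comul_iAE; inside rewrite (bp_pA_mulA bp) (bp_pBM bp).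
symmetry; srw coactE; match_sums.
Qed.

Lemma cocommBA_iA_l a :
  ∑_(r ⊗ r' <- R) ∑_(x ⊗ y <- Δ (iA a)) h (pB (r * x)) (pA (r' * y)) =
  ∑_(r ⊗ r' <- R) ∑_(b ⊗ a0 <- coact a) h (pB r * b) (r' ▷ a0).
Proof.
inside rewrite (bp_pBM bp) pA_mul.
symmetry; srw coactE; match_sums.
Qed.

Lemma cocommBA_iA_r a :
  ∑_(r ⊗ r' <- R) ∑_(x ⊗ y <- Δ (iA a)) h (pB (y * r)) (pA (x * r')) =
  ∑_(r ⊗ r' <- R) h (pB r) (a * pA r').
Proof.
inside rewrite (bp_pBM bp).
srw comul_iA_pB; inside rewrite mul1r (bp_pA_mulA bp); match_sums.
Qed.

(** Both sides equal [εA a] times the projection of R to [B ⊗ B]. *)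
Lemma cocommBB_iA a :
  ∑_(r ⊗ r' <- R) ∑_(x ⊗ y <- Δ (iA a)) k (pB (r * x)) (pB (r' * y)) =
  ∑_(r ⊗ r' <- R) ∑_(x ⊗ y <- Δ (iA a)) k (pB (y * r)) (pB (x * r')).
Proof.
inside rewrite !(bp_pBM bp); srw comul_iA_pB; inside rewrite mulr1.
symmetry; inside rewrite !(bp_pBM bp); srw comul_iA_pB; inside rewrite mul1r.
inside rewrite (bp_pB_iA bp) -scalerAl mul1r.
symmetry; inside rewrite (bp_pB_iA bp) -scalerAr mulr1.
inside (rewrite (linear_scale (g := fun x => k x _)); last by lin).
symmetry; inside (rewrite (linear_scale (g := fun x => k _ x)); last by lin).
match_sums.
Qed.

Lemma cocommAA_iB_l b :
  ∑_(r ⊗ r' <- R) ∑_(x ⊗ y <- Δ (iB b)) f (pA (r * x)) (pA (r' * y)) =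
  ∑_(r ⊗ r' <- R) εB b *: f (pA r) (pA r').
Proof.
srw comul_iB; inside rewrite !(bp_pA_mulB bp).
inside (rewrite linear_scale; last by lin).
inside (rewrite (linear_scale (g := fun x => f x _)); last by lin).
srw counitrB.
inside rewrite scale1r; match_sums.
Qed.

Lemma cocommAA_iB_r b :
  ∑_(r ⊗ r' <- R) ∑_(x ⊗ y <- Δ (iB b)) f (pA (y * r)) (pA (x * r')) =
  ∑_(r ⊗ r' <- R) ∑_(x ⊗ y <- ΔB b) f (iB y ▷ pA r) (iB x ▷ pA r').
Proof. srw comul_iB; inside rewrite !pA_mul; match_sums. Qed.

Lemma cocommAB_iB_l b :
  ∑_(r ⊗ r' <- R) ∑_(x ⊗ y <- Δ (iB b)) g (pA (r * x)) (pB (r' * y)) =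
  ∑_(r ⊗ r' <- R) g (pA r) (pB r' * b).
Proof.
srw comul_iB; inside rewrite (bp_pA_mulB bp) (bp_pBM bp) (bp_pB_iB bp).
inside (rewrite (linear_scale (g := fun x => g x _)); last by lin).
srw counitlB.
inside rewrite scale1r; match_sums.
Qed.

Lemma cocommAB_iB_r b :
  ∑_(r ⊗ r' <- R) ∑_(x ⊗ y <- Δ (iB b)) g (pA (y * r)) (pB (x * r')) =
  ∑_(r ⊗ r' <- R) ∑_(x ⊗ y <- ΔB b) g (iB y ▷ pA r) (x * pB r').
Proof.
srw comul_iB; inside rewrite pA_mul (bp_pBM bp) (bp_pB_iB bp); match_sums.
Qed.

Lemma cocommBA_iB_l b :
  ∑_(r ⊗ r' <- R) ∑_(x ⊗ y <- Δ (iB b)) h (pB (r * x)) (pA (r' * y)) =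
  ∑_(r ⊗ r' <- R) h (pB r * b) (pA r').
Proof.
srw comul_iB; inside rewrite (bp_pA_mulB bp) (bp_pBM bp) (bp_pB_iB bp).
inside (rewrite linear_scale; last by lin).
srw counitrB.
inside rewrite scale1r; match_sums.
Qed.

Lemma cocommBA_iB_r b :
  ∑_(r ⊗ r' <- R) ∑_(x ⊗ y <- Δ (iB b)) h (pB (y * r)) (pA (x * r')) =
  ∑_(r ⊗ r' <- R) ∑_(x ⊗ y <- ΔB b) h (y * pB r) (iB x ▷ pA r').
Proof.
srw comul_iB; inside rewrite pA_mul (bp_pBM bp) (bp_pB_iB bp); match_sums.
Qed.

Lemma cocommBB_iB_l b :
  ∑_(r ⊗ r' <- R) ∑_(x ⊗ y <- Δ (iB b)) k (pB (r * x)) (pB (r' * y)) =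
  ∑_(r ⊗ r' <- R) ∑_(x ⊗ y <- ΔB b) k (pB r * x) (pB r' * y).
Proof. srw comul_iB; inside rewrite !(bp_pBM bp) !(bp_pB_iB bp); match_sums. Qed.

Lemma cocommBB_iB_r b :
  ∑_(r ⊗ r' <- R) ∑_(x ⊗ y <- Δ (iB b)) k (pB (y * r)) (pB (x * r')) =
  ∑_(r ⊗ r' <- R) ∑_(x ⊗ y <- ΔB b) k (y * pB r) (x * pB r').
Proof. srw comul_iB; inside rewrite !(bp_pBM bp) !(bp_pB_iB bp); match_sums. Qed.
End Components.

End Commutation.

(** The axioms of a quasitriangular structure, evaluated on multilinear maps. *)
Record quasi_R (R : H ⨂ H) : Prop := {
  qr_counitl : ∑_(r ⊗ r' <- R) εB (pB r) *: r' = 1;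
  qr_counitr : ∑_(r ⊗ r' <- R) εB (pB r') *: r = 1;
  qr_comull : forall (P : lmodType K) (f : H -> H -> H -> P), trilin f ->
    ∑_(r ⊗ r' <- R) ∑_(x ⊗ y <- Δ r) f x y r' =
    ∑_(r ⊗ r' <- R) ∑_(q ⊗ q' <- R) f r q (r' * q');
  qr_comulr : forall (P : lmodType K) (f : H -> H -> H -> P), trilin f ->
    ∑_(r ⊗ r' <- R) ∑_(x ⊗ y <- Δ r') f r x y =
    ∑_(r ⊗ r' <- R) ∑_(q ⊗ q' <- R) f (r * q) q' r';
  qr_cocomm : forall h, almost_cocomm R (fun k => k) (fun k => k) h }.

(** B is a bialgebra, as a retract of H by algebra and coalgebra maps. *)
Lemma comulBM (P : lmodType K) (f : B -> B -> P) (b b' : B) : bilin f ->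
  ∑_(x ⊗ y <- ΔB (b * b')) f x y =
  ∑_(x ⊗ y <- ΔB b) ∑_(x' ⊗ y' <- ΔB b') f (x * x') (y * y').
Proof.
move=> bf; rewrite -{1}(bp_pB_iB bp b) -{1}(bp_pB_iB bp b') -(bp_pBM bp).
srw comul_pB; srw comulME; srw comul_iB; srw comul_iB.
inside rewrite !(bp_pBM bp) !(bp_pB_iB bp). match_sums.
Qed.

Lemma mul_iB_iA_reorder (P : lmodType K) (f : H -> P) b a : linear f ->
  f (iB b * iA a) = ∑_(x ⊗ y <- ΔB b) f (iA (iB x ▷ a) * iB y).
Proof.
move=> lf; rewrite mul_iA_reorder //; srw comul_iB.
by inside rewrite (bp_pB_iB bp).
Qed.

Lemma coact_actB (P : lmodType K) (f : B -> A -> P) b a : bilin f ->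
  ∑_(x ⊗ y <- ΔB b) ∑_(c ⊗ a0 <- coact a) f (x * c) (iB y ▷ a0) =
  ∑_(x ⊗ y <- ΔB b) ∑_(c ⊗ a0 <- coact (iB x ▷ a)) f (c * y) a0.
Proof.
move=> bf.
transitivity (∑_(x ⊗ y <- Δ (iB b)) ∑_(c ⊗ a0 <- coact a) f (pB x * c) (y ▷ a0)).
  symmetry; srw comul_iB; by inside rewrite (bp_pB_iB bp).
srw coact_act; srw comul_iB; by inside rewrite (bp_pB_iB bp).
Qed.

(** Comparison of the summands up to multiplicativity of [iA] and [iB]. *)
Ltac match_sums_mul :=
  align_sums ltac:(solve [reflexivity
    | rewrite ?(bp_iBM bp) ?(bp_iAM bp) ?mulrA ?mulr1 ?mul1r; reflexivity]).

(** [reorder] and [reorderB] bring a product in the summand into normal order; they find the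
    redex [h * iA a], respectively [iB b * iA a]. *)
Ltac reorder_body :=
  idtac; lazymatch goal with
  | |- ?L = _ =>
    match L with
    | context [ @GRing.mul ?R ?h (@GRing.Linear.sort ?R1 ?R2 ?R3 ?R4 iA ?a) ] =>
      let t := constr:(@GRing.mul R h (@GRing.Linear.sort R1 R2 R3 R4 iA a)) in
      let L' := (eval pattern t in L) in
      lazymatch L' with
      | ?g _ => eapply (mul_iA_reorder (f := g) h a); lin
      end
    end
  end.
Ltac reorderB_body :=
  idtac; lazymatch goal with
  | |- ?L = _ =>
    match L with
    | context [ @GRing.mul ?R (@GRing.Linear.sort ?Q1 ?Q2 ?Q3 ?Q4 iB ?b)
                              (@GRing.Linear.sort ?R1 ?R2 ?R3 ?R4 iA ?a) ] =>
      let t := constr:(@GRing.mul R (@GRing.Linear.sort Q1 Q2 Q3 Q4 iB b)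
                                    (@GRing.Linear.sort R1 R2 R3 R4 iA a)) in
      let L' := (eval pattern t in L) in
      lazymatch L' with
      | ?g _ => eapply (mul_iB_iA_reorder (f := g) b a); lin
      end
    end
  end.
Ltac reorderB := eapply eq_trans; [ under_sums reorderB_body | cbv beta ].
Ltac reorder := eapply eq_trans; [ under_sums reorder_body | cbv beta ].

(** * Partial projections of the universal matrix *)

Section Data.
Variables (W : B ⨂ B) (X : A ⨂ B) (Y : B ⨂ A) (Z : A ⨂ A).

(** These are the images of a quasitriangular structure under [id ⊗ pB], [pB ⊗ id],
    [pA ⊗ id], [id ⊗ pA], and the structure itself.  Each formula splits one leg with a
    hexagon and [h = ∑ iA (pA h₁) * iB (pB h₂)]: the first and fourth split the first leg,
    the second and third the second leg.  The order of the factors in [R₁₃ R₁₂] accounts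
    for the opposite multiplication. *)
Definition R_HB : H ⨂ B := assemble *%R X W.
Definition R_BH : B ⨂ H := flip (assemble (@opmul K B) (flip Y) (flip W)).
Definition R_AH : A ⨂ H :=
  ∑_(s ⊗ s' <- R_HB) ∑_(z ⊗ z' <- Z) (s ▷ z) ⊗ (iA z' * iB s').
Definition R_HA : H ⨂ A :=
  ∑_(u ⊗ u' <- R_AH) ∑_(y ⊗ y' <- Y) (iA u * iB y) ⊗ (u' ▷ y').
Definition R_HH : H ⨂ H := assemble *%R R_AH R_BH.

Lemma R_HBE (P : lmodType K) (f : H -> B -> P) : bilin f ->
  ∑_(s ⊗ s' <- R_HB) f s s' =
  ∑_(x ⊗ x' <- X) ∑_(w ⊗ w' <- W) f (iA x * iB w) (x' * w').
Proof. exact: assembleE. Qed.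

Lemma R_BHE (P : lmodType K) (f : B -> H -> P) : bilin f ->
  ∑_(t ⊗ t' <- R_BH) f t t' =
  ∑_(y ⊗ y' <- Y) ∑_(w ⊗ w' <- W) f (w * y) (iA y' * iB w').
Proof.
move=> bf; srw flipE; srw assembleE.
srw flipE.
srw flipE.
match_sums.
Qed.

Lemma R_AHE (P : lmodType K) (f : A -> H -> P) : bilin f ->
  ∑_(u ⊗ u' <- R_AH) f u u' =
  ∑_(s ⊗ s' <- R_HB) ∑_(z ⊗ z' <- Z) f (s ▷ z) (iA z' * iB s').
Proof.
move=> bf; rewrite /R_AH sweedler_sum //; apply: eq_sweedler => u e.
by rewrite sweedler_sum //; apply: eq_sweedler => t e'; apply: sweedlerT.
Qed.

Lemma R_HAE (P : lmodType K) (f : H -> A -> P) : bilin f ->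
  ∑_(v ⊗ v' <- R_HA) f v v' =
  ∑_(u ⊗ u' <- R_AH) ∑_(y ⊗ y' <- Y) f (iA u * iB y) (u' ▷ y').
Proof.
move=> bf; rewrite /R_HA sweedler_sum //; apply: eq_sweedler => u e.
by rewrite sweedler_sum //; apply: eq_sweedler => t e'; apply: sweedlerT.
Qed.

Lemma R_HHE (P : lmodType K) (f : H -> H -> P) : bilin f ->
  ∑_(r ⊗ r' <- R_HH) f r r' =
  ∑_(u ⊗ u' <- R_AH) ∑_(t ⊗ t' <- R_BH) f (iA u * iB t) (u' * t').
Proof. exact: assembleE. Qed.

Record normalized_data : Prop := {
  nd_W : normalized εB εB 1 1 W;
  nd_X : normalized εA εB 1 1 X;
  nd_Y : normalized εB εA 1 1 Y;
  nd_Z : normalized εA εA 1 1 Z }.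

(** The identities in terms of [▷], [coact] and the partial projections.  Each of them is
    the image of one axiom under projections of the legs.  For the identities below, the
    axiom is [(Δ ⊗ id) R = R₁₃ R₂₃] up to [C13_form] and [(id ⊗ Δ) R = R₁₃ R₁₂] from
    [C14_form] on. *)
Definition C8_form : Prop :=
  forall (P : lmodType K) (f : A -> A -> A -> P), trilin f ->
  ∑_(z ⊗ z' <- Z) ∑_(x ⊗ y <- ΔA z) f x y z' =
  ∑_(u ⊗ u' <- R_AH) ∑_(z ⊗ z' <- Z) f u z (u' ▷ z').

Definition C9_form : Prop := multiplicative ΔA *%R X.

Definition C10_form : Prop :=
  forall (P : lmodType K) (f : B -> A -> A -> P), trilin f ->
  ∑_(u ⊗ u' <- R_AH) ∑_(y ⊗ y' <- Y) ∑_(b ⊗ a <- coact u) f (b * y) a (u' ▷ y') =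
  ∑_(t ⊗ t' <- R_BH) ∑_(z ⊗ z' <- Z) f t z (t' ▷ z').

Definition C11_form : Prop := braided *%R X W.

Definition C12_form : Prop :=
  forall (P : lmodType K) (f : B -> B -> A -> P), trilin f ->
  ∑_(y ⊗ y' <- Y) ∑_(b ⊗ c <- ΔB y) f b c y' =
  ∑_(t ⊗ t' <- R_BH) ∑_(y ⊗ y' <- Y) f t y (t' ▷ y').

Definition C13_form : Prop := multiplicative ΔB *%R W.

Definition C14_form : Prop :=
  forall (P : lmodType K) (f : A -> A -> A -> P), trilin f ->
  ∑_(z ⊗ z' <- Z) ∑_(x ⊗ y <- ΔA z') f z x y =
  ∑_(v ⊗ v' <- R_HA) ∑_(z ⊗ z' <- Z) f (v ▷ z) z' v'.

Definition C15_form : Prop :=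
  forall (P : lmodType K) (f : A -> B -> A -> P), trilin f ->
  ∑_(s ⊗ s' <- R_HB) ∑_(z ⊗ z' <- Z) ∑_(b ⊗ a <- coact z') f (s ▷ z) (b * s') a =
  ∑_(v ⊗ v' <- R_HA) ∑_(x ⊗ x' <- X) f (v ▷ x) x' v'.

Definition C16_form : Prop :=
  forall (P : lmodType K) (f : A -> B -> B -> P), trilin f ->
  ∑_(x ⊗ x' <- X) ∑_(b ⊗ c <- ΔB x') f x b c =
  ∑_(s ⊗ s' <- R_HB) ∑_(x ⊗ x' <- X) f (s ▷ x) x' s'.

Definition C17_form : Prop :=
  forall (P : lmodType K) (f : B -> A -> A -> P), trilin f ->
  ∑_(y ⊗ y' <- Y) ∑_(a ⊗ c <- ΔA y') f y a c =
  ∑_(y ⊗ y' <- Y) ∑_(z ⊗ z' <- Y) f (y * z) z' y'.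

Definition C18_form : Prop :=
  forall (P : lmodType K) (f : B -> B -> A -> P), trilin f ->
  ∑_(w ⊗ w' <- W) ∑_(y ⊗ y' <- Y) ∑_(b ⊗ a <- coact y') f (w * y) (b * w') a =
  ∑_(w ⊗ w' <- W) ∑_(y ⊗ y' <- Y) f (y * w) w' y'.

Definition C19_form : Prop :=
  forall (P : lmodType K) (f : B -> B -> B -> P), trilin f ->
  ∑_(w ⊗ w' <- W) ∑_(b ⊗ c <- ΔB w') f w b c =
  ∑_(w ⊗ w' <- W) ∑_(y ⊗ y' <- W) f (w * y) y' w'.

Record hexagon_eqs : Prop := {
  qe_C8 : C8_form;
  qe_C9 : C9_form;
  qe_C10 : C10_form;
  qe_C11 : C11_form;
  qe_C12 : C12_form;
  qe_C13 : C13_form;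
  qe_C14 : C14_form;
  qe_C15 : C15_form;
  qe_C16 : C16_form;
  qe_C17 : C17_form;
  qe_C18 : C18_form;
  qe_C19 : C19_form }.

(** The images of [R Δ(h) = Δᶜᵒᵖ(h) R] for [h = iA a] in the first three, and for [h = iB b]
    in the last four. *)
Definition C1_form : Prop :=
  forall (P : lmodType K) (f : A -> A -> P), bilin f -> forall a,
  ∑_(r ⊗ r' <- R_HH) ∑_(x ⊗ y <- ΔA a) f (r ▷ x) (r' ▷ y) =
  ∑_(z ⊗ z' <- Z) ∑_(x ⊗ y <- ΔA a) ∑_(b ⊗ a0 <- coact y) f (a0 * z) (x * (iB b ▷ z')).

Definition C2_form : Prop :=
  forall (P : lmodType K) (f : A -> B -> P), bilin f -> forall a,
  ∑_(s ⊗ s' <- R_HB) f (s ▷ a) s' =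
  ∑_(x ⊗ x' <- X) ∑_(b ⊗ a0 <- coact a) f (a0 * x) (b * x').

Definition C3_form : Prop :=
  forall (P : lmodType K) (f : B -> A -> P), bilin f -> forall a,
  ∑_(t ⊗ t' <- R_BH) ∑_(b ⊗ a0 <- coact a) f (t * b) (t' ▷ a0) =
  ∑_(y ⊗ y' <- Y) f y (a * y').

Definition C4_form : Prop :=
  forall (P : lmodType K) (f : A -> A -> P), bilin f -> forall b,
  ∑_(z ⊗ z' <- Z) εB b *: f z z' =
  ∑_(z ⊗ z' <- Z) ∑_(x ⊗ y <- ΔB b) f (iB y ▷ z) (iB x ▷ z').

Definition C5_form : Prop :=
  forall (P : lmodType K) (f : A -> B -> P), bilin f -> forall b,
  ∑_(x ⊗ x' <- X) f x (x' * b) =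
  ∑_(x ⊗ x' <- X) ∑_(c ⊗ d <- ΔB b) f (iB d ▷ x) (c * x').

Definition C6_form : Prop :=
  forall (P : lmodType K) (f : B -> A -> P), bilin f -> forall b,
  ∑_(y ⊗ y' <- Y) f (y * b) y' =
  ∑_(y ⊗ y' <- Y) ∑_(c ⊗ d <- ΔB b) f (d * y) (iB c ▷ y').

Definition C7_form : Prop :=
  forall (P : lmodType K) (f : B -> B -> P), bilin f -> forall b,
  ∑_(w ⊗ w' <- W) ∑_(c ⊗ d <- ΔB b) f (w * c) (w' * d) =
  ∑_(w ⊗ w' <- W) ∑_(c ⊗ d <- ΔB b) f (d * w) (c * w').

Record cocomm_eqs : Prop := {
  qc_C1 : C1_form;
  qc_C2 : C2_form;
  qc_C3 : C3_form;
  qc_C4 : C4_form;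
  qc_C5 : C5_form;
  qc_C6 : C6_form;
  qc_C7 : C7_form }.

(** A tensor with these properties is known together with all its projections.  Both the
    tensor [R_HH] built from the identities and a given quasitriangular structure have
    them, so the seven projected equations are compared with [cocomm_eqs] for both at once. *)
Record projections (R : H ⨂ H) : Prop := {
  pr_HH : forall (P : lmodType K) (f : H -> H -> P), bilin f ->
    ∑_(r ⊗ r' <- R) f r r' = ∑_(r ⊗ r' <- R_HH) f r r';
  pr_HB : forall (P : lmodType K) (f : H -> B -> P), bilin f ->
    ∑_(r ⊗ r' <- R) f r (pB r') = ∑_(s ⊗ s' <- R_HB) f s s';
  pr_BH : forall (P : lmodType K) (f : B -> H -> P), bilin f ->
    ∑_(r ⊗ r' <- R) f (pB r) r' = ∑_(t ⊗ t' <- R_BH) f t t';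
  pr_AH : forall (P : lmodType K) (f : A -> H -> P), bilin f ->
    ∑_(r ⊗ r' <- R) f (pA r) r' = ∑_(u ⊗ u' <- R_AH) f u u';
  pr_HA : forall (P : lmodType K) (f : H -> A -> P), bilin f ->
    ∑_(r ⊗ r' <- R) f r (pA r') = ∑_(v ⊗ v' <- R_HA) f v v';
  pr_W : forall (P : lmodType K) (f : B -> B -> P), bilin f ->
    ∑_(r ⊗ r' <- R) f (pB r) (pB r') = ∑_(w ⊗ w' <- W) f w w';
  pr_X : forall (P : lmodType K) (f : A -> B -> P), bilin f ->
    ∑_(r ⊗ r' <- R) f (pA r) (pB r') = ∑_(x ⊗ x' <- X) f x x';
  pr_Y : forall (P : lmodType K) (f : B -> A -> P), bilin f ->
    ∑_(r ⊗ r' <- R) f (pB r) (pA r') = ∑_(y ⊗ y' <- Y) f y y';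
  pr_Z : forall (P : lmodType K) (f : A -> A -> P), bilin f ->
    ∑_(r ⊗ r' <- R) f (pA r) (pA r') = ∑_(z ⊗ z' <- Z) f z z' }.

Lemma cocomm_eqs_of_proj R : projections R ->
  (forall a, almost_cocomm R pA pA (iA a)) -> (forall a, almost_cocomm R pA pB (iA a)) ->
  (forall a, almost_cocomm R pB pA (iA a)) ->
  (forall b, almost_cocomm R pA pA (iB b)) -> (forall b, almost_cocomm R pA pB (iB b)) ->
  (forall b, almost_cocomm R pB pA (iB b)) -> (forall b, almost_cocomm R pB pB (iB b)) ->
  cocomm_eqs.
Proof.
move=> pr aAA aAB aBA bAA bAB bBA bBB; split=> P f bf c.
- have := aAA c P f bf; rewrite cocommAA_iA_l // cocommAA_iA_r // => e.
  srwr (pr_HH pr); rewrite e; srw (pr_Z pr); match_sums.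
- have := aAB c P f bf; rewrite cocommAB_iA_l // cocommAB_iA_r // => e.
  srwr (pr_HB pr); rewrite e; srw (pr_X pr); match_sums.
- have := aBA c P f bf; rewrite cocommBA_iA_l // cocommBA_iA_r // => e.
  srwr (pr_BH pr); rewrite e; srw (pr_Y pr); match_sums.
- have := bAA c P f bf; rewrite cocommAA_iB_l // cocommAA_iB_r // => e.
  srwr (pr_Z pr); rewrite e; srw (pr_Z pr); match_sums.
- have := bAB c P f bf; rewrite cocommAB_iB_l // cocommAB_iB_r // => e.
  srwr (pr_X pr); rewrite e; srw (pr_X pr); match_sums.
- have := bBA c P f bf; rewrite cocommBA_iB_l // cocommBA_iB_r // => e.
  srwr (pr_Y pr); rewrite e; srw (pr_Y pr); match_sums.
- have := bBB c P f bf; rewrite cocommBB_iB_l // cocommBB_iB_r // => e.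
  srwr (pr_W pr); rewrite e; srw (pr_W pr); match_sums.
Qed.

Lemma proj_of_cocomm_eqs R : projections R -> cocomm_eqs ->
  [/\ forall a, almost_cocomm R pA pA (iA a), forall a, almost_cocomm R pA pB (iA a)
    & forall a, almost_cocomm R pB pA (iA a)] /\
  [/\ forall b, almost_cocomm R pA pA (iB b), forall b, almost_cocomm R pA pB (iB b),
      forall b, almost_cocomm R pB pA (iB b) & forall b, almost_cocomm R pB pB (iB b)].
Proof.
move=> pr qc; split; split=> c P f bf.
- rewrite cocommAA_iA_l // cocommAA_iA_r //;
  srw (pr_HH pr); srw (qc_C1 qc); srwr (pr_Z pr); match_sums.
- rewrite cocommAB_iA_l // cocommAB_iA_r //;
  srw (pr_HB pr); srw (qc_C2 qc); srwr (pr_X pr); match_sums.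
- rewrite cocommBA_iA_l // cocommBA_iA_r //;
  srw (pr_BH pr); srw (qc_C3 qc); srwr (pr_Y pr); match_sums.
- rewrite cocommAA_iB_l // cocommAA_iB_r //;
  srw (pr_Z pr); rewrite (qc_C4 qc) //; srwr (pr_Z pr); match_sums.
- rewrite cocommAB_iB_l // cocommAB_iB_r //;
  srw (pr_X pr); srw (qc_C5 qc); srwr (pr_X pr); match_sums.
- rewrite cocommBA_iB_l // cocommBA_iB_r //;
  srw (pr_Y pr); srw (qc_C6 qc); srwr (pr_Y pr); match_sums.
- rewrite cocommBB_iB_l // cocommBB_iB_r //;
  srw (pr_W pr); srw (qc_C7 qc); srwr (pr_W pr); match_sums.
Qed.

(** * The hexagons from the identities *)

Hypotheses (ne : normalized_data) (qe : hexagon_eqs).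

Lemma normX1 (P : lmodType K) (f : K^o -> B -> P) :
  bilin f -> ∑_(x ⊗ x' <- X) f (εA x) x' = f 1 1.
Proof. by case: (nd_X ne) => e1 _ bf; exact: (sweedler_counitl e1 bf). Qed.
Lemma normX2 (P : lmodType K) (f : A -> K^o -> P) :
  bilin f -> ∑_(x ⊗ x' <- X) f x (εB x') = f 1 1.
Proof. by case: (nd_X ne) => _ e2 bf; exact: (sweedler_counitr e2 bf). Qed.
Lemma normY1 (P : lmodType K) (f : K^o -> A -> P) :
  bilin f -> ∑_(x ⊗ x' <- Y) f (εB x) x' = f 1 1.
Proof. by case: (nd_Y ne) => e1 _ bf; exact: (sweedler_counitl e1 bf). Qed.
Lemma normY2 (P : lmodType K) (f : B -> K^o -> P) :
  bilin f -> ∑_(x ⊗ x' <- Y) f x (εA x') = f 1 1.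
Proof. by case: (nd_Y ne) => _ e2 bf; exact: (sweedler_counitr e2 bf). Qed.
Lemma normW1 (P : lmodType K) (f : K^o -> B -> P) :
  bilin f -> ∑_(x ⊗ x' <- W) f (εB x) x' = f 1 1.
Proof. by case: (nd_W ne) => e1 _ bf; exact: (sweedler_counitl e1 bf). Qed.
Lemma normW2 (P : lmodType K) (f : B -> K^o -> P) :
  bilin f -> ∑_(x ⊗ x' <- W) f x (εB x') = f 1 1.
Proof. by case: (nd_W ne) => _ e2 bf; exact: (sweedler_counitr e2 bf). Qed.
Lemma normZ1 (P : lmodType K) (f : K^o -> A -> P) :
  bilin f -> ∑_(x ⊗ x' <- Z) f (εA x) x' = f 1 1.
Proof. by case: (nd_Z ne) => e1 _ bf; exact: (sweedler_counitl e1 bf). Qed.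
Lemma normZ2 (P : lmodType K) (f : A -> K^o -> P) :
  bilin f -> ∑_(x ⊗ x' <- Z) f x (εA x') = f 1 1.
Proof. by case: (nd_Z ne) => _ e2 bf; exact: (sweedler_counitr e2 bf). Qed.

Lemma pB_AB a b : pB (iA a * iB b) = εA a *: b.
Proof. by rewrite (bp_pBM bp) (bp_pB_iA bp) (bp_pB_iB bp) -scalerAl mul1r. Qed.
Lemma pA_AB a b : pA (iA a * iB b) = εB b *: a.
Proof. by rewrite (bp_pA_mulB bp) (bp_pA_iA bp). Qed.

Lemma R_HB_pB (P : lmodType K) (f : B -> B -> P) : bilin f ->
  ∑_(s ⊗ s' <- R_HB) f (pB s) s' = ∑_(w ⊗ w' <- W) f w w'.
Proof.
move=> bf; srw R_HBE; inside rewrite pB_AB.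
srw normX1; inside rewrite scale1r mul1r.
match_sums.
Qed.

Lemma R_BH_pB (P : lmodType K) (f : B -> B -> P) : bilin f ->
  ∑_(t ⊗ t' <- R_BH) f t (pB t') = ∑_(w ⊗ w' <- W) f w w'.
Proof.
move=> bf; srw R_BHE; inside rewrite pB_AB.
srw normY2; inside rewrite scale1r mulr1.
match_sums.
Qed.

Lemma R_BH_pA (P : lmodType K) (f : B -> A -> P) : bilin f ->
  ∑_(t ⊗ t' <- R_BH) f t (pA t') = ∑_(y ⊗ y' <- Y) f y y'.
Proof.
move=> bf; srw R_BHE; inside rewrite pA_AB.
srw normW2; inside rewrite scale1r mul1r.
match_sums.
Qed.

(** The hexagons for the partial projections are established from the smallest tensors to
    the largest, each from those before it. *)
Lemma R_HB_comull : multiplicative Δ *%R R_HB.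
Proof.
apply: assemble_mult; [by lin | exact: mulrA | exact: qe_C9 | exact: qe_C13 |].
exact: qe_C11.
Qed.

(** The mirror image of the preceding lemma, for the second leg. *)
Lemma R_BH_flip_comul : multiplicative Δ (@opmul K B) (assemble (@opmul K B) (flip Y) (flip W)).
Proof.
apply: assemble_mult; [by lin | exact: opmulA | | | ] => P f tf.
- srw flipE; srw (qe_C17 qe); symmetry; srw flipE; srw flipE; match_sums.
- srw flipE; srw (qe_C19 qe); symmetry; srw flipE; srw flipE; match_sums.
- srw flipE; srw flipE; inside rewrite /opmul; srw (qe_C18 qe).
  symmetry; srw flipE; srw flipE; match_sums.
Qed.

Lemma R_BH_comulr (P : lmodType K) (f : B -> H -> H -> P) : trilin f ->
  ∑_(t ⊗ t' <- R_BH) ∑_(x ⊗ y <- Δ t') f t x y =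
  ∑_(t ⊗ t' <- R_BH) ∑_(u ⊗ u' <- R_BH) f (t * u) u' t'.
Proof.
move=> tf; rewrite /R_BH; srw flipE; srw R_BH_flip_comul; symmetry; srw flipE; srw flipE.
match_sums.
Qed.

Lemma R_HB_comull_pB2 (P : lmodType K) (f : H -> B -> B -> P) : trilin f ->
  ∑_(s ⊗ s' <- R_HB) ∑_(x ⊗ y <- Δ s) f x (pB y) s' =
  ∑_(s ⊗ s' <- R_HB) ∑_(w ⊗ w' <- W) f s w (s' * w').
Proof. move=> tf; srw R_HB_comull; rewrite sweedler_exchange; srw R_HB_pB; match_sums. Qed.

Lemma R_HB_comull_pB1 (P : lmodType K) (f : B -> H -> B -> P) : trilin f ->
  ∑_(s ⊗ s' <- R_HB) ∑_(x ⊗ y <- Δ s) f (pB x) y s' =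
  ∑_(s ⊗ s' <- R_HB) ∑_(w ⊗ w' <- W) f w s (w' * s').
Proof. move=> tf; srw R_HB_comull; srw R_HB_pB; match_sums. Qed.

Lemma R_BH_comulr_pB (P : lmodType K) (f : B -> H -> B -> P) : trilin f ->
  ∑_(t ⊗ t' <- R_BH) ∑_(x ⊗ y <- Δ t') f t x (pB y) =
  ∑_(t ⊗ t' <- R_BH) ∑_(w ⊗ w' <- W) f (w * t) t' w'.
Proof. move=> tf; srw R_BH_comulr; srw R_BH_pB; match_sums. Qed.

(** On the right-hand side the first legs are multiplied; normal ordering comultiplies one
    of them, and the first hexagon of [R_HB] splits it into a copy of [R_HB] and one of W. *)
Lemma R_HB_comulr (P : lmodType K) (f : H -> B -> B -> P) : trilin f ->
  ∑_(s ⊗ s' <- R_HB) ∑_(x ⊗ y <- ΔB s') f s x y =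
  ∑_(s ⊗ s' <- R_HB) ∑_(v ⊗ v' <- R_HB) f (s * v) v' s'.
Proof.
move=> tf; srw R_HBE; srw comulBM; srw (qe_C19 qe); srw (qe_C16 qe).
symmetry; rewrite sweedler_exchange; srw R_HBE; inside rewrite mulrA; reorder.
srw R_HB_comull_pB2; inside rewrite -mulrA -(bp_iBM bp).
match_sums.
Qed.

Lemma R_BH_comull : multiplicative ΔB *%R R_BH.
Proof.
move=> P f tf; srw R_BHE; srw comulBM; srw (qe_C13 qe); srw (qe_C12 qe).
symmetry; rewrite sweedler_exchange; srw R_BHE; inside rewrite mulrA; reorder.
srw R_BH_comulr_pB; inside rewrite -mulrA -(bp_iBM bp).
match_sums.
Qed.

Lemma R_AH_comulr_pB (P : lmodType K) (f : A -> H -> B -> P) : trilin f ->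
  ∑_(u ⊗ u' <- R_AH) ∑_(x ⊗ y <- Δ u') f u x (pB y) =
  ∑_(s ⊗ s' <- R_HB) ∑_(u ⊗ u' <- R_AH) f (s ▷ u) u' s'.
Proof.
move=> tf; srw R_AHE; srw comul_pB_mulA; srw comul_iB.
inside rewrite (bp_pB_iB bp).
srw R_HB_comulr; inside rewrite act_mul.
symmetry; rewrite sweedler_exchange; srw R_AHE.
match_sums.
Qed.

Lemma R_AH_comull : multiplicative ΔA *%R R_AH.
Proof.
move=> P f tf; srw R_AHE; srw comul_act; srw R_HB_comull; srw (qe_C8 qe).
symmetry; rewrite sweedler_exchange; srw R_AHE; inside rewrite mulrA; reorder.
srw R_AH_comulr_pB; inside rewrite -mulrA -(bp_iBM bp).
match_sums.
Qed.

(** Normal ordering of the product of the second legs, with the second hexagon of [R_BH],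
    leads to the right-hand side of [C10_form].  This identity exchanges the factors at the
    cost of a coaction, after which the first leg of [R_HB] still acts; the compatibility of
    Yetter and Drinfeld turns this into a coaction after the action. *)
Lemma R_AH_BH_braided : braided *%R R_AH R_BH.
Proof.
move=> P f tf; symmetry.
rewrite sweedler_exchange; srw R_AHE; inside rewrite mulrA; reorder.
srw R_BH_comulr_pB; inside rewrite -mulrA -(bp_iBM bp).
srwr (qe_C10 qe).
srwr R_HB_comull_pB1; inside rewrite mulrA.
(* The action of [R_HB] follows the coaction; interchange the two. *)
front R_AH; srw coact_act.
inside rewrite -mulrA; srw R_HB_comull_pB2.
inside rewrite (bp_iBM bp) mulrA.
srwr R_AH_comulr_pB.
symmetry; srw R_BHE; inside rewrite !mulrA; reorder.
match_sums_mul.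
Qed.

(** [R_HH] was built by splitting the first leg.  Splitting the second leg first gives the
    same tensor, which is what makes the second hexagon accessible. *)
Lemma R_HH_HB_HA (P : lmodType K) (f : H -> H -> P) : bilin f ->
  ∑_(r ⊗ r' <- R_HH) f r r' =
  ∑_(s ⊗ s' <- R_HB) ∑_(v ⊗ v' <- R_HA) f (s * v) (iA v' * iB s').
Proof.
move=> bf; symmetry; srw R_HAE; inside rewrite mulrA; reorder.
srw R_HB_comull_pB2; inside rewrite (bp_iBM bp) mulrA.
srwr R_AH_comulr_pB.
symmetry; srw R_HHE; srw R_BHE; inside rewrite !mulrA; reorder.
match_sums_mul.
Qed.

Lemma R_HA_comull_pB (P : lmodType K) (f : H -> B -> A -> P) : trilin f ->
  ∑_(v ⊗ v' <- R_HA) ∑_(x ⊗ y <- Δ v) f x (pB y) v' =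
  ∑_(r ⊗ r' <- R_HH) ∑_(y ⊗ y' <- Y) f r y (r' ▷ y').
Proof.
move=> tf; srw R_HAE; srw comul_pB_mulA; srw comul_iB; inside rewrite (bp_pB_iB bp).
srw (qe_C12 qe); inside rewrite -act_mul.
symmetry; srw R_HHE; match_sums.
Qed.

(** The combination in which [R_HH] meets X in the exchange relation below; [C15_form]
    evaluates it. *)
Lemma R_HH_act_X (P : lmodType K) (f : A -> B -> H -> P) : trilin f ->
  ∑_(r ⊗ r' <- R_HH) ∑_(x ⊗ x' <- X) f (r ▷ x) x' r' =
  ∑_(s ⊗ s' <- R_HB) ∑_(b ⊗ c <- ΔB s') ∑_(z ⊗ z' <- Z) ∑_(b' ⊗ a <- coact z')
    f (s ▷ z) (b' * b) (iA a * iB c).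
Proof.
move=> tf; srw R_HH_HB_HA; inside rewrite act_mul.
srwr (qe_C15 qe); inside rewrite -act_mul.
rewrite sweedler_exchange.
srwr R_HB_comulr; match_sums.
Qed.

(** The exchange relation for the second hexagon.  After normal ordering of the first legs,
    [R_HH_act_X] produces a coaction on the second leg of Z; [C18_form] and the
    compatibility of Yetter and Drinfeld make it a coaction on a product, as demanded. *)
Lemma R_HA_HB_braided : braided (@opmul K H) (flip R_HA) (flip R_HB).
Proof.
move=> P f tf; symmetry; srw flipE; srw flipE; inside rewrite /opmul.
srw R_HBE; inside rewrite mulrA; reorder.
srw R_HA_comull_pB; srw R_HH_act_X.
inside rewrite mul_act.
inside rewrite -!mulrA -(bp_iBM bp).
srwr (qe_C18 qe); inside rewrite [X in f (_ * X) _ _]mulrA.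
front R_HB; srw coact_actB; inside rewrite -!mulrA [X in f X _ _]mulrA.
front Z; srwr coact_mul.
symmetry; srw flipE; srw flipE; inside rewrite /opmul.
srw R_HAE; inside rewrite mulrA; reorder.
srw R_HB_comull_pB2; srw R_AHE.
within rewrite mul_act.
inside rewrite mulrA -act_mul.
rewrite sweedler_exchange.
srwr R_HB_comulr. match_sums_mul.
Qed.

Lemma R_HA_HB_exchange (P : lmodType K) (f : B -> A -> H -> P) : trilin f ->
  ∑_(v ⊗ v' <- R_HA) ∑_(s ⊗ s' <- R_HB) ∑_(b ⊗ a <- coact v') f (b * s') a (s * v) =
  ∑_(s ⊗ s' <- R_HB) ∑_(v ⊗ v' <- R_HA) f s' v' (v * s).
Proof.
move=> tf; symmetry.
transitivity (∑_(s ⊗ s' <- flip R_HB) ∑_(v ⊗ v' <- flip R_HA) f s v (opmul s' v')).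
  symmetry; srw flipE; srw flipE; match_sums.
srwr R_HA_HB_braided; srw flipE; srw flipE; match_sums.
Qed.

(** The second leg of [R_AH] is a product of an element of A and one of B, so its
    comultiplication contains a coaction.  [C14_form] splits Z into copies, after which
    the coaction is absorbed by the exchange relation between [R_HB] and [R_HA]. *)
Lemma R_AH_comulr (P : lmodType K) (f : A -> H -> H -> P) : trilin f ->
  ∑_(u ⊗ u' <- R_AH) ∑_(x ⊗ y <- Δ u') f u x y =
  ∑_(r ⊗ r' <- R_HH) ∑_(u ⊗ u' <- R_AH) f (r ▷ u) u' r'.
Proof.
move=> tf; srw R_AHE; srw comulME; srw comul_iA; srw comul_iB; srw R_HB_comulr.
inside rewrite act_mul.
srw (qe_C14 qe).
inside rewrite -mulrA -(bp_iBM bp).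
inside rewrite -[X in f (_ ▷ X) _ _]act_mul.
srw R_HA_HB_exchange.
symmetry; srw R_HH_HB_HA.
rewrite sweedler_exchange; srw R_AHE; inside rewrite act_mul -[X in f (_ ▷ X) _ _]act_mul.
match_sums_mul.
Qed.

Lemma R_HA_comulr (P : lmodType K) (f : H -> A -> A -> P) : trilin f ->
  ∑_(v ⊗ v' <- R_HA) ∑_(x ⊗ y <- ΔA v') f v x y =
  ∑_(v ⊗ v' <- R_HA) ∑_(u ⊗ u' <- R_HA) f (v * u) u' v'.
Proof.
move=> tf; srw R_HAE; srw comul_act; srw (qe_C17 qe); srw R_AH_comulr; srw R_HHE.
inside rewrite mul_act act_mul.
symmetry; srw R_HAE; front R_HA; srw R_HAE.
inside rewrite -!mulrA [X in f (_ * X) _ _]mulrA; reorderB.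
srw (qe_C12 qe).
match_sums_mul.
Qed.

Lemma R_HH_comull (P : lmodType K) (f : H -> H -> H -> P) : trilin f ->
  ∑_(r ⊗ r' <- R_HH) ∑_(x ⊗ y <- Δ r) f x y r' =
  ∑_(r ⊗ r' <- R_HH) ∑_(q ⊗ q' <- R_HH) f r q (r' * q').
Proof.
move: P f; apply: assemble_mult; [by lin | exact: mulrA | exact: R_AH_comull
  | exact: R_BH_comull | exact: R_AH_BH_braided].
Qed.

Lemma R_HH_flip : R_HH = flip (assemble (@opmul K H) (flip R_HA) (flip R_HB)).
Proof.
apply: tensor_ext => P f bf; srw R_HH_HB_HA.
symmetry; srw flipE; srw assembleE; srw flipE; srw flipE; inside rewrite /opmul; match_sums.
Qed.

(** The second hexagon for R is the first one for the flipped R, assembled from the flipped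
    [R_HA] and [R_HB] in the opposite algebra. *)
Lemma R_HH_comulr (P : lmodType K) (f : H -> H -> H -> P) : trilin f ->
  ∑_(r ⊗ r' <- R_HH) ∑_(x ⊗ y <- Δ r') f r x y =
  ∑_(r ⊗ r' <- R_HH) ∑_(q ⊗ q' <- R_HH) f (r * q) q' r'.
Proof.
have m_R : multiplicative Δ (@opmul K H) (assemble (@opmul K H) (flip R_HA) (flip R_HB)).
  apply: assemble_mult; [lin | exact: opmulA | | | exact: R_HA_HB_braided] => P' g tg.
  - srw flipE; srw R_HA_comulr; symmetry; srw flipE; srw flipE; match_sums.
  - srw flipE; srw R_HB_comulr; symmetry; srw flipE; srw flipE; match_sums.
move=> tf; rewrite R_HH_flip; srw flipE; srw m_R; symmetry; srw flipE; srw flipE; match_sums.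
Qed.

Lemma R_HB_εB (P : lmodType K) (f : H -> K^o -> P) : bilin f ->
  ∑_(s ⊗ s' <- R_HB) f s (εB s') = f 1 1.
Proof.
move=> bf; srw R_HBE; inside rewrite (bp_εBM bp).
srw normX2; srw normW2; by rewrite (bp_iA1 bp) (bp_iB1 bp) !mulr1.
Qed.

Lemma R_BH_εB (P : lmodType K) (f : K^o -> H -> P) : bilin f ->
  ∑_(t ⊗ t' <- R_BH) f (εB t) t' = f 1 1.
Proof.
move=> bf; srw R_BHE; inside rewrite (bp_εBM bp).
srw normY1; srw normW1; by rewrite (bp_iA1 bp) (bp_iB1 bp) !mulr1.
Qed.

Lemma εA_act h a : εA (h ▷ a) = εB (pB h) * εA a.
Proof.
rewrite /act (bp_counit bp) (bp_pBM bp) (bp_εBM bp) (bp_pB_iA bp) linearZ /=.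
by rewrite (bp_εB1 bp) mulr1.
Qed.

Lemma R_AH_εA (P : lmodType K) (f : K^o -> H -> P) : bilin f ->
  ∑_(u ⊗ u' <- R_AH) f (εA u) u' = f 1 1.
Proof.
move=> bf; srw R_AHE; inside rewrite εA_act.
srw R_HB_pB; srw normW1; srw normZ1.
by rewrite (bp_iA1 bp) (bp_iB1 bp) !mulr1.
Qed.

Lemma R_HA_εA (P : lmodType K) (f : H -> K^o -> P) : bilin f ->
  ∑_(v ⊗ v' <- R_HA) f v (εA v') = f 1 1.
Proof.
move=> bf; srw R_HAE; inside rewrite εA_act.
srw R_AHE; inside rewrite pB_AB linearZ /=.
srw R_HB_εB; srw normZ2; srw normY2.
by rewrite act1 (bp_iA1 bp) (bp_iB1 bp) !mulr1.
Qed.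

Lemma R_HH_projections : projections R_HH.
Proof.
have eHB (P : lmodType K) (f : H -> B -> P) : bilin f ->
    ∑_(r ⊗ r' <- R_HH) f r (pB r') = ∑_(s ⊗ s' <- R_HB) f s s'.
  move=> bf; srw R_HH_HB_HA; inside rewrite pB_AB.
  srw R_HA_εA; inside rewrite scale1r mulr1; match_sums.
have eBH (P : lmodType K) (f : B -> H -> P) : bilin f ->
    ∑_(r ⊗ r' <- R_HH) f (pB r) r' = ∑_(t ⊗ t' <- R_BH) f t t'.
  move=> bf; srw R_HHE; inside rewrite pB_AB.
  srw R_AH_εA; inside rewrite scale1r mul1r; match_sums.
have eAH (P : lmodType K) (f : A -> H -> P) : bilin f ->
    ∑_(r ⊗ r' <- R_HH) f (pA r) r' = ∑_(u ⊗ u' <- R_AH) f u u'.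
  move=> bf; srw R_HHE; inside rewrite pA_AB.
  srw R_BH_εB; inside rewrite scale1r mulr1; match_sums.
have eHA (P : lmodType K) (f : H -> A -> P) : bilin f ->
    ∑_(r ⊗ r' <- R_HH) f r (pA r') = ∑_(v ⊗ v' <- R_HA) f v v'.
  move=> bf; srw R_HH_HB_HA; inside rewrite pA_AB.
  srw R_HB_εB; inside rewrite scale1r mul1r; match_sums.
split=> // P f bf.
- by srw eHB; srw R_HB_pB.
- srw eHB; srw R_HBE; inside rewrite pA_AB; srw normW1; inside rewrite scale1r mulr1.
  match_sums.
- by srw eBH; srw R_BH_pA.
- srw eAH; srw R_AHE; inside rewrite pA_AB; srw R_HB_εB; inside rewrite scale1r act1.
  match_sums.
Qed.

(** Over [pB ⊗ pB], commutation with A holds for every tensor, so that [cocomm_eqs] covers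
    the other seven projected equations. *)
Theorem R_HH_quasi : cocomm_eqs -> quasi_R R_HH.
Proof.
move=> qc; have pr := R_HH_projections.
split; [| | exact: R_HH_comull | exact: R_HH_comulr |].
- rewrite (pr_BH pr (f := fun b h => εB b *: h)); last by lin.
  by rewrite (R_BH_εB (f := fun k h => k *: h)) ?scale1r //; lin.
- rewrite (pr_HB pr (f := fun h b => εB b *: h)); last by lin.
  by rewrite (R_HB_εB (f := fun h k => k *: h)) ?scale1r //; lin.
have [[aAA aAB aBA] [bAA bAB bBA bBB]] := proj_of_cocomm_eqs pr qc.
by apply: (almost_cocomm_of_gens R_HH_comull R_HH_comulr) => // a P f bf; apply: cocommBB_iA.
Qed.

End Data.

(** * The projections of a quasitriangular structure *)

Section Necessity.
Variable R : H ⨂ H.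
Hypothesis qR : quasi_R R.

Definition proj_pair (U V : lmodType K) (p : H -> U) (q : H -> V) : U ⨂ V :=
  ∑_(r ⊗ r' <- R) p r ⊗ q r'.

Lemma proj_pairE (U V : lmodType K) {p : H -> U} {q : H -> V} (P : lmodType K)
    (f : U -> V -> P) : bilin f ->
  ∑_(u ⊗ v <- proj_pair p q) f u v = ∑_(r ⊗ r' <- R) f (p r) (q r').
Proof.
move=> bf; rewrite /proj_pair sweedler_sum //.
by apply: eq_sweedler => u v; apply: sweedlerT.
Qed.

Local Notation W := (proj_pair pB pB).
Local Notation X := (proj_pair pA pB).
Local Notation Y := (proj_pair pB pA).
Local Notation Z := (proj_pair pA pA).

Lemma proj_normalized : normalized_data W X Y Z.
Proof.
have eA h : εA (pA h) = εB (pB h) := bp_counit bp h.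
have pA1 : pA 1 = 1 by rewrite -(bp_iA1 bp) (bp_pA_iA bp).
have pB1 := bp_pB1 bp.
have cl (U : lmodType K) (p : {linear H -> U}) :
    ∑_(r ⊗ r' <- R) εB (pB r) *: p r' = p 1.
  rewrite -(qr_counitl qR) linear_sweedler; last exact: linearP.
  by apply: eq_sweedler => r r'; rewrite linearZ.
have cr (U : lmodType K) (p : {linear H -> U}) :
    ∑_(r ⊗ r' <- R) εB (pB r') *: p r = p 1.
  rewrite -(qr_counitr qR) linear_sweedler; last exact: linearP.
  by apply: eq_sweedler => r r'; rewrite linearZ.
split; split.
- by rewrite (proj_pairE (f := fun u v => εB u *: v)) ?cl //; lin.
- by rewrite (proj_pairE (f := fun u v => εB v *: u)) ?cr //; lin.
- rewrite (proj_pairE (f := fun u v => εA u *: v)); last by lin.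
  by under eq_sweedler do rewrite eA; rewrite cl.
- by rewrite (proj_pairE (f := fun u v => εB v *: u)) ?cr //; lin.
- by rewrite (proj_pairE (f := fun u v => εB u *: v)) ?cl //; lin.
- rewrite (proj_pairE (f := fun u v => εA v *: u)); last by lin.
  by under eq_sweedler do rewrite eA; rewrite cr.
- rewrite (proj_pairE (f := fun u v => εA u *: v)); last by lin.
  by under eq_sweedler do rewrite eA; rewrite cl.
- rewrite (proj_pairE (f := fun u v => εA v *: u)); last by lin.
  by under eq_sweedler do rewrite eA; rewrite cr.
Qed.

(** Each partial projection of R is computed by splitting the leg that is not projected; the
    order of the four computations follows the dependencies between the definitions. *)
Lemma R_projections : projections W X Y Z R.
Proof.
have eHB (P : lmodType K) (f : H -> B -> P) : bilin f ->
    ∑_(r ⊗ r' <- R) f r (pB r') = ∑_(s ⊗ s' <- R_HB W X) f s s'.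
  move=> bf; inside (rewrite (factorE (f := fun h => f h _)); last by lin).
  srw (qr_comull qR); inside rewrite (bp_pBM bp).
  symmetry; srw R_HBE; srw proj_pairE; srw proj_pairE; match_sums.
have eBH (P : lmodType K) (f : B -> H -> P) : bilin f ->
    ∑_(r ⊗ r' <- R) f (pB r) r' = ∑_(t ⊗ t' <- R_BH W Y) f t t'.
  move=> bf; inside (rewrite (factorE (f := fun h => f _ h)); last by lin).
  srw (qr_comulr qR); inside rewrite (bp_pBM bp).
  symmetry; srw R_BHE; srw proj_pairE; srw proj_pairE; match_sums.
have eAH (P : lmodType K) (f : A -> H -> P) : bilin f ->
    ∑_(r ⊗ r' <- R) f (pA r) r' = ∑_(u ⊗ u' <- R_AH W X Z) f u u'.
  move=> bf; inside (rewrite (factorE (f := fun h => f _ h)); last by lin).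
  srw (qr_comulr qR); inside rewrite pA_mul.
  symmetry; srw R_AHE; srwr eHB; srw proj_pairE; match_sums.
have eHA (P : lmodType K) (f : H -> A -> P) : bilin f ->
    ∑_(r ⊗ r' <- R) f r (pA r') = ∑_(v ⊗ v' <- R_HA W X Y Z) f v v'.
  move=> bf; inside (rewrite (factorE (f := fun h => f h _)); last by lin).
  srw (qr_comull qR); inside rewrite pA_mul.
  symmetry; srw R_HAE; srwr eAH; srw proj_pairE; match_sums.
split=> // P f bf; try by symmetry; srw proj_pairE.
inside (rewrite (factorE (f := fun h => f h _)); last by lin).
srw (qr_comull qR).
symmetry; srw R_HHE; srwr eAH; srwr eBH; match_sums.
Qed.

Let pr := R_projections.

(** Every identity is a hexagon of R read through projections: a comultiplication on the
    left-hand side turns into a product in H, and the products of projections come from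
    [pA (h * k) = h ▷ pA k] and from [pB] being multiplicative.  In the exchange
    relations [C10_form], [C11_form], [C15_form] and [C18_form] the hexagon is used in both
    directions, around the formula for [(pB ⊗ pA) (Δ h)]. *)
Lemma proj_hexagon : hexagon_eqs W X Y Z.
Proof.
split=> P f tf.
- srwr (pr_Z pr); srw comul_pA; srw (qr_comull qR); inside rewrite pA_mul.
  symmetry; srwr (pr_AH pr); srwr (pr_Z pr); match_sums.
- srwr (pr_X pr); srw comul_pA; srw (qr_comull qR); inside rewrite (bp_pBM bp).
  symmetry; srwr (pr_X pr); srwr (pr_X pr); match_sums.
- srwr (pr_AH pr); srwr (pr_Y pr); inside rewrite -pA_mul.
  srwr (qr_comull qR); srwr comul_pB_pA; srw (qr_comull qR); inside rewrite pA_mul.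
  symmetry; srwr (pr_BH pr); srwr (pr_Z pr); match_sums.
- srwr (pr_X pr); srwr (pr_W pr); inside rewrite -(bp_pBM bp).
  srwr (qr_comull qR); srwr comul_pB_pA; srw (qr_comull qR); inside rewrite (bp_pBM bp).
  symmetry; srwr (pr_W pr); srwr (pr_X pr); match_sums.
- srwr (pr_Y pr); srw comul_pB; srw (qr_comull qR); inside rewrite pA_mul.
  symmetry; srwr (pr_BH pr); srwr (pr_Y pr); match_sums.
- srwr (pr_W pr); srw comul_pB; srw (qr_comull qR); inside rewrite (bp_pBM bp).
  symmetry; srwr (pr_W pr); srwr (pr_W pr); match_sums.
- srwr (pr_Z pr); srw comul_pA; srw (qr_comulr qR); inside rewrite pA_mul.
  symmetry; srwr (pr_HA pr); srwr (pr_Z pr); match_sums.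
- srwr (pr_HB pr); srwr (pr_Z pr); inside rewrite -pA_mul.
  srwr (qr_comulr qR); srwr comul_pB_pA; srw (qr_comulr qR); inside rewrite pA_mul.
  symmetry; srwr (pr_HA pr); srwr (pr_X pr); match_sums.
- srwr (pr_X pr); srw comul_pB; srw (qr_comulr qR); inside rewrite pA_mul.
  symmetry; srwr (pr_HB pr); srwr (pr_X pr); match_sums.
- srwr (pr_Y pr); srw comul_pA; srw (qr_comulr qR); inside rewrite (bp_pBM bp).
  symmetry; srwr (pr_Y pr); srwr (pr_Y pr); match_sums.
- srwr (pr_W pr); srwr (pr_Y pr); inside rewrite -(bp_pBM bp).
  srwr (qr_comulr qR); srwr comul_pB_pA; srw (qr_comulr qR); inside rewrite (bp_pBM bp).
  symmetry; srwr (pr_W pr); srwr (pr_Y pr); match_sums.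
- srwr (pr_W pr); srw comul_pB; srw (qr_comulr qR); inside rewrite (bp_pBM bp).
  symmetry; srwr (pr_W pr); srwr (pr_W pr); match_sums.
Qed.

Lemma proj_cocomm : cocomm_eqs W X Y Z.
Proof.
have ac (U V : lmodType K) (p : {linear H -> U}) (q : {linear H -> V}) h :
    almost_cocomm R p q h.
  by move=> P f bf; have := qr_cocomm qR h; move/(_ P (fun x y => f (p x) (q y))); apply; lin.
by apply: (cocomm_eqs_of_proj pr).
Qed.

Lemma R_HH_proj : R = R_HH W X Y Z.
Proof. by apply: tensor_ext; apply: (pr_HH pr). Qed.

End Necessity.

(** * The identities in terms of action and coaction *)

Section Translation.
Variables (σ : {linear B ⨂ A -> A ⨂ B}) (τ : {linear A ⨂ B -> B ⨂ A}).
Hypothesis σ_act : forall (P : lmodType K) (f : A -> B -> P), bilin f -> forall b a,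
  ∑_(aσ ⊗ bσ <- σ (b ⊗ a)) f aσ bσ = ∑_(x ⊗ y <- ΔB b) f (iB x ▷ a) y.
Hypothesis τ_coact : forall (P : lmodType K) (f : B -> A -> P), bilin f -> forall a b,
  ∑_(bτ ⊗ aτ <- τ (a ⊗ b)) f bτ aτ = ∑_(c ⊗ a0 <- coact a) f (c * b) a0.

Lemma σ_act_ε (P : lmodType K) (f : A -> K^o -> P) b a : bilin f ->
  ∑_(aσ ⊗ bσ <- σ (b ⊗ a)) f aσ (εB bσ) = f (iB b ▷ a) 1.
Proof. by move=> bf; srw σ_act; apply: (counitrB (f := fun x k => f (iB x ▷ a) k)); lin. Qed.

Variables (W : B ⨂ B) (X : A ⨂ B) (Y : B ⨂ A) (Z : A ⨂ A).

Lemma C2P : C2 εB σ τ W X <-> C2_form W X.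
Proof.
apply: tensor_eq2 => P f bf a; push.
- srw σ_act_ε; inside rewrite scale1r; symmetry; srw R_HBE; inside rewrite mul_act; match_sums.
- srw τ_coact; match_sums.
Qed.

Lemma C3P : C3 εB σ τ W Y <-> C3_form W Y.
Proof.
apply: tensor_eq2 => P f bf a; push.
- srw σ_act_ε; inside rewrite scale1r; srw τ_coact; symmetry; srw R_BHE.
  inside rewrite mul_act; match_sums.
- match_sums.
Qed.

Lemma C4P : C4 εB σ Z <-> C4_form Z.
Proof.
apply: tensor_eq2 => P f bf b; push.
- by inside (rewrite linear_scale; last by lin).
- srw σ_act_ε; inside rewrite scale1r; srw σ_act; match_sums.
Qed.

Lemma C5P : C5 ΔB εB σ X <-> C5_form X.
Proof.
apply: tensor_eq2 => P f bf b; push; first by match_sums.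
srw σ_act_ε; inside rewrite scale1r; match_sums.
Qed.

Lemma C6P : C6 σ Y <-> C6_form Y.
Proof.
apply: tensor_eq2 => P f bf b; push; first by match_sums.
srw σ_act; match_sums.
Qed.

Lemma C7P : C7 ΔB W <-> C7_form W.
Proof. by apply: tensor_eq2 => P f bf b; push; match_sums. Qed.

Lemma C9P : C9 ΔA X <-> C9_form X.
Proof. by apply: tensor_eq3 => P f tf; push; match_sums. Qed.

Lemma C11P : C11 τ W X <-> C11_form W X.
Proof.
apply: tensor_eq3 => P f tf; push; last by match_sums.
srw τ_coact; match_sums.
Qed.

Lemma C13P : C13 ΔB W <-> C13_form W.
Proof. by apply: tensor_eq3 => P f tf; push; match_sums. Qed.

Lemma C17P : C17 ΔA Y <-> C17_form Y.
Proof. by apply: tensor_eq3 => P f tf; push; match_sums. Qed.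

Lemma C18P : C18 τ W Y <-> C18_form W Y.
Proof.
apply: tensor_eq3 => P f tf; push; last by match_sums.
srw τ_coact; match_sums.
Qed.

Lemma C19P : C19 ΔB W <-> C19_form W.
Proof. by apply: tensor_eq3 => P f tf; push; match_sums. Qed.

Lemma C16P : C16 ΔB εB σ W X <-> C16_form W X.
Proof.
apply: tensor_eq3 => P f tf; push; first by match_sums.
srw σ_act_ε; inside rewrite scale1r; symmetry; srw R_HBE; inside rewrite mul_act.
match_sums.
Qed.

Lemma C12P : C12 ΔB εB σ W Y <-> C12_form W Y.
Proof.
apply: tensor_eq3 => P f tf; push; first by match_sums.
srw σ_act_ε; inside rewrite scale1r; symmetry; srw R_BHE; inside rewrite mul_act.
match_sums.
Qed.

(** The remaining tensors contain [τ] applied to Z and X in places where the forms above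
    contain the action of [R_HB]; [C2_form] is the translation between the two. *)
Hypothesis c2 : C2_form W X.

Lemma C8P : C8 ΔA εB σ τ X Z <-> C8_form W X Z.
Proof.
apply: tensor_eq3 => P f tf; push; first by match_sums.
srw σ_act_ε; inside rewrite scale1r; srw τ_coact; srwr c2.
symmetry; srw R_AHE; inside rewrite mul_act.
match_sums.
Qed.

Lemma C10P : C10 εB σ τ W X Y Z <-> C10_form W X Y Z.
Proof.
apply: tensor_eq3 => P f tf; push.
- srw σ_act_ε; inside rewrite scale1r; srw τ_coact; srw τ_coact; srwr c2.
  symmetry; srw R_AHE; inside rewrite mul_act.
  match_sums.
- srw σ_act_ε; inside rewrite scale1r; symmetry; srw R_BHE; inside rewrite mul_act.
  match_sums.
Qed.

Lemma C14P : C14 ΔA εB σ τ X Y Z <-> C14_form W X Y Z.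
Proof.
apply: tensor_eq3 => P f tf; push; first by match_sums.
inside rewrite -scalerA.
srw σ_act_ε; srw σ_act_ε; inside rewrite !scale1r; srw τ_coact; srwr c2.
symmetry; srw R_HAE; srw R_AHE; inside rewrite !mul_act.
match_sums.
Qed.

Lemma C15P : C15 εB σ τ X Y Z <-> C15_form W X Y Z.
Proof.
apply: tensor_eq3 => P f tf; push.
- srw τ_coact; srw τ_coact; srwr c2; match_sums.
- inside rewrite -scalerA.
  srw σ_act_ε; srw σ_act_ε; inside rewrite !scale1r; srw τ_coact; srwr c2.
  symmetry; srw R_HAE; srw R_AHE; inside rewrite !mul_act.
  match_sums.
Qed.

Hypotheses (ne : normalized_data W X Y Z) (qe : hexagon_eqs W X Y Z).

(** The shape that α has too: both legs are in normal order, and [R_HB] enters only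
    through its action on A and through its second leg. *)
Lemma R_HH_expand (P : lmodType K) (f : H -> H -> P) : bilin f ->
  ∑_(r ⊗ r' <- R_HH W X Y Z) f r r' =
  ∑_(s ⊗ s' <- R_HB W X) ∑_(t ⊗ t' <- R_HB W X) ∑_(z ⊗ z' <- Z)
  ∑_(w ⊗ w' <- W) ∑_(y ⊗ y' <- Y)
    f (iA (s ▷ (t ▷ z)) * iB (w * y)) (iA (z' * (iB t' ▷ y')) * iB (s' * w')).
Proof.
move=> bf; srw (R_HH_HB_HA ne qe); srw R_HAE; inside rewrite mulrA.
eapply eq_trans;
  [under_sums ltac:(eapply (mul_iA_reorder (f := fun k => f (k * _) _)); lin) | cbv beta].
srw (R_HB_comull_pB2 ne qe); srw R_AHE; inside rewrite mul_act -mulrA -(bp_iBM bp).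
match_sums.
Qed.

Lemma alpha_expand (P : lmodType K) (f : A ⨂ B -> A ⨂ B -> P) : bilin f ->
  ∑_(r ⊗ r' <- qt_alpha εB σ τ W X Y Z) f r r' =
  ∑_(s ⊗ s' <- R_HB W X) ∑_(t ⊗ t' <- R_HB W X) ∑_(z ⊗ z' <- Z)
  ∑_(w ⊗ w' <- W) ∑_(y ⊗ y' <- Y)
    f ((s ▷ (t ▷ z)) ⊗ (w * y)) ((z' * (iB t' ▷ y')) ⊗ (s' * w')).
Proof.
move=> bf; rewrite -/(eval2 f _) /qt_alpha; push.
srw σ_act_ε; inside rewrite scale1r.
srw τ_coact; srw τ_coact; srw τ_coact; inside rewrite mulrA.
srwr coact_mul.
srwr c2; srwr c2.
match_sums.
Qed.

Lemma C1P : C1 ΔA εB σ τ W X Y Z <-> C1_form W X Y Z.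
Proof.
apply: tensor_eq2 => P f bf a; push.
- inside rewrite -!scalerA.
  srw σ_act_ε; srw σ_act_ε; srw σ_act_ε; inside rewrite !scale1r.
  srw τ_coact; srw τ_coact; srw τ_coact; inside rewrite !mulrA.
  srwr coact_mul.
  srwr c2; srwr c2.
  symmetry; srw R_HH_expand; inside rewrite !mul_act.
  match_sums.
- srw σ_act_ε; inside rewrite scale1r; srw τ_coact; inside rewrite mulr1; match_sums.
Qed.

End Translation.

Theorem qt_datumP (σ : {linear B ⨂ A -> A ⨂ B}) (τ : {linear A ⨂ B -> B ⨂ A}) W X Y Z :
  (forall (P : lmodType K) (f : A -> B -> P), bilin f -> forall b a,
    ∑_(aσ ⊗ bσ <- σ (b ⊗ a)) f aσ bσ = ∑_(x ⊗ y <- ΔB b) f (iB x ▷ a) y) ->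
  (forall (P : lmodType K) (f : B -> A -> P), bilin f -> forall a b,
    ∑_(bτ ⊗ aτ <- τ (a ⊗ b)) f bτ aτ = ∑_(c ⊗ a0 <- coact a) f (c * b) a0) ->
  qt_datum ΔA εA ΔB εB σ τ W X Y Z <->
  [/\ normalized_data W X Y Z, hexagon_eqs W X Y Z & cocomm_eqs W X Y Z].
Proof.
move=> hσ hτ; split=> [d | [ne qe qc]].
  have c2 := (C2P hσ hτ W X).1 (qt_C2 d).
  have ne : normalized_data W X Y Z by case: d.
  have qe : hexagon_eqs W X Y Z.
    split.
    - exact: (C8P hσ hτ Z c2).1 (qt_C8 d).
    - exact: (C9P X).1 (qt_C9 d).
    - exact: (C10P hσ hτ Y Z c2).1 (qt_C10 d).
    - exact: (C11P hτ W X).1 (qt_C11 d).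
    - exact: (C12P hσ W Y).1 (qt_C12 d).
    - exact: (C13P W).1 (qt_C13 d).
    - exact: (C14P hσ hτ Y Z c2).1 (qt_C14 d).
    - exact: (C15P hσ hτ Y Z c2).1 (qt_C15 d).
    - exact: (C16P hσ W X).1 (qt_C16 d).
    - exact: (C17P Y).1 (qt_C17 d).
    - exact: (C18P hτ W Y).1 (qt_C18 d).
    - exact: (C19P W).1 (qt_C19 d).
  split=> //; split.
  - exact: (C1P hσ hτ c2 ne qe).1 (qt_C1 d).
  - exact: c2.
  - exact: (C3P hσ hτ W Y).1 (qt_C3 d).
  - exact: (C4P hσ Z).1 (qt_C4 d).
  - exact: (C5P hσ X).1 (qt_C5 d).
  - exact: (C6P hσ Y).1 (qt_C6 d).
  - exact: (C7P W).1 (qt_C7 d).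
have c2 : C2_form W X := qc_C2 qc.
split; try by case: ne.
- exact: (C1P hσ hτ c2 ne qe).2 (qc_C1 qc).
- exact: (C2P hσ hτ W X).2 c2.
- exact: (C3P hσ hτ W Y).2 (qc_C3 qc).
- exact: (C4P hσ Z).2 (qc_C4 qc).
- exact: (C5P hσ X).2 (qc_C5 qc).
- exact: (C6P hσ Y).2 (qc_C6 qc).
- exact: (C7P W).2 (qc_C7 qc).
- exact: (C8P hσ hτ Z c2).2 (qe_C8 qe).
- exact: (C9P X).2 (qe_C9 qe).
- exact: (C10P hσ hτ Y Z c2).2 (qe_C10 qe).
- exact: (C11P hτ W X).2 (qe_C11 qe).
- exact: (C12P hσ W Y).2 (qe_C12 qe).
- exact: (C13P W).2 (qe_C13 qe).
- exact: (C14P hσ hτ Y Z c2).2 (qe_C14 qe).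
- exact: (C15P hσ hτ Y Z c2).2 (qe_C15 qe).
- exact: (C16P hσ W X).2 (qe_C16 qe).
- exact: (C17P Y).2 (qe_C17 qe).
- exact: (C18P hτ W Y).2 (qe_C18 qe).
- exact: (C19P W).2 (qe_C19 qe).
Qed.

End Biproduct.

(** * Smash biproducts as biproducts with a retract *)

Section Smash.
Variables (K : fieldType) (A B : algType K).
Variables (ΔA : {linear A -> A ⨂ A}) (εA : {scalar A}).
Variables (ΔB : {linear B -> B ⨂ B}) (εB : {scalar B}).
Variables (σ : {linear B ⨂ A -> A ⨂ B}) (τ : {linear A ⨂ B -> B ⨂ A}).
Hypothesis bialgH : smash_biproduct_bialgebra ΔA εA ΔB εB σ τ.

Local Notation mul := (smash_mul σ).
Local Notation comul := (smash_comul ΔA ΔB τ).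
Local Notation counit := (smash_counit εA εB).
Local Notation one := (smash_one A B).

Lemma counit_pure a b : counit (a ⊗ b) = εA a * εB b.
Proof.
rewrite /smash_counit.
by rewrite (sweedlerT (P := K^o) (f := fun a b => εA a * εB b)) //; lin.
Qed.

(** The counit maps 1 to 1, so the biproduct is not the zero ring. *)
Lemma one_neq0 : one <> 0.
Proof.
move=> one0; have := bialg_counit1 (sb_bialgebra bialgH); rewrite one0.
have lc : linear (counit : A ⨂ B -> K^o) by apply: (coalg_scalar (sb_coproduct bialgH)).
by rewrite (linearE0 lc) => /eqP; rewrite eq_sym oner_eq0.
Qed.

Definition smash_alg : algType K := algType_of (sb_product bialgH) one_neq0.
Local Notation H := smash_alg.
Definition smashΔ : {linear H -> H ⨂ H} :=
  linear_of (U := H) (V := H ⨂ H) (coalg_linear (sb_coproduct bialgH)).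

Lemma inA_linear : linear (fun a : A => a ⊗ (1 : B)). Proof. by lin. Qed.
Lemma inB_linear : linear (fun b : B => (1 : A) ⊗ b). Proof. by lin. Qed.
Lemma prA_linear : linear (fun t : A ⨂ B => ∑_(a ⊗ b <- t) εB b *: a).
Proof. by lin. Qed.
Lemma prB_linear : linear (fun t : A ⨂ B => ∑_(a ⊗ b <- t) εA a *: b).
Proof. by lin. Qed.
Definition inA : {linear A -> H} := linear_of (V := H) inA_linear.
Definition inB : {linear B -> H} := linear_of (V := H) inB_linear.
Definition prA : {linear H -> A} := linear_of (U := H) prA_linear.
Definition prB : {linear H -> B} := linear_of (U := H) prB_linear.

Lemma prA_pure a b : prA (a ⊗ b) = εB b *: a.
Proof. by apply: (sweedlerT (f := fun a b => εB b *: a)); lin. Qed.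
Lemma prB_pure a b : prB (a ⊗ b) = εA a *: b.
Proof. by apply: (sweedlerT (f := fun a b => εA a *: b)); lin. Qed.

Lemma mul_pure a b a' b' :
  mul (a ⊗ b) (a' ⊗ b') = ∑_(aσ ⊗ bσ <- σ (b ⊗ a')) (a * aσ) ⊗ (bσ * b').
Proof.
rewrite /smash_mul sweedlerT; last by lin.
by rewrite sweedlerT //; lin.
Qed.

Lemma comul_pure a b :
  comul (a ⊗ b) = ∑_(a1 ⊗ a2 <- ΔA a) ∑_(b1 ⊗ b2 <- ΔB b)
    ∑_(b1τ ⊗ a2τ <- τ (a2 ⊗ b1)) (a1 ⊗ b1τ) ⊗ (a2τ ⊗ b2).
Proof. by rewrite /smash_comul sweedlerT //; lin. Qed.

Lemma σ1l a : σ (1 ⊗ a) = a ⊗ 1.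
Proof.
have := alg_unitl (sb_product bialgH) (a ⊗ 1); rewrite /smash_one mul_pure.
by under eq_sweedler do rewrite mul1r mulr1; rewrite -tensor_decomp.
Qed.
Lemma σ1r b : σ (b ⊗ 1) = 1 ⊗ b.
Proof.
have := alg_unitr (sb_product bialgH) (1 ⊗ b); rewrite /smash_one mul_pure.
by under eq_sweedler do rewrite mul1r mulr1; rewrite -tensor_decomp.
Qed.

Lemma mul_inA a a' b : mul (a ⊗ 1) (a' ⊗ b) = (a * a') ⊗ b.
Proof. by rewrite mul_pure σ1l sweedlerT ?mul1r //; lin. Qed.
Lemma mul_inB a b b' : mul (a ⊗ b) (1 ⊗ b') = a ⊗ (b * b').
Proof. by rewrite mul_pure σ1r sweedlerT ?mulr1 //; lin. Qed.
Lemma inB_inA b a : mul (1 ⊗ b) (a ⊗ 1) = σ (b ⊗ a).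
Proof.
rewrite mul_pure; under eq_sweedler do rewrite mul1r mulr1.
by rewrite -tensor_decomp.
Qed.

Let coA := sb_coalgA bialgH.
Let coB := sb_coalgB bialgH.
Let coH := sb_coproduct bialgH.

Lemma comulE (P : lmodType K) (f : A ⨂ B -> A ⨂ B -> P) a b : bilin f ->
  ∑_(x ⊗ y <- comul (a ⊗ b)) f x y =
  ∑_(a1 ⊗ a2 <- ΔA a) ∑_(b1 ⊗ b2 <- ΔB b)
    ∑_(b1τ ⊗ a2τ <- τ (a2 ⊗ b1)) f (a1 ⊗ b1τ) (a2τ ⊗ b2).
Proof.
by move=> bf; rewrite comul_pure; rewrite -/(eval2 f _); push.
Qed.

Lemma sum_counits (P : lmodType K) (g : B -> A -> P) a b : bilin g ->
  ∑_(a1 ⊗ a2 <- ΔA a) ∑_(b1 ⊗ b2 <- ΔB b) ∑_(b1τ ⊗ a2τ <- τ (a2 ⊗ b1))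
    (εA a1 * εB b2) *: g b1τ a2τ =
  ∑_(bτ ⊗ aτ <- τ (a ⊗ b)) g bτ aτ.
Proof.
move=> bg; inside rewrite -scalerA; srw (counitlE coA); srw (counitrE coB).
by inside rewrite !scale1r.
Qed.

(** Apply [prA] to the left counit law of the smash coproduct. *)
Lemma τ_εB (P : lmodType K) (f : K^o -> A -> P) a b : bilin f ->
  ∑_(bτ ⊗ aτ <- τ (a ⊗ b)) f (εB bτ) aτ = f (εB b) a.
Proof.
apply: sweedler_scalarl.
have /(congr1 prA) := coalg_counitl coH (a ⊗ b).
rewrite prA_pure linear_sweedler; last by lin.
move=> <-; rewrite -(sum_counits (g := fun b a => εB b *: a)); last by lin.
symmetry; inside (rewrite linear_scale; last by lin).
rewrite (comulE (f := fun x y => counit x *: prA y)).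
  by inside rewrite counit_pure prA_pure scalerA mulrAC -scalerA.
have lc : scalar counit by apply: (coalg_scalar coH).
by lin.
Qed.

(** Apply [prB] to the right counit law of the smash coproduct. *)
Lemma τ_εA (P : lmodType K) (f : B -> K^o -> P) a b : bilin f ->
  ∑_(bτ ⊗ aτ <- τ (a ⊗ b)) f bτ (εA aτ) = f b (εA a).
Proof.
apply: sweedler_scalarr.
have /(congr1 prB) := coalg_counitr coH (a ⊗ b).
rewrite prB_pure linear_sweedler; last by lin.
move=> <-; rewrite -(sum_counits (g := fun b a => εA a *: b)); last by lin.
symmetry; inside (rewrite linear_scale; last by lin).
rewrite (comulE (f := fun x y => counit y *: prB x)).
  by inside rewrite counit_pure prB_pure scalerA mulrC (mulrC (εA _) (εB _)) mulrA -scalerA.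
have lc : scalar counit by apply: (coalg_scalar coH).
by lin.
Qed.

Hypotheses (conormalσ : right_conormal εA σ) (normalτ : right_normal τ).

Lemma counitE t : counit t = εB (prB t).
Proof.
have lc : linear (counit : A ⨂ B -> K^o) by apply: (coalg_scalar coH).
apply: (eq_on_pure lc (g := fun t => εB (prB t) : K^o)); first by lin.
by move=> a b; rewrite counit_pure prB_pure linearZ.
Qed.

Lemma counitE' t : counit t = εA (prA t).
Proof.
have lc : linear (counit : A ⨂ B -> K^o) by apply: (coalg_scalar coH).
apply: (eq_on_pure lc (g := fun t => εA (prA t) : K^o)); first by lin.
by move=> a b; rewrite counit_pure prA_pure linearZ mulrC.
Qed.

(** Right conormality is used for the multiplicativity of [prB], right normality for the
    compatibility of [inB] with the comultiplications.  All other fields come from the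
    unit and counit laws of the smash structures. *)
Lemma smash_radford_biproduct : radford_biproduct ΔA εA ΔB εB smashΔ inA inB prA prB.
Proof.
have [εA1 εAM] := sb_counitA bialgH.
have [εB1 εBM] := sb_counitB bialgH.
have bH := sb_bialgebra bialgH.
have prBM : {morph prB : x y / x * y}.
  move=> x y.
  apply: (eq_on_pure (f := fun x : H => prB (x * y))
    (g := fun x : H => prB x * prB y));
    [by lin | by lin |] => a b.
  apply: (eq_on_pure (f := fun y : H => prB ((a ⊗ b : H) * y))
    (g := fun y : H => prB (a ⊗ b) * prB y));
    [by lin | by lin |] => a' b'.
  rewrite [_ * _]mul_pure linear_sweedler; last by lin.
  rewrite !prB_pure -scalerAl -scalerAr.
  transitivity (εA a *: ((∑_(aσ ⊗ bσ <- σ (b ⊗ a')) εA aσ *: bσ) * b')); last first.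
    by rewrite conormalσ -scalerAl.
  rewrite (linear_sweedler (g := fun x => εA a *: (x * b'))); last by lin.
  by inside rewrite prB_pure εAM -scalerA scalerAl.
split.
- have cE x : counit x = εB (prB x) := counitE x.
  case: coH => lD lc ca cl cr; split=> //; first by lin.
  + by move=> h; rewrite -[RHS]cl; apply: eq_sweedler => x y; rewrite cE.
  + by move=> h; rewrite -[RHS]cr; apply: eq_sweedler => x y; rewrite cE.
- exact: coA.
- exact: coB.
- exact: bialg_comulM bH.
- by move=> h; rewrite -counitE -counitE'.
- exact: εBM.
- exact: εB1.
- by move=> a a'; rewrite [RHS]mul_inA.
- by [].
- by move=> b b'; rewrite [RHS]mul_inB.
- by [].
- exact: prBM.
- by rewrite [LHS]prB_pure εA1 scale1r.
- by move=> a; rewrite [LHS]prA_pure εB1 scale1r.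
- by move=> a; rewrite [LHS]prB_pure εA1 scale1r.
- by move=> a; rewrite [LHS]prB_pure.
- move=> h b.
  apply: (eq_on_pure (f := fun h : H => prA (h * inB b))
    (g := fun h : H => εB b *: prA h));
    [by lin | by lin |] => a c.
  by rewrite [_ * _]mul_inB !prA_pure εBM scalerA mulrC.
- move=> a h.
  apply: (eq_on_pure (f := fun h : H => prA (inA a * h))
    (g := fun h : H => a * prA h));
    [by lin | by lin |] => a' b.
  by rewrite [_ * _]mul_inA !prA_pure scalerAr.
- move=> P f bf b; rewrite [LHS]comulE //.
  rewrite (sb_unitA bialgH) sweedlerT; last by lin.
  by within rewrite normalτ; srw sweedlerT.
- move=> P f bf h.
  apply: (eq_on_pure (f := fun h : H => ∑_(x ⊗ y <- ΔB (prB h)) f x y)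
    (g := fun h : H => ∑_(x ⊗ y <- smashΔ h) f (prB x) (prB y)));
    [by lin | by lin |] => a b.
  rewrite [RHS](comulE (f := fun x y : H => f (prB x) (prB y))); last by lin.
  symmetry; inside rewrite !prB_pure.
  inside (rewrite linear_scale; last by lin).
  inside (rewrite (linear_scale (g := fun x => f x _)); last by lin).
  srw τ_εA; srw (counitlE coA); inside rewrite scale1r.
  rewrite prB_pure (linear_scale (g := fun x => ∑_(x ⊗ y <- ΔB x) f x y)); last by lin.
  by rewrite linear_sweedler //; lin.
- move=> P f bf h.
  apply: (eq_on_pure (f := fun h : H => ∑_(x ⊗ y <- ΔA (prA h)) f x y)
    (g := fun h : H => ∑_(x ⊗ y <- smashΔ h) f (prA x) (prA y)));
    [by lin | by lin |] => a b.
  rewrite [RHS](comulE (f := fun x y : H => f (prA x) (prA y))); last by lin.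
  symmetry; inside rewrite !prA_pure.
  inside (rewrite linear_scale; last by lin).
  inside (rewrite (linear_scale (g := fun x => f x _)); last by lin).
  srw τ_εB; srw (counitrE coB); inside rewrite scale1r.
  rewrite prA_pure (linear_scale (g := fun x => ∑_(x ⊗ y <- ΔA x) f x y)); last by lin.
  by rewrite linear_sweedler //; lin.
- move=> h; rewrite [LHS]tensor_decomp.
  apply: (eq_on_pure (P := H) (f := fun h : H => ∑_(a ⊗ b <- h) a ⊗ b)
    (g := fun h : H => ∑_(x ⊗ y <- smashΔ h) inA (prA x) * inB (prB y)));
    [by lin | by lin |] => a b.
  rewrite [RHS](comulE (f := fun x y : H => inA (prA x) * inB (prB y))); last by lin.
  rewrite sweedlerT; last by lin.
  symmetry; inside rewrite [_ * _]mul_inB !prA_pure prB_pure mul1r.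
  suff factor_pure (P : lmodType K) (g : A -> B -> P) : bilin g ->
      ∑_(a1 ⊗ a2 <- ΔA a) ∑_(b1 ⊗ b2 <- ΔB b) ∑_(b1τ ⊗ a2τ <- τ (a2 ⊗ b1))
        g (εB b1τ *: a1) (εA a2τ *: b2) = g a b.
    by apply: (factor_pure _ (@tens K A B)); lin.
  move=> bg.
  inside (rewrite linear_scale; last by lin).
  inside (rewrite (linear_scale (g := fun x => g x _)); last by lin).
  by srw τ_εB; srw (counitlE coB); srw (counitrE coA); rewrite !scale1r.
- move=> a; apply: tensor_ext => P f bf.
  rewrite [LHS]comulE // (sweedler_sum _ _ bf).
  rewrite [RHS](comulE (f := fun x y : H => ∑_(x ⊗ y <- x ⊗ inA (prA y)) f x y)); last by lin.
  rewrite (sb_unitB bialgH).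
  apply: eq_sweedler => a1 a2; rewrite !sweedlerT; [|by lin|by lin].
  apply: eq_sweedler => b a'; rewrite sweedlerT // prA_pure εB1 scale1r //.
Qed.

Local Notation bp := smash_radford_biproduct.
Local Notation "h ▷ a" := (act inA prA h a) (at level 40, left associativity).

(** In H, [σ (b ⊗ a)] is the product of [1 ⊗ b] and [a ⊗ 1], of which the right-hand side is
    the normal ordering. *)
Lemma smash_σ (P : lmodType K) (f : A -> B -> P) : bilin f -> forall b a,
  ∑_(aσ ⊗ bσ <- σ (b ⊗ a)) f aσ bσ = ∑_(x ⊗ y <- ΔB b) f (inB x ▷ a) y.
Proof.
move=> bf b a.
have := mul_iB_iA_reorder bp (f := fun h : H => ∑_(x ⊗ y <- h) f x y) b a.
rewrite [inB b * inA a]inB_inA => ->; last by lin.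
by apply: eq_sweedler => x y; rewrite [_ * _]mul_inB mul1r sweedlerT.
Qed.

(** The right-hand side is [(pB ⊗ pA) (Δ (a ⊗ b))], where the counits remove all but [τ]. *)
Lemma smash_τ (P : lmodType K) (f : B -> A -> P) : bilin f -> forall a b,
  ∑_(bτ ⊗ aτ <- τ (a ⊗ b)) f bτ aτ =
  ∑_(c ⊗ a0 <- coact smashΔ inA prA prB a) f (c * b) a0.
Proof.
move=> bf a b; rewrite -(comul_mulB bp) // [inA a * inB b]mul_inB mul1r.
rewrite [RHS](comulE (f := fun x y : H => f (prB x) (prA y))); last by lin.
symmetry; inside rewrite prB_pure prA_pure.
inside (rewrite linear_scale; last by lin).
inside (rewrite (linear_scale (g := fun x => f x _)); last by lin).
by inside rewrite scalerA mulrC; rewrite sum_counits.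
Qed.

End Smash.

(** * The quasitriangularity axioms on multilinear maps *)

Section TensorMul.
Variables (K : fieldType) (U V : lmodType K) (mU : U -> U -> U) (mV : V -> V -> V).
Hypotheses (bU : bilin mU) (bV : bilin mV).

Lemma tensor_mul_bilin : bilin (tensor_mul mU mV).
Proof. by rewrite /tensor_mul; lin. Qed.

Lemma tensor_mul_pure u v u' v' :
  tensor_mul mU mV (u ⊗ v) (u' ⊗ v') = mU u u' ⊗ mV v v'.
Proof. by rewrite /tensor_mul sweedlerT ?sweedlerT //; lin. Qed.
End TensorMul.

Lemma eval2_tensor_mul (K : fieldType) (U V P : lmodType K) (mU : U -> U -> U)
    (mV : V -> V -> V) (f : U -> V -> P) (s t : U ⨂ V) :
  bilin mU -> bilin mV -> bilin f ->
  eval2 f (tensor_mul mU mV s t) =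
  ∑_(u ⊗ v <- s) ∑_(u' ⊗ v' <- t) f (mU u u') (mV v v').
Proof. by move=> bU bV bf; rewrite /tensor_mul; push. Qed.

Lemma bilin_sweedler2 (K : fieldType) (U V U' V' P Q R : lmodType K) (m : P -> Q -> R)
    (s : U ⨂ V) (t : U' ⨂ V') (f : U -> V -> P) (g : U' -> V' -> Q) : bilin m ->
  m (∑_(u ⊗ v <- s) f u v) (∑_(u' ⊗ v' <- t) g u' v') =
  ∑_(u ⊗ v <- s) ∑_(u' ⊗ v' <- t) m (f u v) (g u' v').
Proof.
case=> ml mr; rewrite (linear_sweedler _ _ (ml _)); apply: eq_sweedler => u v.
exact: (linear_sweedler _ _ (mr _)).
Qed.

Section Quasi.
Variables (K : fieldType) (H : algType K) (D : {linear H -> H ⨂ H}).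
Variable R : H ⨂ H.

Lemma mul3_legs (f g : H -> H -> H ⨂ H ⨂ H) :
  mul3 *%R (∑_(r ⊗ r' <- R) f r r') (∑_(r ⊗ r' <- R) g r r') =
  ∑_(r ⊗ r' <- R) ∑_(q ⊗ q' <- R) mul3 *%R (f r r') (g q q').
Proof.
apply: bilin_sweedler2; apply: tensor_mul_bilin; last by lin.
by apply: tensor_mul_bilin; lin.
Qed.

Lemma mul3_pure (x y z x' y' z' : H) :
  mul3 *%R (x ⊗ y ⊗ z) (x' ⊗ y' ⊗ z') = (x * x') ⊗ (y * y') ⊗ (z * z').
Proof.
rewrite /mul3 tensor_mul_pure /mul2; [|by apply: tensor_mul_bilin; lin|by lin].
by rewrite tensor_mul_pure //; lin.
Qed.

Lemma QT2P : ∑_(r ⊗ r' <- R) D r ⊗ r' = mul3 *%R (leg13 1 R) (leg23 1 R) <->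
  (forall (P : lmodType K) (f : H -> H -> H -> P), trilin f ->
    ∑_(r ⊗ r' <- R) ∑_(x ⊗ y <- D r) f x y r' =
    ∑_(r ⊗ r' <- R) ∑_(q ⊗ q' <- R) f r q (r' * q')).
Proof.
apply: tensor_eq3 => P f tf; first by push.
rewrite /leg13 /leg23 mul3_legs.
under eq_sweedler do under eq_sweedler do rewrite mul3_pure mulr1 mul1r.
by push.
Qed.

Lemma QT3P :
  ∑_(r ⊗ r' <- R) ∑_(x ⊗ y <- D r') r ⊗ x ⊗ y = mul3 *%R (leg13 1 R) (leg12 1 R) <->
  (forall (P : lmodType K) (f : H -> H -> H -> P), trilin f ->
    ∑_(r ⊗ r' <- R) ∑_(x ⊗ y <- D r') f r x y =
    ∑_(r ⊗ r' <- R) ∑_(q ⊗ q' <- R) f (r * q) q' r').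
Proof.
apply: tensor_eq3 => P f tf; first by push.
rewrite /leg13 /leg12 mul3_legs.
under eq_sweedler do under eq_sweedler do rewrite mul3_pure mulr1 mul1r.
by push.
Qed.

Lemma QT4P :
  (forall h, mul2 *%R R (D h) = mul2 *%R (flip (D h)) R) <->
  (forall h, almost_cocomm D R (fun k => k) (fun k => k) h).
Proof.
have bm : bilin ( *%R : H -> H -> H) by lin.
have [to from] := @tensor_eq2 _ H H H
  (fun h => mul2 *%R R (D h)) (fun h => mul2 *%R (flip (D h)) R)
  (fun P f h => ∑_(r ⊗ r' <- R) ∑_(x ⊗ y <- D h) f (r * x) (r' * y))
  (fun P f h => ∑_(r ⊗ r' <- R) ∑_(x ⊗ y <- D h) f (y * r) (x * r'))
  (fun P f bf h => eval2_tensor_mul _ _ bm bm bf)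
  ltac:(by move=> P f bf h; rewrite /mul2 eval2_tensor_mul // sweedler_exchange;
          apply: eq_sweedler => r r'; srw flipE).
by split=> [c h P f bf | c]; [exact: to | apply: from => P f bf h; apply: c].
Qed.
End Quasi.

(** * Quasitriangular structures of smash biproducts *)

Section Main.
Variables (K : fieldType) (A B : algType K).
Variables (ΔA : {linear A -> A ⨂ A}) (εA : {scalar A}).
Variables (ΔB : {linear B -> B ⨂ B}) (εB : {scalar B}).
Variables (σ : {linear B ⨂ A -> A ⨂ B}) (τ : {linear A ⨂ B -> B ⨂ A}).
Hypothesis bialgH : smash_biproduct_bialgebra ΔA εA ΔB εB σ τ.
Hypotheses (conormalσ : right_conormal εA σ) (normalτ : right_normal τ).
Local Notation H := (smash_alg bialgH).
Local Notation D := (smashΔ bialgH).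
Local Notation bp := (smash_radford_biproduct bialgH conormalσ normalτ).

Lemma quasitriangular_quasi_R (R : H ⨂ H) :
  quasitriangular (smash_mul σ) (smash_one A B)
      (smash_comul ΔA ΔB τ) (smash_counit εA εB) R <-> quasi_R εB D (prB bialgH) R.
Proof.
have cE := counitE bialgH.
split.
- case=> [[n1 n2] q2 q3 q4]; split.
  + by rewrite -[RHS]n1; apply: eq_sweedler => x y; rewrite -cE.
  + by rewrite -[RHS]n2; apply: eq_sweedler => x y; rewrite -cE.
  + exact: (QT2P D R).1 q2.
  + exact: (QT3P D R).1 q3.
  + exact: (QT4P D R).1 q4.
- case=> n1 n2 q2 q3 q4; split.
  + split.
    * by rewrite -[RHS]n1; apply: eq_sweedler => x y; rewrite cE.
    * by rewrite -[RHS]n2; apply: eq_sweedler => x y; rewrite cE.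
  + exact: (QT2P D R).2 q2.
  + exact: (QT3P D R).2 q3.
  + exact: (QT4P D R).2 q4.
Qed.

Local Notation iA := (inA bialgH).
Local Notation iB := (inB bialgH).
Local Notation pA := (prA bialgH).
Local Notation pB := (prB bialgH).
Local Notation σP := (smash_σ bialgH conormalσ normalτ).
Local Notation τP := (smash_τ bialgH conormalσ normalτ).

Lemma smash_datumP W X Y Z :
  qt_datum ΔA εA ΔB εB σ τ W X Y Z <->
  [/\ normalized_data εA εB W X Y Z, hexagon_eqs ΔA ΔB D iA iB pA pB W X Y Z
    & cocomm_eqs ΔA ΔB εB D iA iB pA pB W X Y Z].
Proof. by apply: (qt_datumP bp); [exact: σP | exact: τP]. Qed.

Lemma smash_alphaE W X Y Z : qt_datum ΔA εA ΔB εB σ τ W X Y Z ->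
  qt_alpha εB σ τ W X Y Z = R_HH iA iB pA W X Y Z.
Proof.
move=> /smash_datumP[ne qe qc]; apply: tensor_ext => P f bf.
rewrite (alpha_expand bp σP τP Y Z (qc_C2 qc)) //.
rewrite (R_HH_expand bp ne qe bf).
do 5 (apply: eq_sweedler => ? ?).
by rewrite ![iA _ * iB _](mul_inB bialgH) !mul1r.
Qed.

Lemma quasitriangularP (R : H ⨂ H) :
  quasitriangular (smash_mul σ) (smash_one A B)
      (smash_comul ΔA ΔB τ) (smash_counit εA εB) R <->
  exists W X Y Z, qt_datum ΔA εA ΔB εB σ τ W X Y Z /\ R = qt_alpha εB σ τ W X Y Z.
Proof.
split=> [/quasitriangular_quasi_R qR | [W [X [Y [Z [d ->]]]]]].
  exists (proj_pair R pB pB), (proj_pair R pA pB), (proj_pair R pB pA), (proj_pair R pA pA).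
  have d : qt_datum ΔA εA ΔB εB σ τ
      (proj_pair R pB pB) (proj_pair R pA pB) (proj_pair R pB pA) (proj_pair R pA pA).
    apply/smash_datumP; split.
    - exact: (proj_normalized bp qR).
    - exact: (proj_hexagon bp qR).
    - exact: (proj_cocomm bp qR).
  split=> //; rewrite smash_alphaE //; exact: (R_HH_proj bp qR).
rewrite smash_alphaE //; apply/quasitriangular_quasi_R.
by have /smash_datumP[ne qe qc] := d; apply: (R_HH_quasi bp).
Qed.

End Main.

Theorem corollary4p1 (K : fieldType) (A B : algType K)
    (ΔA : {linear A -> A ⨂ A}) (εA : {scalar A})
    (ΔB : {linear B -> B ⨂ B}) (εB : {scalar B})
    (σ : {linear B ⨂ A -> A ⨂ B}) (τ : {linear A ⨂ B -> B ⨂ A})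
    (bialgH : smash_biproduct_bialgebra ΔA εA ΔB εB σ τ)
    (conormalσ : right_conormal εA σ) (normalτ : right_normal τ) :
  let is_qt (R : (A ⨂ B) ⨂ (A ⨂ B)) :=
    quasitriangular (smash_mul σ) (smash_one A B)
      (smash_comul ΔA ΔB τ) (smash_counit εA εB) R in
  ((exists R : (A ⨂ B) ⨂ (A ⨂ B), is_qt R) <->
   (exists (W : B ⨂ B) (X : A ⨂ B) (Y : B ⨂ A) (Z : A ⨂ A),
      qt_datum ΔA εA ΔB εB σ τ W X Y Z)) /\
  (forall R : (A ⨂ B) ⨂ (A ⨂ B),
     is_qt R <->
     exists (W : B ⨂ B) (X : A ⨂ B) (Y : B ⨂ A) (Z : A ⨂ A),
       qt_datum ΔA εA ΔB εB σ τ W X Y Z /\ R = qt_alpha εB σ τ W X Y Z).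
Proof.
move=> is_qt; have qtP := quasitriangularP (bialgH := bialgH) conormalσ normalτ.
split; last exact: qtP.
split=> [[R /qtP [W [X [Y [Z [d _]]]]]] | [W [X [Y [Z d]]]]].
  by exists W, X, Y, Z.
by exists (qt_alpha εB σ τ W X Y Z); apply/qtP; exists W, X, Y, Z.
Qed.
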